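(* Let $M$ be a symmetric positive definite real $n\times n$ matrix with distinct (real positive) eigenvalues $\lambda_1<\lambda_2<\dots<\lambda_p$ with multiplicities $h_1,\dots,h_p$ respectively. Then: (a) for all integers $0\le u_i\le h_i$ ($1\le i\le p$), the manifold $\mathcal{SSR}(M)_{(u_1,\dots,u_p)}$ is diffeomorphic to the product of homogeneous spaces $$\prod_{i=1}^p\frac{\mathcal{O}_{h_i}}{\mathcal{O}_{u_i}\oplus\mathcal{O}_{v_i}},\qquad v_i=h_i-u_i$$ (where $\dfrac{\mathcal{O}_{h_i}}{\mathcal{O}_{u_i}\oplus\mathcal{O}_{v_i}}$ is diffeomorphic to the real Grassmannian $\mathbb{G}_{u_i}(\mathbb{R}^{h_i})$); (b) the connected components of $\mathcal{SSR}(M)$ are the manifolds $\mathcal{SSR}(M)_{(u_1,\dots,u_p)}$, and each of them is a compact totally geodesic homogeneous semi-Riemannian submanifold of $(GL_n,g)$, where $g$ is the trace metric.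
   Context: $GL_n$ is the group of real non-singular $n\times n$ matrices, $\mathcal{O}_n$ the group of real orthogonal $n\times n$ matrices. The trace metric $g$ on $GL_n$ is the semi-Riemannian metric $g_A(V,W)=\mathrm{tr}(A^{-1}VA^{-1}W)$ for $A\in GL_n$ and $V,W\in T_A(GL_n)=M_n$ (real $n\times n$ matrices). For $M$ symmetric positive definite, $\mathcal{SSR}(M)$ is the set of all real symmetric matrices $Y$ with $Y^2=M$. If $M$ has distinct eigenvalues $\lambda_1<\dots<\lambda_p$ of multiplicities $h_1,\dots,h_p$ and $0\le u_i\le h_i$, then $\mathcal{SSR}(M)_{(u_1,\dots,u_p)}$ is the set of $Y\in\mathcal{SSR}(M)$ having, for every $i$, eigenvalue $\sqrt{\lambda_i}$ with multiplicity $u_i$ and eigenvalue $-\sqrt{\lambda_i}$ with multiplicity $h_i-u_i$; with $u:=\sum_iu_i$, it is regarded as a submanifold of the manifold of non-singular real symmetric matrices with $u$ positive and $n-u$ negative eigenvalues. $\mathcal{O}_u\oplus\mathcal{O}_v$ denotes the group of block-diagonal matrices $A\oplus B$ with $A\in\mathcal{O}_u$, $B\in\mathcal{O}_v$, a subgroup of $\mathcal{O}_{u+v}$; blocks of size $0$ are omitted. $\mathbb{G}_u(\mathbb{R}^h)$ is the Grassmannian of $u$-dimensional linear subspaces of $\mathbb{R}^h$. *)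

(* Defs.v *)
From HB Require Import structures.
From mathcomp Require Import all_boot all_order all_algebra.
From mathcomp Require Import all_classical all_reals all_analysis.
Set Implicit Arguments.
Unset Strict Implicit.
Unset Printing Implicit Defensive.
Import Order.TTheory GRing.Theory Num.Theory.
Import numFieldNormedType.Exports.
Local Open Scope classical_set_scope.
Local Open Scope ring_scope.

(* Only used with E finite-dimensional, where f is C^(k+1) on the open set U
   iff it is differentiable on U and all its directional derivatives are C^k. *)
Fixpoint Ck {R : realType} {E F : normedModType R} (k : nat) (U : set E)
    (f : E -> F) : Prop :=
  match k with
  | 0%N => forall x, U x -> {for x, continuous f}
  | k'.+1 => (forall x, U x -> differentiable f x) /\
             (forall v : E, Ck k' U ('D_v f))
  end.

Definition smooth_on {R : realType} {E F : normedModType R} (U : set E)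
    (f : E -> F) : Prop :=
  forall k, Ck k U f.

(* A map on an arbitrary subset S of E is smooth when it extends, locally
   around each point of S, to a smooth map on an open set of E. *)
Definition smooth_subset {R : realType} {E F : normedModType R} (S : set E)
    (f : E -> F) : Prop :=
  forall x, S x -> exists U : set E, exists g : E -> F,
    [/\ open U, U x, smooth_on U g & forall y, S y -> U y -> f y = g y].

(* A manifold is a set X of points of a type T with an atlas of local
   parametrizations R^d > pdom -> X (the inverses of the charts). The topology
   of X is the one induced by the atlas. *)
Record param (R : realType) (d : nat) (T : Type) := Param {
  pdom : set 'rV[R]_d;
  pfun :> 'rV[R]_d -> T }.

Definition pimage {R : realType} {d : nat} {T : Type} (p : param R d T) :
    set T :=
  pfun p @` pdom p.

(* The expression q^-1 \o f \o p of f in the coordinates p and q has an open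
   domain and is smooth. *)
Definition smooth_in_coords {R : realType} {d e : nat} {T T' : Type}
    (p : param R d T) (q : param R e T') (f : T -> T') : Prop :=
  let W := [set x | pdom p x /\ pimage q (f (p x))] in
  open W /\
  exists2 tau : 'rV[R]_d -> 'rV[R]_e, smooth_on W tau &
    forall x, W x -> pdom q (tau x) /\ q (tau x) = f (p x).

Definition is_atlas {R : realType} {d : nat} {T : Type} (X : set T)
    (A : set (param R d T)) : Prop :=
  [/\ forall p, A p ->
        [/\ open (pdom p), {in pdom p &, injective p} & pimage p `<=` X],
      forall x, X x -> exists2 p, A p & pimage p x
    & forall p q, A p -> A q -> smooth_in_coords p q id].

Definition atlas_open {R : realType} {d : nat} {T : Type} (X : set T)
    (A : set (param R d T)) (W : set T) : Prop :=
  W `<=` X /\ forall p, A p -> open [set x | pdom p x /\ W (p x)].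

Definition smooth_manifold {R : realType} {d : nat} {T : Type} (X : set T)
    (A : set (param R d T)) : Prop :=
  [/\ is_atlas X A,
      (forall x y, X x -> X y -> x <> y -> exists U V : set T,
        [/\ atlas_open X A U, atlas_open X A V, U x, V y & U `&` V = set0])
    & (exists2 B : nat -> set T, forall k, atlas_open X A (B k) &
        forall W x, atlas_open X A W -> W x ->
          exists2 k, B k x & B k `<=` W)].

Definition smooth_map {R : realType} {d e : nat} {T T' : Type}
    (X : set T) (A : set (param R d T))
    (Y : set T') (B : set (param R e T')) (f : T -> T') : Prop :=
  (forall x, X x -> Y (f x)) /\
  (forall p q, A p -> B q -> smooth_in_coords p q f).

Definition diffeo_pair {R : realType} {d e : nat} {T T' : Type}
    (X : set T) (A : set (param R d T))
    (Y : set T') (B : set (param R e T')) (f : T -> T') (g : T' -> T) : Prop :=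
  [/\ smooth_map X A Y B f, smooth_map Y B X A g,
      forall x, X x -> g (f x) = x & forall y, Y y -> f (g y) = y].

Definition diffeomorphic {R : realType} {d e : nat} {T T' : Type}
    (X : set T) (A : set (param R d T))
    (Y : set T') (B : set (param R e T')) : Prop :=
  exists f g, diffeo_pair X A Y B f g.

Definition prod_set {m : nat} {T : 'I_m -> Type} (X : forall i, set (T i)) :
    set (forall i, T i) :=
  [set f | forall i, X i (f i)].

Definition prod_param {R : realType} {m : nat} {d : 'I_m -> nat}
    {T : 'I_m -> Type} (p : forall i, param R (d i) (T i)) :
    param R (\sum_i d i)%N (forall i, T i) :=
  Param [set x | forall i, pdom (p i) (submxrow x i)]
        (fun x i => p i (submxrow x i)).

Definition prod_atlas {R : realType} {m : nat} {d : 'I_m -> nat}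
    {T : 'I_m -> Type} (A : forall i, set (param R (d i) (T i))) :
    set (param R (\sum_i d i)%N (forall i, T i)) :=
  [set P | exists2 p, (forall i, A i (p i)) & P = prod_param p].

(* The diffeomorphisms from an open set of R^d onto a relatively open subset
   of S. *)
Definition submanifold_atlas {R : realType} {E : normedModType R} (d : nat)
    (S : set E) : set (param R d E) :=
  [set p | [/\ open (pdom p),
               exists2 O : set E, open O & pimage p = S `&` O,
               smooth_on (pdom p) p
             & exists2 chi : E -> 'rV[R]_d, smooth_subset (pimage p) chi &
                 forall x, pdom p x -> chi (p x) = x]].
Arguments submanifold_atlas {R E} d S _.

(* N is the ambient manifold, itself with the structure induced by E. *)
Definition embedded_submanifold {R : realType} {E : normedModType R} (d : nat)
    (S N : set E) : Prop :=
  S `<=` N /\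
  forall x, S x -> exists2 p, submanifold_atlas d S p & pimage p x.

Definition tangent_space {R : realType} {E : normedModType R} (d : nat)
    (S : set E) (x : E) : set E :=
  [set V | exists p : param R d E, exists u w : 'rV[R]_d,
     [/\ submanifold_atlas d S p, pdom p u, p u = x & V = 'd (pfun p) u w]].
Arguments tangent_space {R E} d S x _.

Definition left_coset {R : realType} {n : nat} (H : set 'M[R]_n)
    (A : 'M[R]_n) : set 'M[R]_n :=
  [set A *m B | B in H].

Definition homogeneous_space {R : realType} {n : nat} (G H : set 'M[R]_n) :
    set (set 'M[R]_n) :=
  left_coset H @` G.

(* The smooth structure of G / H is the unique one for which the projection
   pi : G -> G / H is smooth and has smooth local sections around every point.
   A parametrization p belongs to it iff its image is open for the quotient
   topology, p^-1 \o pi is smooth, and p lifts locally to a smooth map into G. *)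
Definition homogeneous_atlas {R : realType} {n : nat} (d : nat)
    (G H : set 'M[R]_n) : set (param R d (set 'M[R]_n)) :=
  [set p | let D := [set A | G A /\ pimage p (left_coset H A)] in
     [/\ [/\ open (pdom p), {in pdom p &, injective p}
           & pimage p `<=` homogeneous_space G H],
         exists2 O : set 'M[R]_n, open O & D = G `&` O,
         exists2 tau : 'M[R]_n -> 'rV[R]_d, smooth_subset D tau &
           forall A, D A -> pdom p (tau A) /\ p (tau A) = left_coset H A
       & forall x, pdom p x -> exists U : set 'rV[R]_d,
           exists s : 'rV[R]_d -> 'M[R]_n,
           [/\ open U, U x, smooth_on U s &
             forall y, pdom p y -> U y -> G (s y) /\ left_coset H (s y) = p y]]].
Arguments homogeneous_atlas {R n} d G H _.

Definition grassmannian {R : realType} (u h : nat) :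
    set {vspace 'rV[R]_h} :=
  [set S | \dim S = u].
Arguments grassmannian {R} u h _.

(* For an invertible B with rows b_1, ..., b_(u+v), this parametrizes the
   subspaces complementary to <b_(u+1), ..., b_(u+v)> as graphs of linear maps
   <b_1, ..., b_u> -> <b_(u+1), ..., b_(u+v)>. *)
Definition grassmannian_param {R : realType} (u v : nat)
    (B : 'M[R]_(u + v)) : param R (u * v)%N {vspace 'rV[R]_(u + v)} :=
  Param setT (fun x =>
    limg (linfun (mulmxr (row_mx 1%:M (vec_mx x : 'M[R]_(u, v)) *m B)
                  : 'rV[R]_u -> 'rV[R]_(u + v)))).

Definition grassmannian_atlas {R : realType} (u v : nat) :
    set (param R (u * v)%N {vspace 'rV[R]_(u + v)}) :=
  [set grassmannian_param B | B in [set B | B \in unitmx]].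
Arguments grassmannian_atlas {R} u v _.

Section SemiRiemannian.
Context {R : realType} {n : nat}.
Local Notation E := 'M[R]_n.

(* U is an open set of E and g : U -> bilinear forms on E a metric tensor. *)
Context (U : set E) (g : E -> E -> E -> R).

Definition nondegenerate_on (b : E -> E -> R) (T : set E) : Prop :=
  forall V, T V -> (forall W, T W -> b V W = 0) -> V = 0.

Definition negative_definite_on (b : E -> E -> R) (L : {vspace E}) : Prop :=
  forall V, V \in L -> V != 0 -> b V V < 0.

(* q is the largest dimension of a subspace of T on which b is negative
   definite. *)
Definition has_index (b : E -> E -> R) (T : set E) (q : nat) : Prop :=
  (exists L : {vspace E},
     [/\ [set` L] `<=` T, negative_definite_on b L & \dim L = q]) /\
  (forall L : {vspace E},
     [set` L] `<=` T -> negative_definite_on b L -> (\dim L <= q)%N).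

Definition semi_riemannian_submanifold (d : nat) (S : set E) : Prop :=
  embedded_submanifold d S U /\
  exists q : nat, forall A, S A ->
    nondegenerate_on (g A) (tangent_space d S A) /\
    has_index (g A) (tangent_space d S A) q.

(* Vector fields are maps E -> E that are smooth on U. *)
Definition levi_civita (nabla : (E -> E) -> (E -> E) -> E -> E) : Prop :=
  (forall X Y, smooth_on U X -> smooth_on U Y -> smooth_on U (nabla X Y)) /\
  forall X Y Z : E -> E, forall f : E -> R^o,
    smooth_on U X -> smooth_on U Y -> smooth_on U Z -> smooth_on U f ->
    forall A, U A ->
    [/\ nabla (fun B => f B *: X B + Y B) Z A =
          f A *: nabla X Z A + nabla Y Z A,
        nabla X (fun B => Y B + Z B) A = nabla X Y A + nabla X Z A,
        nabla X (fun B => f B *: Y B) A =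
          f A *: nabla X Y A + ('d f A (X A) : R) *: Y A,
        nabla X Y A - nabla Y X A = 'd Y A (X A) - 'd X A (Y A)
      & 'd (fun B => g B (Y B) (Z B) : R^o) A (X A) =
          g A (nabla X Y A) (Z A) + g A (Y A) (nabla X Z A)].

(* The second fundamental form, i.e. the component of nabla X Y normal to S for
   X and Y tangent to S, vanishes. *)
Definition totally_geodesic (d : nat) (S : set E) : Prop :=
  exists2 nabla, levi_civita nabla &
    forall X Y : E -> E, smooth_on U X -> smooth_on U Y ->
      (forall A, S A -> tangent_space d S A (X A)) ->
      (forall A, S A -> tangent_space d S A (Y A)) ->
      forall A, S A -> tangent_space d S A (nabla X Y A).

Definition isometry (d : nat) (S : set E) (f : E -> E) : Prop :=
  (exists f', diffeo_pair S (submanifold_atlas d S) S (submanifold_atlas d S)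
                f f') /\
  forall p : param R d E, submanifold_atlas d S p ->
    forall x v w, pdom p x ->
      g (f (p x)) ('d (f \o p) x v) ('d (f \o p) x w) =
      g (p x) ('d (pfun p) x v) ('d (pfun p) x w).

Definition homogeneous (d : nat) (S : set E) : Prop :=
  forall A B, S A -> S B -> exists2 f, isometry d S f & f A = B.

End SemiRiemannian.

Definition GLn {R : realType} (n : nat) : set 'M[R]_n :=
  [set A | A \in unitmx].
Arguments GLn {R} n _.

Definition trace_metric {R : realType} {n : nat} (A V W : 'M[R]_n) : R :=
  \tr (invmx A *m V *m invmx A *m W).

Definition orthogonal_group {R : realType} (n : nat) : set 'M[R]_n :=
  [set A | A *m A^T = 1%:M].
Arguments orthogonal_group {R} n _.

Definition block_orthogonal_group {R : realType} (u v : nat) :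
    set 'M[R]_(u + v) :=
  [set C | exists A B, [/\ orthogonal_group u A, orthogonal_group v B
                         & C = block_mx A 0 0 B]].
Arguments block_orthogonal_group {R} u v _.

Definition symmetric_posdef {R : realType} {n : nat} (M : 'M[R]_n) : Prop :=
  M^T = M /\ forall x : 'rV[R]_n, x != 0 -> 0 < (x *m M *m x^T) 0 0.

Definition eigen_multiplicity {R : realType} {n : nat} (A : 'M[R]_n) (a : R) :
    nat :=
  mup a (char_poly A).

Definition sym_signature {R : realType} (n u : nat) : set 'M[R]_n :=
  [set Y | Y^T = Y /\ exists s : seq R,
     [/\ char_poly Y = \prod_(a <- s) ('X - a%:P),
         count (fun a => 0 < a) s = u & count (fun a => a < 0) s = (n - u)%N]].
Arguments sym_signature {R} n u _.

Definition SSR {R : realType} {n : nat} (M : 'M[R]_n) : set 'M[R]_n :=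
  [set Y | Y^T = Y /\ Y *m Y = M].

Definition SSR_mult {R : realType} {n p : nat} (M : 'M[R]_n)
    (lam : 'I_p -> R) (h u : 'I_p -> nat) : set 'M[R]_n :=
  [set Y | SSR M Y /\ forall i,
     eigen_multiplicity Y (Num.sqrt (lam i)) = u i /\
     eigen_multiplicity Y (- Num.sqrt (lam i)) = (h i - u i)%N].

(* Main.v *)
From HB Require Import structures.
Require Import Defs.
From mathcomp Require Import all_boot all_order all_algebra perm.
From mathcomp Require Import spectral sesquilinear.
From mathcomp.real_closed Require Import complex.
From mathcomp Require Import all_classical all_reals all_analysis.
From mathcomp Require Import ring lra.
Import Order.TTheory GRing.Theory Num.Theory.
Import numFieldNormedType.Exports.
Set Implicit Arguments.
Unset Strict Implicit.
Unset Printing Implicit Defensive.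
Local Open Scope classical_set_scope.
Local Open Scope ring_scope.

(** The roots of [M] with prescribed multiplicities are the roots with a
    prescribed characteristic polynomial ([ssr_class]).  If [A] is one of them,
    the others are the [Q A Q^T] with [Q] orthogonal and commuting with [M]
    ([class_conj]), and everything follows from this description together with
    one explicit chart.

    The chart is a Cayley transform.  For [V] symmetric with [V A + A V = 0] the
    matrix [W = V A^-1 / 2] is skew and anticommutes with [A], and
    [V |-> (1 + W) A (1 + W)^-1] is a bijection from these [V] onto the roots [Y]
    with [Y + A] invertible, inverted by [W = (Y - A) (Y + A)^-1]
    ([cayleyP], [cayley_invP]).  Both directions are smooth and preserve the
    characteristic polynomial.  So each class is an embedded submanifold, open
    and closed in the set of all roots, with tangent space
    [{V | V^T = V, V A + A V = 0}] ([class_tangent_space]).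

    Part (b).  The set of roots is closed, and bounded because the squares of the
    entries of a row of a root sum to a diagonal entry of [M]; hence the classes
    are compact.  A class is connected because the [Q] above can be chosen without
    the eigenvalue -1, hence be joined to the identity by orthogonal matrices
    commuting with [M] ([class_path]).  On tangent vectors
    [tr (A^-1 V A^-1 V) = - tr (B B^T)] with [B = V A^-1], so the trace metric is
    negative definite there.  Its Levi-Civita connection is
    [dY(X) - (X A^-1 Y + Y A^-1 X) / 2]; differentiating the two equations of the
    tangent space along [X] shows that it preserves fields tangent to the class.
    Conjugations by [Q] are isometries, and they act transitively.

    Part (a).  For [M = 1] the class of [J = diag(1, .., 1, -1, .., -1)] is at once
    the homogeneous space, through [A H |-> A J A^T], and the Grassmannian, by
    sending an involution to its eigenspace for 1.  The given atlases of these two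
    spaces are turned into submanifold charts of the class
    ([homogeneous_chart_emb], [grassmannian_chart_emb]), after which smoothness of
    the maps between them is automatic ([smooth_in_coords_emb]).  The analytic
    input is a smooth local section of [A |-> A J A^T], obtained by smoothly
    orthonormalizing eigenvectors ([local_section]).  For general [M], orthonormal
    bases of its eigenspaces identify a class with the product of the classes of
    involutions of these eigenspaces ([frame_diffeo]). *)

(** * Closure properties of maps of class C^k *)

Section Calculus.
Context {R : realType}.
Implicit Types E F : normedModType R.

(** The differential is carried along with differentiability, so that
    differentials of two maps that agree near a point can be exchanged. *)
Lemma near_eq_is_diff E F (f g : E -> F) x :
  {near x, f =1 g} -> differentiable f x -> is_diff x g ('d f x).
Proof.
move=> fg df; have [dc deq] := (diff_locallyP _ _).1 df.
have geq : g \o shift x = cst (g x) + 'd f x +o_ 0 id.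
  apply/eqaddoP => e e0.
  have /eqaddoP/(_ e e0) := deq.
  have fgx : f x = g x by exact: nbhs_singleton fg.
  have : \forall h \near (0 : E), f (h + x) = g (h + x).
    have ct : (h + x) @[h --> (0 : E)] --> x.
      by rewrite -[X in _ --> X]add0r; apply: cvgD; [exact: cvg_id|exact: cvg_cst].
    exact: ct _ fg.
  apply: filterS2 => h /= e1.
  by rewrite !fctE /= fgx e1.
have h := diff_unique dc geq.
apply: DiffDef; last exact: h.
apply/diff_locallyP; rewrite h.
by split; [exact: dc|exact: geq].
Qed.

Lemma open_near_eq E F (U : set E) (f g : E -> F) x :
  open U -> U x -> (forall y, U y -> f y = g y) -> {near x, f =1 g}.
Proof.
move=> oU Ux fg; have : \near x, U x by exact: open_nbhs_nbhs.
by apply: filterS => y /fg.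
Qed.

Lemma CkS E F k (U : set E) (f : E -> F) : Ck k.+1 U f <->
  (forall x, U x -> differentiable f x) /\ (forall v, Ck k U ('D_v f)).
Proof. by []. Qed.

Lemma Ck_ext E F k (U : set E) (f g : E -> F) :
  open U -> (forall x, U x -> f x = g x) -> Ck k U f -> Ck k U g.
Proof.
move=> oU; elim: k f g => [|k IH] f g fg /=.
  move=> cf x Ux; have ne := open_near_eq oU Ux fg.
  move=> /= A; rewrite -(fg x Ux) => /(cf x Ux) h.
  have h1 : \forall y \near x, A (f y) by exact: h.
  suff : \forall y \near x, A (g y) by [].
  by apply: filterS2 ne h1 => y ->.
move=> /CkS[df Df]; split=> [x Ux|v].
  by have [] := near_eq_is_diff (open_near_eq oU Ux fg) (df x Ux).
apply: IH (Df v) => x Ux; apply: near_eq_derive.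
exact: (open_near_eq oU Ux fg).
Qed.

Lemma Ck_sub E F k (U V : set E) (f : E -> F) :
  V `<=` U -> Ck k U f -> Ck k V f.
Proof.
move=> VU; elim: k f => [|k IH] f /=; first by move=> h x /VU/h.
by move=> /CkS[df Df]; split=> [x /VU/df//|v]; apply: IH.
Qed.

Lemma CkW E F k (U : set E) (f : E -> F) : Ck k.+1 U f -> Ck k U f.
Proof.
elim: k f => [|k IH] f.
  by case=> df _ x /df /differentiable_continuous.
by case=> df Df; split=> // v; apply: IH.
Qed.

(** The conditions that make up [Ck] are imposed point by point, so being of
    class C^k is a local property. *)
Lemma Ck_pointwise E F k (U : set E) (f : E -> F) :
  (forall x, U x -> Ck k [set x] f) -> Ck k U f.
Proof.
elim: k f => [|k IH] f /= h.
  by move=> x Ux; apply: (h x Ux).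
split=> [x Ux|v]; first by case: (h x Ux) => + _; apply.
by apply: IH => x Ux; case: (h x Ux).
Qed.

Lemma Ck_cst E F k (U : set E) (a : F) : Ck k U (fun=> a).
Proof.
elim: k a => [|k IH] a /=; first by move=> x _; exact: cst_continuous.
split=> [x _|v]; first exact: differentiable_cst.
suff -> : 'D_v (fun=> a : F) = (fun=> 0 : F) by apply: IH.
by apply/funext => x; rewrite (derive_cst a).
Qed.

Lemma Ck_linear E F k (U : set E) (f : {linear E -> F}) :
  continuous f -> Ck k U f.
Proof.
move=> cf; case: k => [|k] /=; first by move=> x _; exact: cf.
split=> [x _|v]; first exact: linear_differentiable.
suff -> : 'D_v f = (fun=> f v) by apply: Ck_cst.
apply/funext => x; rewrite deriveE ?diff_lin //; exact: linear_differentiable.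
Qed.

(** Here and in the lemmas below the derivative of the combined map is again a
    combination of the given maps and of their derivatives, which makes the
    induction on [k] go through. *)
Lemma Ck_add E F k (U : set E) (f g : E -> F) : open U ->
  Ck k U f -> Ck k U g -> Ck k U (fun x => f x + g x).
Proof.
move=> oU; elim: k f g => [|k IH] f g /=.
  by move=> cf cg x Ux; apply: continuousD; [apply: cf|apply: cg].
move=> /CkS[df Df] /CkS[dg Dg]; split=> [x Ux|v].
  by apply: differentiableD; [apply: df|apply: dg].
apply: (@Ck_ext _ _ _ _ (fun x => 'D_v f x + 'D_v g x)) => //; last exact: IH.
by move=> x Ux; rewrite -deriveD //; apply: diff_derivable; [apply: df|apply: dg].
Qed.

Lemma Ck_mul E k (U : set E) (f g : E -> R^o) : open U ->
  Ck k U f -> Ck k U g -> Ck k U (fun x => f x * g x : R^o).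
Proof.
move=> oU; elim: k f g => [|k IH] f g.
  by move=> cf cg x Ux; apply: continuousM; [apply: cf|apply: cg].
move=> kf kg; have [/CkS[df Df] /CkS[dg Dg]] := (kf, kg); split=> [x Ux|v].
  by apply: differentiableM; [apply: df|apply: dg].
apply: (@Ck_ext _ _ _ _ (fun x => f x * 'D_v g x + g x * 'D_v f x)) => //.
  move=> x Ux; rewrite (_ : (fun _ => _ * _) = (f : E -> R) * g); last exact/funext.
  by rewrite deriveM //; apply: diff_derivable; [apply: df|apply: dg].
apply: (@Ck_add _ R^o _ _ (fun x => f x * 'D_v g x) (fun x => g x * 'D_v f x)) => //;
  by apply: IH => //; apply: CkW.
Qed.

Lemma Ck_inv E k (U : set E) (f : E -> R^o) : open U ->
  (forall x, U x -> f x != 0) -> Ck k U f -> Ck k U (fun x => (f x)^-1 : R^o).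
Proof.
move=> oU f0; elim: k => [|k IH].
  by move=> cf x Ux; apply: continuousV; [apply: f0|apply: cf].
move=> kf; have /CkS[df Df] := kf; split=> [x Ux|v].
  by apply: differentiableV; [apply: df|apply: f0].
apply: (@Ck_ext _ _ _ _ (fun x => (-1) * ((f x)^-1 * (f x)^-1) * 'D_v f x)) => //.
  move=> x Ux; rewrite deriveV; first last.
  - by apply: diff_derivable; apply: df.
  - exact: f0.
  by rewrite /GRing.scale /= ?expr2 ?invfM mulN1r.
have Vk : Ck k U (fun x => (f x)^-1 : R^o) by apply/IH/CkW.
apply: (@Ck_mul _ _ _ (fun x => (-1) * ((f x)^-1 * (f x)^-1))) => //.
apply: (@Ck_mul _ _ _ (fun=> (-1))) => //; first exact: (@Ck_cst _ R^o).
exact: (@Ck_mul _ _ _ (fun x => (f x)^-1)).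
Qed.

Lemma Ck_sqrt E k (U : set E) (f : E -> R^o) : open U ->
  (forall x, U x -> 0 < f x) -> Ck k U f -> Ck k U (fun x => Num.sqrt (f x) : R^o).
Proof.
move=> oU f0; elim: k => [|k IH].
  move=> cf x Ux; apply: continuous_comp; [exact: cf|exact: sqrt_continuous].
move=> kf; have /CkS[df Df] := kf.
have ds x : U x -> differentiable (Num.sqrt : R -> R) (f x).
  by move=> Ux; apply/derivable1_diffP; have [] := is_derive1_sqrt (f0 x Ux).
split=> [x Ux|v].
  by apply: (@differentiable_comp _ _ _ _ f); [apply: df|exact: ds].
apply: (@Ck_ext _ _ _ _ (fun x => (2 * Num.sqrt (f x))^-1 * 'D_v f x)) => //.
  move=> x Ux; rewrite [RHS]deriveE; last first.
    by apply: (@differentiable_comp _ _ _ _ f); [apply: df|exact: ds].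
  rewrite (diff_comp (df x Ux) (ds x Ux)) /= deriveE; last exact: df.
  have [_ dv] := is_derive1_sqrt (f0 x Ux).
  rewrite -dv -derive1E deriv1E /GRing.scale/=; last first.
    by have [] := is_derive1_sqrt (f0 x Ux).
  by rewrite mulrC derive1E.
apply: (@Ck_mul _ _ _ (fun x => (2 * Num.sqrt (f x))^-1)) => //.
apply: (@Ck_inv _ _ _ (fun x => 2 * Num.sqrt (f x))) => //.
  by move=> x Ux; rewrite mulf_neq0 ?pnatr_eq0 // gt_eqF // sqrtr_gt0 f0.
by apply: (@Ck_mul _ _ _ (fun=> 2)) => //; [exact: (@Ck_cst _ R^o)|apply/IH/CkW].
Qed.

Lemma Ck_sum E F k (U : set E) (I : Type) (r : seq I) (f : I -> E -> F) : open U ->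
  (forall i, Ck k U (f i)) -> Ck k U (fun x => \sum_(i <- r) f i x).
Proof.
move=> oU h; elim: r => [|i r IH].
  by apply: (@Ck_ext _ _ _ _ (fun=> 0)) (Ck_cst _ _ _) => // x _; rewrite big_nil.
apply: (@Ck_ext _ _ _ _ (fun x => f i x + \sum_(i <- r) f i x)) => //.
  by move=> x _; rewrite big_cons.
exact: Ck_add.
Qed.

Lemma Ck_prod E k (U : set E) (I : Type) (r : seq I) (f : I -> E -> R^o) : open U ->
  (forall i, Ck k U (f i)) -> Ck k U (fun x => \prod_(i <- r) f i x : R^o).
Proof.
move=> oU h; elim: r => [|i r IH].
  apply: (@Ck_ext _ R^o _ _ (fun=> (1 : R^o))) => //; last exact: (@Ck_cst _ R^o).
  by move=> x _; rewrite big_nil.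
apply: (@Ck_ext _ R^o _ _ (fun x => f i x * \prod_(i <- r) f i x)) => //.
  by move=> x _; rewrite big_cons.
exact: (@Ck_mul _ _ _ (f i) (fun x => \prod_(i <- r) f i x)).
Qed.

Lemma differentiable_mx E m n (f : E -> 'M[R]_(m, n)) x :
  (forall i j, differentiable (fun y => f y i j : R) x) -> differentiable f x.
Proof.
move=> h.
have -> : f = \sum_(i < m) \sum_(j < n) (fun y => f y i j *: delta_mx i j).
  apply/funext => y; rewrite {1}[f y]matrix_sum_delta fct_sumE.
  by apply: eq_bigr => i _; rewrite fct_sumE.
apply: differentiable_sum => i; apply: differentiable_sum => j.
exact: differentiableZl.
Qed.

Lemma differentiable_entry E m n (f : E -> 'M[R]_(m, n)) x i j :
  differentiable f x -> differentiable (fun y => f y i j : R) x.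
Proof. by move=> df; apply: (differentiable_comp df (differentiable_coord _ _ _)). Qed.

Lemma derive_entry E m n (f : E -> 'M[R]_(m, n)) x v i j :
  differentiable f x -> 'D_v f x i j = 'D_v (fun y => f y i j : R^o) x.
Proof. by move=> df; rewrite derive_mx ?mxE //; apply: diff_derivable. Qed.

Lemma Ck_entry E k (U : set E) m n (f : E -> 'M[R]_(m, n)) i j : open U ->
  Ck k U f -> Ck k U (fun x => f x i j : R^o).
Proof.
move=> oU; elim: k f => [|k IH] f.
  move=> cf x Ux; apply: (@continuous_comp _ _ _ f (fun A : 'M[R]_(m, n) => A i j)).
    exact: cf.
  exact: coord_continuous.
move=> /CkS[df Df]; split=> [x Ux|v].
  by apply: differentiable_entry; apply: df.
apply: Ck_ext (IH _ (Df v)) => // x Ux; exact/derive_entry/df.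
Qed.

Lemma continuous_mx (T : topologicalType) m n (f : T -> 'M[R]_(m, n)) x :
  (forall i j, {for x, continuous (fun y => f y i j : R^o)}) ->
  {for x, continuous f}.
Proof.
move=> h; apply/cvgrPdist_lt => e e0.
have : \forall y \near x, forall ij : 'I_m * 'I_n, `|f x ij.1 ij.2 - f y ij.1 ij.2| < e.
  apply: filter_forall => -[i j] /=.
  by have /cvgrPdist_lt/(_ e e0) := h i j.
apply: filterS => y hy.
rewrite [ltLHS]/Num.Def.normr/= mx_normrE; apply: bigmax_lt => //= ij _.
by rewrite !mxE.
Qed.

Lemma Ck_mx E k (U : set E) m n (f : E -> 'M[R]_(m, n)) : open U ->
  (forall i j, Ck k U (fun x => f x i j : R^o)) -> Ck k U f.
Proof.
move=> oU; elim: k f => [|k IH] f h.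
  by move=> x Ux; apply: continuous_mx => i j; apply: (h i j x Ux).
have df x : U x -> differentiable f x.
  by move=> Ux; apply: differentiable_mx => i j; have [+ _] := h i j; apply.
split=> // v; apply: IH => i j; have [_ /(_ v)] := h i j.
by apply: Ck_ext => // x Ux; rewrite derive_entry //; apply: df.
Qed.

Lemma Ck_mulmx E k (U : set E) m n p (f : E -> 'M[R]_(m, n)) (g : E -> 'M[R]_(n, p)) :
  open U -> Ck k U f -> Ck k U g -> Ck k U (fun x => f x *m g x).
Proof.
move=> oU kf kg; apply: Ck_mx => // i j.
apply: (@Ck_ext _ _ _ _ (fun x => \sum_l f x i l * g x l j : R^o)) => //.
  by move=> x _; rewrite mxE.
apply: Ck_sum => // l; apply: Ck_mul => //; exact: Ck_entry.
Qed.

Lemma Ck_scalemx E k (U : set E) m n (a : E -> R^o) (g : E -> 'M[R]_(m, n)) :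
  open U -> Ck k U a -> Ck k U g -> Ck k U (fun x => a x *: g x).
Proof.
move=> oU kf kg; apply: Ck_mx => // i j.
apply: (@Ck_ext _ _ _ _ (fun x => a x * g x i j : R^o)) => //.
  by move=> x _; rewrite mxE.
apply: Ck_mul => //; exact: Ck_entry.
Qed.

Lemma Ck_det E k (U : set E) n (f : E -> 'M[R]_n) :
  open U -> Ck k U f -> Ck k U (fun x => \det (f x) : R^o).
Proof.
move=> oU kf; rewrite /determinant; apply: Ck_sum => // s.
apply: (@Ck_mul _ _ _ (fun=> _)) => //; first exact: (@Ck_cst _ R^o).
by apply: Ck_prod => // i; apply: Ck_entry.
Qed.

(** A linear map on matrices is a finite combination of the coordinates. *)
Lemma linear_mx_continuous F m n (f : {linear 'M[R]_(m, n) -> F}) : continuous f.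
Proof.
have -> : f = (fun A : 'M[R]_(m, n) => \sum_i \sum_j A i j *: f (delta_mx i j)) :> (_ -> _).
  apply/funext => A; rewrite {1}[A]matrix_sum_delta linear_sum.
  apply: eq_bigr => i _; rewrite linear_sum; apply: eq_bigr => j _.
  by rewrite linearZ.
move=> x; have cs (I : finType) (g : I -> 'M[R]_(m, n) -> F) :
    (forall i, {for x, continuous (g i)}) -> {for x, continuous (fun A => \sum_i g i A)}.
  move=> h; elim: (index_enum I) => [|i r IHr].
    have -> : (fun A : 'M[R]_(m, n) => \sum_(i <- [::]) g i A) = cst 0.
      by apply/funext => A; rewrite big_nil.
    exact: cst_continuous.
  have -> : (fun A : 'M[R]_(m, n) => \sum_(j <- i :: r) g j A) =
      (fun A => g i A + \sum_(j <- r) g j A).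
    by apply/funext => A; rewrite big_cons.
  exact: continuousD.
apply: (cs _ (fun i A => \sum_j A i j *: f (delta_mx i j))) => i.
apply: (cs _ (fun j A => A i j *: f (delta_mx i j))) => j.
apply: continuousZr_tmp; exact: coord_continuous.
Qed.

Lemma Ck_linmx F k m n (U : set 'M[R]_(m, n)) (f : {linear 'M[R]_(m, n) -> F}) :
  Ck k U f.
Proof. exact/Ck_linear/linear_mx_continuous. Qed.

Lemma Ck_trmx E k (U : set E) m n (f : E -> 'M[R]_(m, n)) :
  open U -> Ck k U f -> Ck k U (fun x => (f x)^T).
Proof.
move=> oU kf; apply: Ck_mx => // i j.
apply: (@Ck_ext _ _ _ _ (fun x => f x j i : R^o)) => //.
  by move=> x _; rewrite mxE.
exact: Ck_entry.
Qed.

Lemma Ck_opp E F k (U : set E) (f : E -> F) :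
  open U -> Ck k U f -> Ck k U (fun x => - f x).
Proof.
move=> oU; elim: k f => [|k IH] f.
  by move=> cf x Ux; apply: continuousN; apply: cf.
move=> /CkS[df Df]; split=> [x Ux|v].
  by apply: differentiableN; apply: df.
apply: (@Ck_ext _ _ _ _ (fun x => - 'D_v f x)) => //; last by apply: IH.
by move=> x Ux; rewrite -deriveN //; apply: diff_derivable; apply: df.
Qed.

Lemma Ck_invmx E k (U : set E) n (f : E -> 'M[R]_n) :
  open U -> (forall x, U x -> f x \in unitmx) -> Ck k U f ->
  Ck k U (fun x => invmx (f x)).
Proof.
move=> oU fu kf.
apply: (@Ck_ext _ _ _ _ (fun x => (\det (f x))^-1 *: \adj (f x))) => //.
  by move=> x Ux; rewrite /invmx fu.
apply: Ck_scalemx => //.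
  apply: (@Ck_inv _ _ _ (fun x => \det (f x))) => //; last exact: Ck_det.
  by move=> x /fu; rewrite unitmxE unitfE.
apply: Ck_mx => // i j.
apply: (@Ck_ext _ _ _ _ (fun x => cofactor (f x) j i : R^o)) => //.
  by move=> x _; rewrite mxE.
apply: (@Ck_mul _ _ _ (fun=> _)) => //; first exact: (@Ck_cst _ R^o).
apply: Ck_det => //; apply: Ck_mx => // i' j'.
apply: (@Ck_ext _ _ _ _ (fun x => f x (lift j i') (lift i j') : R^o)) => //.
  by move=> x _; rewrite !mxE.
exact: Ck_entry.
Qed.

Lemma diff_mx_sum F m n (g : 'M[R]_(m, n) -> F) y v : differentiable g y ->
  'd g y v = \sum_i \sum_j v i j *: 'D_(delta_mx i j) g y.
Proof.
move=> dg; rewrite {1}[v]matrix_sum_delta linear_sum; apply: eq_bigr => i _.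
rewrite linear_sum; apply: eq_bigr => j _.
by rewrite linearZ /= deriveE.
Qed.

(** For scalar values the chain rule writes the derivative of the composite as
    a finite sum, over the matrix basis, of products to which the induction
    hypothesis applies. *)
Lemma Ck_comp_scalar E k (U : set E) m n (V : set 'M[R]_(m, n))
    (f : E -> 'M[R]_(m, n)) (g : 'M[R]_(m, n) -> R^o) :
  open U -> (forall x, U x -> V (f x)) -> Ck k U f -> Ck k V g ->
  Ck k U (fun x => g (f x)).
Proof.
move=> oU UV; elim: k f g UV => [|k IH] f g UV.
  move=> cf cg x Ux; apply: (@continuous_comp _ _ _ f g); first exact: cf.
  by apply/cg/UV.
move=> kf kg; have [/CkS[df Df] /CkS[dg Dg]] := (kf, kg); split=> [x Ux|v].
  by apply: (@differentiable_comp _ _ _ _ f); [apply: df|apply/dg/UV].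
apply: (@Ck_ext _ _ _ _ (fun x =>
   \sum_i \sum_j ('D_v f x) i j * 'D_(delta_mx i j) g (f x) : R^o)) => //.
  move=> x Ux; have [dfx dgx] := (df x Ux, dg _ (UV _ Ux)).
  rewrite [RHS]deriveE; last exact: (differentiable_comp dfx dgx).
  by rewrite (diff_comp dfx dgx) /= diff_mx_sum // deriveE.
apply: Ck_sum => // i; apply: Ck_sum => // j; apply: Ck_mul => //.
  exact: Ck_entry.
by apply: (IH f ('D_(delta_mx i j) g)) => //; apply: CkW.
Qed.

(** Matrix-valued maps reduce to their entries. *)
Lemma Ck_comp E k (U : set E) m n m' n' (V : set 'M[R]_(m, n))
    (f : E -> 'M[R]_(m, n)) (g : 'M[R]_(m, n) -> 'M[R]_(m', n')) :
  open U -> open V -> (forall x, U x -> V (f x)) -> Ck k U f -> Ck k V g ->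
  Ck k U (fun x => g (f x)).
Proof.
move=> oU oV UV kf kg; apply: Ck_mx => // i j.
by apply: (@Ck_comp_scalar _ _ _ _ _ V f (fun y => g y i j)) => //; apply: Ck_entry.
Qed.

End Calculus.

(** * Smoothness at a point and directional derivatives *)

Section SmoothAt.
Context {R : realType}.
Implicit Types E F G : normedModType R.

Lemma near_open (T : topologicalType) (x : T) (P : T -> Prop) :
  (\forall y \near x, P y) -> exists V : set T, [/\ open V, V x & forall y, V y -> P y].
Proof.
move=> h; have : nbhs x P by [].
by rewrite nbhsE => -[V [oV Vx] VP]; exists V.
Qed.

Definition smooth_at E F (x : E) (f : E -> F) : Prop :=
  exists U : set E, [/\ open U, U x & smooth_on U f].

Lemma smooth_onP E F (U : set E) (f : E -> F) : open U ->
  smooth_on U f <-> forall x, U x -> smooth_at x f.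
Proof.
move=> oU; split=> [sf x Ux|sf k]; first by exists U.
apply: Ck_pointwise => x Ux; have [V [oV Vx sV]] := sf x Ux.
by apply: Ck_sub (sV k) => y ->.
Qed.

Lemma smooth_at_ext E F (x : E) (f g : E -> F) :
  {near x, f =1 g} -> smooth_at x f -> smooth_at x g.
Proof.
move=> fg [U [oU Ux sU]].
have [V [oV Vx Vfg]] := near_open fg.
exists (U `&` V); split=> //; first exact: openI.
move=> k; apply: (@Ck_ext _ _ _ _ _ f); first exact: openI.
  by move=> y [_ /Vfg].
by apply: Ck_sub (sU k) => y [].
Qed.

Lemma smooth_at_diff E F (x : E) (f : E -> F) : smooth_at x f -> differentiable f x.
Proof. by move=> [U [oU Ux sU]]; have /CkS[h _] := sU 1%N; apply: h. Qed.

Lemma smooth_at_cont E F (x : E) (f : E -> F) :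
  smooth_at x f -> {for x, continuous f}.
Proof. by move=> /smooth_at_diff/differentiable_continuous. Qed.

(** Transfers to [smooth_at] the closure under a binary operation of the
    classes C^k. *)
Lemma smooth_at2 E F (F' : normedModType R) G (x : E) (f : E -> F) (g : E -> F') (h : E -> G) :
  (forall k U, open U -> Ck k U f -> Ck k U g -> Ck k U h) ->
  smooth_at x f -> smooth_at x g -> smooth_at x h.
Proof.
move=> H [U [oU Ux sU]] [V [oV Vx sV]].
have oUV := openI oU oV.
exists (U `&` V); split=> // k.
by apply: H => //; [apply: Ck_sub (sU k)|apply: Ck_sub (sV k)] => y [].
Qed.

(** Transfers the closure under an operation that requires the values to stay
    in an open set [V], by shrinking the neighbourhood. *)
Lemma smooth_at_restrict E F G (x : E) (f : E -> F) (h : E -> G) (V : set F) :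
  (forall k U, open U -> (forall x, U x -> V (f x)) -> Ck k U f -> Ck k U h) ->
  open V -> V (f x) -> smooth_at x f -> smooth_at x h.
Proof.
move=> H oV Vfx sf; have [U [oU Ux sU]] := sf.
have : \forall y \near x, V (f y) /\ U y.
  near=> y; split; last by near: y; exact: open_nbhs_nbhs.
  near: y; apply: (smooth_at_cont sf); exact: open_nbhs_nbhs.
move=> /near_open[W [oW Wx WUV]].
exists W; split=> // k; apply: H => //; first by move=> y /WUV[].
by apply: Ck_sub (sU k) => y /WUV[].
Unshelve. all: by end_near. Qed.

Lemma smooth_at_cst E F (x : E) (a : F) : smooth_at x (fun=> a).
Proof. by exists setT; split=> //; [exact: openT|move=> k; exact: Ck_cst]. Qed.

Lemma smooth_at_lin F m n (x : 'M[R]_(m, n)) (f : {linear 'M[R]_(m, n) -> F}) :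
  smooth_at x f.
Proof. by exists setT; split=> //; [exact: openT|move=> k; exact: Ck_linmx]. Qed.

Lemma smooth_at_id m n (x : 'M[R]_(m, n)) : smooth_at x id.
Proof. exact: (@smooth_at_lin _ _ _ _ idfun). Qed.

Lemma smooth_at_add E F (x : E) (f g : E -> F) :
  smooth_at x f -> smooth_at x g -> smooth_at x (fun y => f y + g y).
Proof. by apply: smooth_at2 => k U oU; apply: Ck_add. Qed.

Lemma smooth_at_opp E F (x : E) (f : E -> F) :
  smooth_at x f -> smooth_at x (fun y => - f y).
Proof. by move=> sf; apply: (smooth_at2 _ sf sf) => k U oU kf _; apply: Ck_opp. Qed.

Lemma smooth_at_sub E F (x : E) (f g : E -> F) :
  smooth_at x f -> smooth_at x g -> smooth_at x (fun y => f y - g y).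
Proof. by move=> sf sg; apply: smooth_at_add => //; apply: smooth_at_opp. Qed.

Lemma smooth_at_sum E F (x : E) (I : Type) (r : seq I) (f : I -> E -> F) :
  (forall i, smooth_at x (f i)) -> smooth_at x (fun y => \sum_(i <- r) f i y).
Proof.
move=> h; elim: r => [|i r IH].
  have -> : (fun y => \sum_(i <- [::]) f i y) = (fun=> 0).
    by apply/funext => y; rewrite big_nil.
  exact: smooth_at_cst.
have -> : (fun y => \sum_(j <- i :: r) f j y) = (fun y => f i y + \sum_(j <- r) f j y).
  by apply/funext => y; rewrite big_cons.
exact: smooth_at_add.
Qed.

Lemma smooth_at_mulmx E (x : E) m n p (f : E -> 'M[R]_(m, n)) (g : E -> 'M[R]_(n, p)) :
  smooth_at x f -> smooth_at x g -> smooth_at x (fun y => f y *m g y).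
Proof. by apply: smooth_at2 => k U oU; apply: Ck_mulmx. Qed.

Lemma smooth_at_scale E (x : E) m n (a : E -> R^o) (g : E -> 'M[R]_(m, n)) :
  smooth_at x a -> smooth_at x g -> smooth_at x (fun y => a y *: g y).
Proof. by apply: smooth_at2 => k U oU; apply: Ck_scalemx. Qed.

Lemma smooth_at_trmx E (x : E) m n (f : E -> 'M[R]_(m, n)) :
  smooth_at x f -> smooth_at x (fun y => (f y)^T).
Proof. by move=> sf; apply: (smooth_at2 _ sf sf) => k U oU kf _; apply: Ck_trmx. Qed.

Lemma smooth_at_entry E (x : E) m n (f : E -> 'M[R]_(m, n)) i j :
  smooth_at x f -> smooth_at x (fun y => f y i j : R^o).
Proof. by move=> sf; apply: (smooth_at2 _ sf sf) => k U oU kf _; apply: Ck_entry. Qed.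

Lemma open_unitmx n : open [set A : 'M[R]_n | A \in unitmx].
Proof.
have cdet : continuous (fun A : 'M[R]_n => \det A : R^o).
  move=> A; have := @Ck_det R 'M[R]_n 0 setT n id openT; apply => //.
  by move=> ? _; exact: cvg_id.
have -> : [set A : 'M[R]_n | A \in unitmx] = (fun A : 'M[R]_n => \det A : R^o) @^-1` [set x | x != 0].
  by apply/seteqP; split => A /=; rewrite unitmxE unitfE.
apply: open_comp => [A _|]; [exact: cdet|exact: open_neq].
Qed.

Lemma smooth_at_inv E (x : E) (f : E -> R^o) :
  f x != 0 -> smooth_at x f -> smooth_at x (fun y => (f y)^-1 : R^o).
Proof.
apply: (@smooth_at_restrict _ _ _ _ _ _ [set y | y != 0]); last exact: open_neq.
by move=> k U oU; apply: Ck_inv.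
Qed.

Lemma smooth_at_sqrt E (x : E) (f : E -> R^o) :
  0 < f x -> smooth_at x f -> smooth_at x (fun y => Num.sqrt (f y) : R^o).
Proof.
apply: (@smooth_at_restrict E R^o R^o x f _ [set y : R^o | 0 < y]); last exact: open_gt.
by move=> k U oU; apply: Ck_sqrt.
Qed.

Lemma smooth_at_invmx E (x : E) n (f : E -> 'M[R]_n) :
  f x \in unitmx -> smooth_at x f -> smooth_at x (fun y => invmx (f y)).
Proof.
apply: (@smooth_at_restrict _ _ _ _ _ _ [set y | y \in unitmx]); last exact: open_unitmx.
by move=> k U oU; apply: Ck_invmx.
Qed.

Lemma smooth_at_comp E (x : E) m n m' n'
    (f : E -> 'M[R]_(m, n)) (g : 'M[R]_(m, n) -> 'M[R]_(m', n')) :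
  smooth_at x f -> smooth_at (f x) g -> smooth_at x (fun y => g (f y)).
Proof.
move=> sf [V [oV Vfx sV]].
by apply: (smooth_at_restrict _ oV Vfx sf) => k U oU UV kf; apply: (@Ck_comp _ _ _ _ _ _ _ _ V).
Qed.

Lemma smooth_at_mx E (x : E) m n (f : E -> 'M[R]_(m, n)) :
  (forall i j, smooth_at x (fun y => f y i j : R^o)) -> smooth_at x f.
Proof.
move=> h.
have -> : f = (fun y => \sum_i \sum_j f y i j *: delta_mx i j).
  by apply/funext => y; rewrite -matrix_sum_delta.
apply: smooth_at_sum => i; apply: smooth_at_sum => j.
by apply: smooth_at_scale => //; apply: smooth_at_cst.
Qed.

Lemma smooth_at_block E (x : E) m1 m2 n1 n2 (a : E -> 'M[R]_(m1, n1))
   (b : E -> 'M[R]_(m1, n2)) (c : E -> 'M[R]_(m2, n1)) (d : E -> 'M[R]_(m2, n2)) :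
  smooth_at x a -> smooth_at x b -> smooth_at x c -> smooth_at x d ->
  smooth_at x (fun y => block_mx (a y) (b y) (c y) (d y)).
Proof.
move=> sa sb sc sd; apply: smooth_at_mx => i j.
case: (split_ordP i) => i' ->; case: (split_ordP j) => j' ->.
- under [X in smooth_at _ X]eq_fun do rewrite block_mxEul; exact: smooth_at_entry.
- under [X in smooth_at _ X]eq_fun do rewrite block_mxEur; exact: smooth_at_entry.
- under [X in smooth_at _ X]eq_fun do rewrite block_mxEdl; exact: smooth_at_entry.
- under [X in smooth_at _ X]eq_fun do rewrite block_mxEdr; exact: smooth_at_entry.
Qed.

(** Directional derivatives are handled as a relation, so that they combine
    without rewriting under the differential. *)
Definition has_deriv E F (f : E -> F) (x v : E) (w : F) : Prop :=
  differentiable f x /\ 'd f x v = w.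

Lemma has_deriv_uniq E F (f : E -> F) x v w w' :
  has_deriv f x v w -> has_deriv f x v w' -> w = w'.
Proof. by move=> [_ <-] [_ <-]. Qed.

Lemma smooth_at_deriv E F (f : E -> F) x v : smooth_at x f -> has_deriv f x v ('d f x v).
Proof. by move=> /smooth_at_diff. Qed.

Lemma has_deriv_cst E F (a : F) (x v : E) : has_deriv (fun=> a) x v 0.
Proof.
split; first exact: differentiable_cst.
by rewrite -deriveE ?derive_cst //; exact: differentiable_cst.
Qed.

Lemma has_deriv_id E (x v : E) : has_deriv id x v v.
Proof.
have di : differentiable (id : E -> E) x by apply: ex_diff.
by split=> //; rewrite -deriveE ?derive_id.
Qed.

Lemma has_deriv_ext E F (f g : E -> F) x v w :
  {near x, f =1 g} -> has_deriv f x v w -> has_deriv g x v w.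
Proof.
move=> fg [df dw]; have [dg dge] := near_eq_is_diff fg df.
by split; [exact: dg|exact: etrans (congr1 (fun h => h v) dge) dw].
Qed.

Lemma has_deriv_add E F (f g : E -> F) x v w w' :
  has_deriv f x v w -> has_deriv g x v w' ->
  has_deriv (fun y => f y + g y) x v (w + w').
Proof.
move=> [df dw] [dg dw']; have dfg := differentiableD df dg.
split; first exact: dfg.
apply: etrans (congr1 (fun h => h v) (diffD df dg)) _.
by rewrite -dw -dw'.
Qed.

Lemma has_deriv_lin E F m n (f : E -> 'M[R]_(m, n)) (L : {linear 'M[R]_(m, n) -> F}) x v w :
  has_deriv f x v w -> has_deriv (fun y => L (f y)) x v (L w).
Proof.
move=> [df dw]; have cL := @linear_mx_continuous R F m n L.
have dL : differentiable L (f x) by exact: linear_differentiable.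
split; first exact: (differentiable_comp df dL).
apply: etrans (congr1 (fun h => h v) (diff_comp df dL)) _ => /=.
by rewrite dw diff_lin.
Qed.

Lemma has_deriv_comp E F m n (f : E -> 'M[R]_(m, n)) (g : 'M[R]_(m, n) -> F) x v w w' :
  has_deriv f x v w -> has_deriv g (f x) w w' -> has_deriv (fun y => g (f y)) x v w'.
Proof.
move=> [df dw] [dg dw']; split; first exact: (differentiable_comp df dg).
by apply: etrans (congr1 (fun h => h v) (diff_comp df dg)) _ => /=; rewrite dw.
Qed.

Lemma has_deriv_mulmx E m n p (f : E -> 'M[R]_(m, n)) (g : E -> 'M[R]_(n, p)) x v w w' :
  has_deriv f x v w -> has_deriv g x v w' ->
  has_deriv (fun y => f y *m g y) x v (w *m g x + f x *m w').
Proof.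
move=> [df dw] [dg dw'].
have fE i j : (fun y => (f y *m g y) i j : R) =
    \sum_(l < n) ((fun y => f y i l : R) * (fun y => g y l j : R)).
  by apply/funext => y; rewrite mxE fct_sumE.
have dfg : differentiable (fun y => f y *m g y) x.
  apply: differentiable_mx => i j; rewrite fE.
  by apply: differentiable_sum => l; apply: differentiableM; apply: differentiable_entry.
split=> //; apply/matrixP => i j; rewrite -deriveE // derive_entry // fE derive_sum; last first.
  by move=> l; apply: derivableM; apply: diff_derivable; apply: differentiable_entry.
rewrite !mxE -big_split /=; apply: eq_bigr => l _.
rewrite deriveM; try by apply: diff_derivable; apply: differentiable_entry.
rewrite -(derive_entry _ _ _ df) -(derive_entry _ _ _ dg) !deriveE // dw dw'.
rewrite [LHS]addrC; congr (_ + _); exact: mulrC.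
Qed.

(** Differentiate [f y * (f y)^-1 = 1]. *)
Lemma has_deriv_invmx E n (f : E -> 'M[R]_n) x v w :
  smooth_at x f -> f x \in unitmx -> has_deriv f x v w ->
  has_deriv (fun y => invmx (f y)) x v (- (invmx (f x) *m w *m invmx (f x))).
Proof.
move=> sf fu df; have dI := smooth_at_deriv v (smooth_at_invmx fu sf).
split; first by case: dI.
have e1 : {near x, (fun y => f y *m invmx (f y)) =1 (fun=> 1%:M)}.
  have h := smooth_at_cont sf (open_nbhs_nbhs (conj (@open_unitmx n) fu)).
  by near=> y; rewrite mulmxV //; near: y; exact: h.
have := has_deriv_uniq (has_deriv_ext e1 (has_deriv_mulmx df dI)) (has_deriv_cst _ _ _).
move: ('d _ x v) => w' /eqP; rewrite addrC addr_eq0 => /eqP h.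
by rewrite -[LHS](mulKmx fu) h mulmxN mulmxA.
Unshelve. all: by end_near. Qed.

Lemma has_deriv_scale E m n (a : E -> R^o) (f : E -> 'M[R]_(m, n)) x v (a' : R) w :
  has_deriv a x v a' -> has_deriv f x v w ->
  has_deriv (fun y => a y *: f y) x v (a' *: f x + a x *: w).
Proof.
move=> [da dw] [df dw'].
have fE i j : (fun y => (a y *: f y) i j : R) = (a : E -> R) * (fun y => f y i j : R).
  by apply/funext => y; rewrite mxE.
have dfg : differentiable (fun y => a y *: f y) x.
  apply: differentiable_mx => i j; rewrite fE.
  by apply: differentiableM => //; apply: differentiable_entry.
split=> //; apply/matrixP => i j; rewrite -deriveE // derive_entry // fE.
rewrite deriveM; try by apply: diff_derivable => //; apply: differentiable_entry.
rewrite -(derive_entry _ _ _ df) !deriveE // dw dw' !mxE [LHS]addrC.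
by congr (_ + _); exact: mulrC.
Qed.

End SmoothAt.

(** * Positive definite matrices and the real spectral theorem *)

Section MatrixFacts.
Context {R : realType}.

Lemma mulmx_tr_eq0 n (x : 'rV[R]_n) : x *m x^T = 0 -> x = 0.
Proof.
move/matrixP/(_ 0 0); rewrite !mxE => /eqP.
rewrite psumr_eq0 => [|i _]; last by rewrite mxE -expr2 sqr_ge0.
move=> /allP h; apply/rowP => i; rewrite mxE.
have := h i (mem_index_enum _); rewrite mxE -expr2 sqrf_eq0 => /implyP/(_ isT)/eqP; exact.
Qed.

Lemma unitmx_inj n (A : 'M[R]_n) :
  (forall x : 'rV_n, x *m A = 0 -> x = 0) -> A \in unitmx.
Proof.
move=> h; rewrite -row_free_unit -kermx_eq0; apply/rowV0P => v /sub_kermxP; exact: h.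
Qed.

Lemma posdef_unit n (M : 'M[R]_n) : symmetric_posdef M -> M \in unitmx.
Proof.
move=> [_ h]; apply: unitmx_inj => x xM; apply/eqP/negP => /negP /h.
by rewrite xM mul0mx mxE ltxx.
Qed.

(** For a skew [K] the form [x K x^T] vanishes, so [x (1 + K) = 0] forces [x
    x^T = 0]. *)
Lemma skew_unit n (K : 'M[R]_n) : K^T = - K -> 1%:M + K \in unitmx.
Proof.
move=> skK; apply: unitmx_inj => x; rewrite mulmxDr mulmx1 => h.
have h1 : x *m x^T + x *m K *m x^T = 0 by rewrite -mulmxDl h mul0mx.
have h2 : (x *m K *m x^T)^T = - (x *m K *m x^T).
  by rewrite !trmx_mul trmxK skK mulNmx mulmxN mulmxA.
have h3 : x *m K *m x^T = 0.
  apply/matrixP => i j; rewrite !ord1.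
  have /matrixP/(_ 0 0) := h2; rewrite [LHS]mxE [RHS]mxE => /eqP.
  by rewrite -subr_eq0 opprK -mulr2n mulrn_eq0 /= => /eqP ->; rewrite mxE.
by apply: mulmx_tr_eq0; rewrite -h1 h3 addr0.
Qed.

Lemma orthV n (P : 'M[R]_n) : P *m P^T = 1%:M -> P^T *m P = 1%:M.
Proof. by move/mulmx1C. Qed.

Lemma orth_unit n (P : 'M[R]_n) : P *m P^T = 1%:M -> P \in unitmx.
Proof. by case/mulmx1_unit. Qed.

(** Inverse Cholesky factor: a lower triangular [L] with [L G L^T = 1], by
    recursion on Schur complements. It plays the role of [G^(-1/2)], with
    entries that are visibly smooth in [G]. *)
Fixpoint cholinv n : 'M[R]_n -> 'M[R]_n :=
  match n with
  | 0 => fun G => G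
  | n'.+1 => fun G : 'M[R]_(1 + n') =>
     let a := G 0 0 in
     let L := cholinv (drsubmx G - a^-1 *: (dlsubmx G *m ursubmx G)) in
     block_mx ((Num.sqrt a)^-1)%:M 0 (- a^-1 *: (L *m dlsubmx G)) L
  end.

Lemma cholinvS n (G : 'M[R]_(1 + n)) (S := drsubmx G - (G 0 0)^-1 *: (dlsubmx G *m ursubmx G)) :
  @cholinv n.+1 G = block_mx ((Num.sqrt (G 0 0))^-1)%:M 0
    (- (G 0 0)^-1 *: (cholinv S *m dlsubmx G)) (cholinv S).
Proof. by []. Qed.

(** The Schur complement is the restriction of the form to the orthogonal
    complement, for the form itself, of the first basis vector. *)
Lemma posdef_schur n (a : R) (b : 'rV[R]_n) (D : 'M[R]_n) :
  symmetric_posdef (block_mx (a%:M : 'M[R]_1) b b^T D) ->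
  0 < a /\ symmetric_posdef (D - a^-1 *: (b^T *m b)).
Proof.
move=> [sG pG].
have a0 : 0 < a.
  have := pG (row_mx 1%:M 0); rewrite tr_row_mx mul_row_block mul_row_col.
  rewrite !mul1mx !mul0mx !addr0 trmx1 trmx0 mulmx1 mulmx0 addr0 mxE eqxx.
  apply; apply/eqP => /matrixP/(_ 0 (lshift n 0)); rewrite row_mxEl !mxE eqxx.
  by move/eqP; rewrite oner_eq0.
have sD : D^T = D by move: sG; rewrite tr_block_mx => /eq_block_mx[].
split=> //; split; first by rewrite linearB /= linearZ /= trmx_mul trmxK sD.
move=> y y0; have := pG (row_mx (- a^-1 *: (y *m b^T)) y).
have -> : row_mx (- a^-1 *: (y *m b^T)) y *m block_mx (a%:M : 'M[R]_1) b b^T D =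
    row_mx 0 (y *m (D - a^-1 *: (b^T *m b))).
  rewrite mul_row_block; congr row_mx.
    by rewrite mul_mx_scalar scalerA mulrN divff ?gt_eqF // scaleN1r addNr.
  by rewrite mulmxBr addrC -scalemxAl scaleNr -scalemxAr mulmxA.
rewrite tr_row_mx mul_row_col mul0mx add0r; apply.
by apply: contra_neq y0 => /(congr1 rsubmx); rewrite row_mxKr linear0.
Qed.

Lemma sym_block1 n (G : 'M[R]_(1 + n)) : G^T = G ->
  G = block_mx (G 0 0)%:M (ursubmx G) (ursubmx G)^T (drsubmx G) /\
  dlsubmx G = (ursubmx G)^T.
Proof.
move=> sG.
have e : dlsubmx G = (ursubmx G)^T by rewrite trmx_ursub sG.
split=> //; rewrite -e -[LHS]submxK; congr block_mx.
apply/matrixP => i j; rewrite !ord1 !mxE eqxx mulr1n.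
by congr (G _ _); apply/val_inj.
Qed.

Lemma cholinvP n (G : 'M[R]_n) :
  symmetric_posdef G -> cholinv G *m G *m (cholinv G)^T = 1%:M.
Proof.
elim: n G => [|n IH] G; first by move=> _; apply/matrixP => -[].
move=> pG; have [eG edl] := sym_block1 pG.1.
set a := G 0 0 in eG *; set b := ursubmx (G : 'M[R]_(1 + n)) in eG edl *.
set D := drsubmx (G : 'M[R]_(1 + n)) in eG *.
have [a0 pS] : 0 < a /\ symmetric_posdef (D - a^-1 *: (b^T *m b)).
  by apply: posdef_schur; rewrite -eG.
rewrite /= -/a -/D edl -/b; set L := cholinv _.
have LS := IH _ pS; rewrite -/L in LS.
have sa0 : Num.sqrt a != 0 by rewrite gt_eqF // sqrtr_gt0.
have sa2 : Num.sqrt a * Num.sqrt a = a by rewrite -expr2 sqr_sqrtr // ltW.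
have an0 : a != 0 by rewrite gt_eqF.
rewrite [X in _ *m X *m _]eG.
have -> : block_mx ((Num.sqrt a)^-1)%:M 0 (- a^-1 *: (L *m b^T)) L *m
   block_mx (a%:M : 'M[R]_1) b b^T D = block_mx (Num.sqrt a)%:M ((Num.sqrt a)^-1 *: b)
     0 (L *m (D - a^-1 *: (b^T *m b))).
  rewrite mulmx_block !mul0mx !addr0 -scalar_mxM mul_scalar_mx; congr block_mx.
  - by congr (_%:M); rewrite -[X in _ * X]sa2 mulKf.
  - by rewrite mul_mx_scalar scalerA mulrN divff // scaleN1r addNr.
  - by rewrite mulmxBr addrC -scalemxAl scaleNr -scalemxAr mulmxA.
rewrite (@tr_block_mx _ 1 n 1 n) (@mulmx_block _ 1 n 1 n 1 n) !tr_scalar_mx !trmx0 !mulmx0 !mul0mx !addr0 !add0r LS.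
rewrite -scalar_mxM divff //.
have one : (1%:M : 'M[R]_(1 + n)) = block_mx 1%:M 0 0 1%:M by rewrite scalar_mx_block.
apply: (etrans _ (esym one)); congr block_mx.
rewrite linearZ /= trmx_mul trmxK mul_scalar_mx -scalemxAl scalerA -scalerDl.
rewrite mulrN -[X in X^-1]sa2 invfM mulrA divff // mul1r addNr scale0r //.
Qed.

(** A diagonal matrix that commutes with [G] commutes with the blocks of [G],
    hence with its Schur complement. *)
Lemma cholinv_comm n (d : 'rV[R]_n) (G : 'M[R]_n) :
  diag_mx d *m G = G *m diag_mx d ->
  diag_mx d *m cholinv G = cholinv G *m diag_mx d.
Proof.
elim: n d G => [|n IH] d G; first by move=> _; apply/matrixP => -[].
suff h : forall (d : 'rV[R]_(1 + n)) (G : 'M[R]_(1 + n)),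
    diag_mx d *m G = G *m diag_mx d ->
    diag_mx d *m @cholinv n.+1 G = @cholinv n.+1 G *m diag_mx d by exact: h.
move=> {d G} d G; rewrite cholinvS.
rewrite -[d](@hsubmxK _ 1 1 n) [d in diag_mx d](_ : _ = row_mx (d 0 0)%:M (@rsubmx _ 1 1 n d)); last first.
  congr row_mx; apply/matrixP => i j; rewrite !ord1 !mxE eqxx mulr1n.
  by congr (d _ _); apply/val_inj.
move: (d 0 0) (rsubmx _) => d0 d'; rewrite (@diag_mx_row _ n 1).
have -> : diag_mx (d0%:M : 'rV[R]_1) = d0%:M :> 'M[R]_1.
  by apply/matrixP => i j; rewrite !ord1 !mxE !eqxx.
rewrite -[in X in X -> _](@submxK _ 1 n 1 n G) !(@mulmx_block _ 1 n 1 n 1 n).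
rewrite !mulmx0 !mul0mx !addr0 !add0r => /eq_block_mx[_ hb hc hD].
set a := G 0 0; set S := _ - _.
have hS : diag_mx d' *m S = S *m diag_mx d'.
  rewrite /S mulmxBr mulmxBl hD -scalemxAr -scalemxAl; congr (_ - _ *: _).
  by rewrite mulmxA hc -!mulmxA -hb.
have hL := IH _ _ hS; set L := cholinv S in hL *.
have e1 : (d0%:M : 'M[R]_1) *m ((Num.sqrt a)^-1)%:M = ((Num.sqrt a)^-1)%:M *m d0%:M.
  by rewrite -!scalar_mxM mulrC.
have e2 : diag_mx d' *m (- a^-1 *: (L *m dlsubmx G)) =
    - a^-1 *: (L *m dlsubmx G) *m (d0%:M : 'M[R]_1).
  rewrite -scalemxAr -scalemxAl; congr (_ *: _).
  by rewrite mulmxA hL -!mulmxA hc.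
by rewrite e1 e2 hL.
Qed.

Lemma smooth_at_cholinv (E : normedModType R) (x : E) n (f : E -> 'M[R]_n) :
  symmetric_posdef (f x) -> smooth_at x f -> smooth_at x (fun y => cholinv (f y)).
Proof.
elim: n f => [|n IH] f; first by move=> _.
move=> pG sf; have [eG edl] := sym_block1 pG.1.
have [a0 pS] : 0 < f x 0 0 /\ symmetric_posdef (drsubmx (f x : 'M[R]_(1 + n)) -
    (f x 0 0)^-1 *: ((ursubmx (f x : 'M[R]_(1 + n)))^T *m ursubmx (f x : 'M[R]_(1 + n)))).
  by apply: posdef_schur; rewrite -eG.
have sa : smooth_at x (fun y => f y 0 0 : R^o) by exact: smooth_at_entry.
have sdr : smooth_at x (fun y => drsubmx (f y : 'M[R]_(1 + n))).
  by apply: smooth_at_mx => i j; under [X in smooth_at _ X]eq_fun do rewrite !mxE;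
    exact: smooth_at_entry.
have sdl : smooth_at x (fun y => dlsubmx (f y : 'M[R]_(1 + n))).
  by apply: smooth_at_mx => i j; under [X in smooth_at _ X]eq_fun do rewrite !mxE;
    exact: smooth_at_entry.
have sur : smooth_at x (fun y => ursubmx (f y : 'M[R]_(1 + n))).
  by apply: smooth_at_mx => i j; under [X in smooth_at _ X]eq_fun do rewrite !mxE;
    exact: smooth_at_entry.
have sV : smooth_at x (fun y => (f y 0 0)^-1 : R^o).
  by apply: smooth_at_inv => //; rewrite gt_eqF.
have sL : smooth_at x (fun y => cholinv (drsubmx (f y : 'M[R]_(1 + n)) -
    (f y 0 0)^-1 *: (dlsubmx (f y : 'M[R]_(1 + n)) *m ursubmx (f y : 'M[R]_(1 + n))))).
  apply: IH; first by rewrite edl.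
  apply: smooth_at_sub => //; apply: smooth_at_scale => //; exact: smooth_at_mulmx.
apply: (@smooth_at_block _ _ _ 1 n 1 n) => //.
- have -> : (fun y => ((Num.sqrt (f y 0 0))^-1)%:M : 'M[R]_1) =
      (fun y => (Num.sqrt (f y 0 0))^-1 *: 1%:M).
    by apply/funext => y; rewrite scalemx1.
  apply: smooth_at_scale; last exact: smooth_at_cst.
  apply: (@smooth_at_inv _ _ _ (fun y => Num.sqrt (f y 0 0) : R^o)).
    by rewrite gt_eqF // sqrtr_gt0.
  exact: smooth_at_sqrt.
- exact: smooth_at_cst.
- apply: smooth_at_scale; first exact: (@smooth_at_opp _ _ R^o).
  exact: smooth_at_mulmx.
Qed.

(** The hypothesis says that the rows of [F] are linearly independent. *)
Lemma gram_posdef m n (F : 'M[R]_(m, n)) :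
  (forall x : 'rV_m, x *m F = 0 -> x = 0) -> symmetric_posdef (F *m F^T).
Proof.
move=> h; split; first by rewrite trmx_mul trmxK.
move=> x x0; rewrite !mulmxA -mulmxA -trmx_mul.
have : x *m F != 0 by apply: contra_neq x0 => /h.
move: (x *m F) => y y0; rewrite lt_neqAle; apply/andP; split.
  apply: contra_neq y0 => e; apply: mulmx_tr_eq0; apply/matrixP => i j.
  by rewrite !ord1 -e mxE.
by rewrite mxE sumr_ge0 // => i _; rewrite mxE -expr2 sqr_ge0.
Qed.

(** Signs are chosen one diagonal entry at a time, from the last to the first:
    the determinant is affine in the entry, with the minor already made
    nonzero as leading coefficient, so it cannot vanish both at 1 and at -1.
    *)
Lemma sign_perturbation n (Q : 'M[R]_n) : exists s : 'rV[R]_n,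
  (forall j, s 0 j ^+ 2 = 1) /\ Q + diag_mx s \in unitmx.
Proof.
elim: n Q => [|n IH] Q.
  by exists 0; split=> [[]//|]; rewrite unitmxE det_mx00 unitr1.
have [s' [s'1 uK]] := IH (drsubmx (Q : 'M[R]_(1 + n))).
set K := _ + _ in uK.
pose c := (ursubmx (Q : 'M[R]_(1 + n)) *m invmx K *m dlsubmx (Q : 'M[R]_(1 + n))) 0 0.
(* The determinant is [det K] times [Q 0 0 + s0 - c], [c] coming from the
   Schur complement of [K]. *)
have [s0 [s01 sn]] : exists s0 : R, s0 ^+ 2 = 1 /\ Q 0 0 + s0 - c != 0.
  have [e|ne] := eqVneq (Q 0 0 + 1 - c) 0; last by exists 1; rewrite expr1n.
  exists (-1); split; first by rewrite sqrrN expr1n.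
  apply/eqP => e2; have : (2 : R) = 0 by rewrite -[RHS](subrr 0) -{1}e -e2; ring.
  by move/eqP; rewrite pnatr_eq0.
exists (row_mx s0%:M s' : 'rV[R]_(1 + n)); split.
  move=> j; case: (@split_ordP 1 n j) => i ->; rewrite ?(@row_mxEl _ 1 1 n) ?(@row_mxEr _ 1 1 n) //.
  by rewrite !ord1 mxE.
rewrite (@diag_mx_row _ n 1).
have -> : diag_mx (s0%:M : 'rV[R]_1) = s0%:M :> 'M[R]_1.
  by apply/matrixP => i j; rewrite !ord1 !mxE !eqxx.
rewrite -[Q](@submxK _ 1 n 1 n) (@add_block_mx _ 1 n 1 n) !addr0 -/K.
set b := ursubmx _ in c sn *; set d := dlsubmx _ in c sn *; set q := ulsubmx _.
have -> : block_mx (q + s0%:M) b d K =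
   block_mx 1%:M (b *m invmx K) 0 1%:M *m block_mx (Q 0 0 + s0 - c)%:M 0 d K.
  rewrite (@mulmx_block _ 1 n 1 n 1 n) !mul1mx !mul0mx !add0r mulmxKV //.
  congr block_mx; apply/matrixP => i j; rewrite !ord1.
  rewrite [LHS]mxE [RHS]mxE -/c [q _ _]mxE [ _%:M _ _]mxE [X in _ = X + _]mxE eqxx !mulr1n.
  rewrite subrK; congr (_ + _); rewrite mxE; congr (Q _ _); exact/val_inj.
rewrite unitmx_mul; apply/andP; split.
  by rewrite unitmxE (@det_ublock _ 1 n) !det1 mul1r unitr1.
by rewrite unitmxE (@det_lblock _ 1 n) det_scalar1 unitrM -!unitmxE uK andbT unitfE.
Qed.

(** The complex spectral theorem gives a real diagonal matrix similar to [A]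
    over the complex numbers, hence over the reals by some [P]. The Gram
    matrix of [P] commutes with the diagonal matrix, and so does its inverse
    Cholesky factor, by which [P] can therefore be orthonormalized. *)
Lemma real_spectral n (A : 'M[R]_n) : A^T = A ->
  exists (P : 'M[R]_n) (d : 'rV[R]_n), P *m P^T = 1%:M /\ A = P^T *m diag_mx d *m P.
Proof.
move=> sA.
pose toC := real_complex R; pose AC := map_mx toC A.
have realC m' n' (B : 'M[R]_(m', n')) : map_mx toC B \is a mxOver Num.real.
  by apply/mxOverP => i j; rewrite mxE; apply/complex_realP; exists (B i j).
have symC : AC \is symmetricmx.
  by apply/is_hermitianmxP; rewrite expr0 scale1r map_mx_id // map_trmx sA.
have hermC := realsym_hermsym symC (realC _ _ A).
have /orthomx_spectralP eA := hermitian_normalmx hermC.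
have rd := hermitian_spectral_diag_real hermC.
pose d := map_mx (@complex.Re R) (spectral_diag AC).
have ed : spectral_diag AC = map_mx toC d.
  apply/matrixP => i j; rewrite !mxE; symmetry; apply: RRe_real.
  by move/mxOverP: rd; apply.
have [P /andP[realP uP] simP] : similar_in [predI mxOver Num.real & unitmx] AC (map_mx toC (diag_mx d)).
  apply: real_similar; [|exact: realC|exact: realC].
  exists (spectralmx AC); first exact: spectral_unit.
  apply/similarP; first exact: spectral_unit.
  rewrite map_diag_mx -ed.
  have /(congr1 (mulmx (spectralmx AC))) := eA.
  by rewrite !mulmxA mulmxV ?spectral_unit // mul1mx.
pose P0 := map_mx (@complex.Re R) P.
have eP : P = map_mx toC P0.
  apply/matrixP => i j; rewrite !mxE; symmetry; apply: RRe_real.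
  by move/mxOverP: realP; apply.
have uP0 : P0 \in unitmx by rewrite -(map_unitmx toC) -eP.
have PA : P0 *m A = diag_mx d *m P0.
  apply: (map_mx_inj (f := toC)).
  by rewrite !map_mxM -eP; exact/(similarP uP).
pose G := P0 *m P0^T.
have pG : symmetric_posdef G.
  apply: gram_posdef => x xP; by rewrite -[x](mulmxK uP0) xP mul0mx.
have dG : diag_mx d *m G = G *m diag_mx d.
  rewrite /G mulmxA -PA -!mulmxA; congr (_ *m _).
  have /(congr1 trmx) := PA; rewrite !trmx_mul sA tr_diag_mx => -> //.
have dL := cholinv_comm dG; have LG := cholinvP pG.
set L := cholinv G in dL LG.
exists (L *m P0), d.
have o : L *m P0 *m (L *m P0)^T = 1%:M by rewrite trmx_mul -LG /G !mulmxA.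
split=> //.
have : (L *m P0) *m A = diag_mx d *m (L *m P0) by rewrite -mulmxA PA !mulmxA dL.
move: (L *m P0) o => Q o.
by move/(congr1 (mulmx Q^T)); rewrite !mulmxA (orthV o) mul1mx.
Qed.

End MatrixFacts.

(** * The Cayley chart of the set of roots *)

Lemma addmxE (R : nmodType) m n (A B : 'M[R]_(m, n)) i j : (A + B) i j = A i j + B i j.
Proof. by rewrite mxE. Qed.
Lemma oppmxE (R : zmodType) m n (A : 'M[R]_(m, n)) i j : (- A) i j = - A i j.
Proof. by rewrite mxE. Qed.
Lemma scalemxE (R : pzRingType) m n a (A : 'M[R]_(m, n)) i j : (a *: A) i j = a * A i j.
Proof. by rewrite mxE. Qed.
Lemma zeromxE (R : nmodType) m n i j : (0 : 'M[R]_(m, n)) i j = 0.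
Proof. by rewrite mxE. Qed.
Definition linmxE := (addmxE, oppmxE, scalemxE, zeromxE).

Lemma trmxZ (R : pzRingType) m n a (A : 'M[R]_(m, n)) : (a *: A)^T = a *: A^T.
Proof. by apply/matrixP => i j; rewrite !mxE. Qed.

(** Proves linear identities between matrices, products being atoms. *)
Ltac mxring := apply/matrixP => ? ?; rewrite !linmxE; ring.

Section Roots.
Context {R : realType} {n : nat}.
Implicit Types (A Y V Q K C : 'M[R]_n).

Lemma char_poly_conj A C : C \in unitmx -> char_poly (C *m A *m invmx C) = char_poly A.
Proof.
move=> uC; rewrite /char_poly /char_poly_mx.
pose pC := map_mx polyC C; pose pD := map_mx polyC (invmx C).
have CD : pC *m pD = 1%:M by rewrite /pC /pD -map_mxM mulmxV // map_mx1.
have -> : 'X%:M - map_mx polyC (C *m A *m invmx C) = pC *m ('X%:M - map_mx polyC A) *m pD.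
  have xC : pC *m 'X%:M *m pD = 'X%:M by rewrite scalar_mxC -mulmxA CD mulmx1.
  by rewrite mulmxBr mulmxBl xC !map_mxM.
by rewrite !det_mulmx mulrAC -det_mulmx CD det1 mul1r.
Qed.

Lemma char_poly_orth A Q : Q *m Q^T = 1%:M -> char_poly (Q *m A *m Q^T) = char_poly A.
Proof.
move=> oQ; have uQ := orth_unit oQ.
have -> : Q^T = invmx Q by rewrite -[LHS](mulKmx uQ) oQ mulmx1.
exact: char_poly_conj.
Qed.

(** The right-hand side lists the entries of [d] in order, so that
    multiplicities can be read off by counting. *)
Lemma char_poly_spectral Q (d : 'rV[R]_n) : Q *m Q^T = 1%:M ->
  char_poly (Q^T *m diag_mx d *m Q) = \prod_(x <- [seq d 0 j | j <- enum 'I_n]) ('X - x%:P).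
Proof.
move=> oQ; have oT : Q^T *m Q^T^T = 1%:M by rewrite trmxK orthV.
rewrite -[X in _ *m _ *m X]trmxK char_poly_orth // big_map big_enum /=.
rewrite char_poly_trig ?diag_mx_is_trig //.
by apply: eq_bigr => i _; rewrite mxE eqxx.
Qed.

Lemma spectral_entry (P : 'M[R]_n) (d : 'rV[R]_n) a b :
  (P^T *m diag_mx d *m P) a b = \sum_j d 0 j * P j a * P j b.
Proof.
rewrite mxE; apply: eq_bigr => j _; rewrite mul_mx_diag !mxE; congr (_ * _).
exact: mulrC.
Qed.

(** Tangent space at [A] of the set of roots, namely the linearization of [Y^T
    = Y] and [Y Y = M]. *)
Definition tangent_at A : set 'M[R]_n :=
  [set V | V^T = V /\ V *m A + A *m V = 0].

(** For [V] tangent at [A] the matrix [W = V A^-1 / 2] is skew and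
    anticommutes with [A], so that the conjugate below equals [(1 + W) (1 -
    W)^-1 A]: a Cayley transform times [A]. *)
Definition cayley A V : 'M[R]_n :=
  let C := 1%:M + 2^-1 *: (V *m invmx A) in C *m A *m invmx C.

Definition cayley_inv A Y : 'M[R]_n := 2 *: ((Y - A) *m invmx (Y + A) *m A).

Section Fixed.
Variable M : 'M[R]_n.
Hypothesis Mpos : symmetric_posdef M.

Lemma SSR_unit A : SSR M A -> A \in unitmx.
Proof.
by move=> [_ AA]; have := posdef_unit Mpos; rewrite -AA unitmx_mul => /andP[].
Qed.

(** As [W] anticommutes with [A] we have [A (1 + W) = (1 - W) A], and [W]
    commutes with [A A = M]. So [Y] is conjugate to [A] by a matrix commuting
    with [M], and [(Y + A) (1 + W) = 2 A] while [(Y - A) (1 + W) = 2 W A]. *)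
Lemma cayley_skew A (W : 'M[R]_n) : SSR M A -> W^T = - W -> A *m W = - (W *m A) ->
  let C := 1%:M + W in let Y := C *m A *m invmx C in
  [/\ SSR M Y, char_poly Y = char_poly A, Y + A \in unitmx &
      (Y - A) *m invmx (Y + A) = W].
Proof.
move=> sA skW AW C Y; have [sAT AA] := sA.
have uA := SSR_unit sA.
have uC : C \in unitmx by exact: skew_unit.
have uC' : 1%:M - W \in unitmx by apply: skew_unit; rewrite linearN /= skW.
have AC : A *m C = (1%:M - W) *m A by rewrite mulmxDr mulmxBl AW mulmx1 mul1mx.
have AC' : A *m (1%:M - W) = C *m A by rewrite mulmxBr mulmxDl AW opprK mulmx1 mul1mx.
have CC' : C *m (1%:M - W) = (1%:M - W) *m C.
  rewrite /C !(mulmxDl, mulmxDr, mulmxN, mulNmx, mulmx1, mul1mx); mxring.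
have CT : C^T = 1%:M - W by rewrite linearD /= trmx1 skW.
have YC : Y *m C = C *m A by rewrite mulmxKV.
have YT : Y^T = Y.
  apply: (can_inj (mulKmx uC')); apply: (can_inj (mulmxK uC)).
  rewrite -[RHS]mulmxA YC.
  rewrite /Y !trmx_mul trmx_inv CT sAT !mulmxA mulmxV // mul1mx.
  by rewrite AC' -[LHS]mulmxA AC mulmxA CC'.
have MW : C *m M = M *m C.
  rewrite /C mulmxDl mulmxDr mul1mx mulmx1; congr (_ + _).
  by rewrite -AA -[in RHS]mulmxA AW mulmxN !mulmxA AW mulNmx opprK.
have YY : Y *m Y = M.
  by rewrite {2}/Y !mulmxA YC -[C *m A *m A]mulmxA AA MW mulmxK.
have YpA : (Y + A) *m C = 2 *: A.
  by rewrite mulmxDl YC AC /C !(mulmxDl, mulNmx, mul1mx); mxring.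
have uYA : Y + A \in unitmx.
  have : (Y + A) *m C \in unitmx by rewrite YpA unitmxZ // unitfE pnatr_eq0.
  by rewrite unitmx_mul => /andP[].
split=> //; first exact: char_poly_conj.
apply: (can_inj (mulmxK uYA)); rewrite mulmxKV //.
apply: (can_inj (mulmxK uC)); rewrite -mulmxA YpA mulmxBl YC AC.
rewrite /C !(mulmxDl, mulNmx, mul1mx) -scalemxAr; mxring.
Qed.

(** Put [S = Y + A] and [D = Y - A]. Since [Y] and [A] have the same square,
    [S Y = A S], [D Y = - A D] and [D S = - S D]; the three conclusions
    rewrite these identities. *)
Lemma cayley_skew_inv A Y : SSR M A -> SSR M Y -> Y + A \in unitmx ->
  let W := (Y - A) *m invmx (Y + A) in
  [/\ W^T = - W, A *m W = - (W *m A) & Y = (1%:M + W) *m A *m invmx (1%:M + W)].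
Proof.
move=> [AT AA] [YT YY] uS W.
set S := Y + A in uS W *; set D := Y - A in W *.
have SY : S *m Y = A *m S by rewrite mulmxDl mulmxDr YY AA addrC.
have DY : D *m Y = - (A *m D) by rewrite mulmxBl mulmxBr YY AA opprB.
have WS : W *m S = D by rewrite mulmxKV.
have SiA : invmx S *m A = Y *m invmx S.
  by apply: (can_inj (mulKmx uS)); apply: (can_inj (mulmxK uS));
     rewrite mulKVmx // !mulmxA mulmxKV // SY.
have WT : W^T = - W.
  have DS : D *m S = - (S *m D).
    rewrite /S /D !(mulmxDl, mulmxDr, mulmxN, mulNmx) YY AA; mxring.
  apply: (can_inj (mulmxK uS)); rewrite mulNmx WS.
  rewrite /W trmx_mul trmx_inv.
  have -> : S^T = S by rewrite linearD /= YT AT.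
  have -> : D^T = D by rewrite linearB /= YT AT.
  by apply: (can_inj (mulKmx uS)); rewrite !mulmxA mulmxV // mul1mx mulmxN DS.
have uC := skew_unit WT.
split=> //.
  by rewrite /W -mulmxA SiA !mulmxA DY mulNmx opprK.
apply: (can_inj (mulmxK uC)); rewrite mulmxKV //.
apply: (can_inj (mulmxK uS)); rewrite -!mulmxA -SY [in RHS]mulmxA mulmxDl mul1mx WS.
have -> : S + D = 2 *: Y by rewrite /S /D addrACA subrr addr0 scaler_nat mulr2n.
by rewrite -scalemxAl -scalemxAr.
Qed.

Lemma tangent_invmx A V : SSR M A -> tangent_at A V ->
  invmx A *m V = - (V *m invmx A).
Proof.
move=> sA tV; have uA := SSR_unit sA; have [VT VA] := tV.
have AV : A *m V = - (V *m A) by apply/eqP; rewrite -addr_eq0 addrC VA.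
apply: (can_inj (mulKmx uA)); apply: (can_inj (mulmxK uA)).
by rewrite mulmxA mulmxV // mul1mx mulmxN !mulmxA mulNmx mulmxKV // AV opprK.
Qed.

(** [V |-> W] is the linear change of variables that brings a tangent vector
    into the form used by the Cayley transform. *)
Lemma tangent_skew A V (W := 2^-1 *: (V *m invmx A)) : SSR M A -> tangent_at A V ->
  [/\ W^T = - W, A *m W = - (W *m A) & 2 *: (W *m A) = V].
Proof.
move=> sA tV; have [VT VA] := tV; have uA := SSR_unit sA; have [AT _] := sA.
have AV : A *m V = - (V *m A) by apply/eqP; rewrite -addr_eq0 addrC VA.
split.
- by rewrite linearZ /= trmx_mul trmx_inv VT AT (tangent_invmx sA tV) scalerN.
- by rewrite -scalemxAl -scalemxAr mulmxKV // mulmxA AV mulNmx mulmxK // scalerN.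
- by rewrite -scalemxAl mulmxKV // scalerA divff ?pnatr_eq0 // scale1r.
Qed.

Lemma cayleyP A V : SSR M A -> tangent_at A V ->
  [/\ SSR M (cayley A V), char_poly (cayley A V) = char_poly A,
      cayley A V + A \in unitmx & cayley_inv A (cayley A V) = V].
Proof.
move=> sA tV; have [skW AW WV] := tangent_skew sA tV.
have [h1 h2 h3 h4] := cayley_skew sA skW AW.
by split=> //; rewrite /cayley_inv h4 WV.
Qed.

Lemma cayley_invP A Y : SSR M A -> SSR M Y -> Y + A \in unitmx ->
  tangent_at A (cayley_inv A Y) /\ cayley A (cayley_inv A Y) = Y.
Proof.
move=> sA sY u; have [WT AW eY] := cayley_skew_inv sA sY u; have uA := SSR_unit sA.
have [AT AA] := sA; rewrite /cayley_inv; set W := (Y - A) *m _ in WT AW eY *.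
split.
  split; first by rewrite linearZ /= trmx_mul WT AT mulmxN AW opprK.
  by rewrite -scalemxAl -scalemxAr -scalerDr -mulmxA [A *m (W *m A)]mulmxA AW mulNmx
    mulmxA subrr scaler0.
rewrite /cayley -scalemxAl mulmxK // scalerA mulVf ?pnatr_eq0 // scale1r.
by rewrite -eY.
Qed.

(** Orthonormal eigenbases [P] of [A] and [P2] of [Y] are matched so as to
    have the same diagonal matrix [a]. Inserting signs [e] between them does
    not change the conclusion [Y = Q A Q^T], and by [sign_perturbation] the
    signs can be chosen so that -1 is not an eigenvalue of [Q]; then [Q] is a
    Cayley transform, which is what makes the class connected. *)
Lemma class_conj A Y : SSR M A -> SSR M Y -> char_poly Y = char_poly A ->
  exists Q, [/\ Q *m Q^T = 1%:M, Q *m M = M *m Q, Y = Q *m A *m Q^T &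
    1%:M + Q \in unitmx].
Proof.
move=> [AT AA] [YT YY].
have [P [a [oP eA]]] := real_spectral AT; have [P' [b [oP' eY]]] := real_spectral YT.
rewrite {1}eA {1}eY !char_poly_spectral // => /prod_XsubC_eq.
pose tb : n.-tuple R := map_tuple (fun j => b 0 j) (ord_tuple n).
rewrite perm_sym -[X in perm_eq _ X]/(tval tb) => /tuple_permP[s].
move/eq_in_map => es0.
have {es0} es j : b 0 (s j) = a 0 j.
  by rewrite es0 ?mem_enum // tnth_map tnth_ord_tuple.
pose P2 := row_perm s P'.
have oP2 : P2 *m P2^T = 1%:M.
  apply/matrixP => i j; have /matrixP/(_ (s i) (s j)) := oP'.
  rewrite !mxE (inj_eq perm_inj) => <-.
  by apply: eq_bigr => k _; rewrite !mxE.
have {}eY : Y = P2^T *m diag_mx a *m P2.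
  apply/matrixP => i j; rewrite eY !spectral_entry.
  rewrite (reindex_inj (@perm_inj _ s)) /=; apply: eq_bigr => k _.
  by rewrite es !mxE.
(* In the bases [P2] and [P] the matrix [1 + Q] reads [P2 P^T + diag e]. *)
have [e [e1 ue]] := sign_perturbation (P2 *m P^T).
have ee : diag_mx e *m diag_mx e = 1%:M.
  rewrite mulmx_diag; apply/matrixP => i j; rewrite !mxE -expr2 e1 //.
have ea : diag_mx e *m diag_mx a *m diag_mx e = diag_mx a.
  by rewrite diag_mxC -mulmxA ee mulmx1.
pose Q := P2^T *m diag_mx e *m P.
have QT : Q^T = P^T *m diag_mx e *m P2 by rewrite /Q !trmx_mul trmxK tr_diag_mx mulmxA.
have PP B : B *m P *m P^T = B by rewrite -mulmxA oP mulmx1.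
have ee' B : B *m diag_mx e *m diag_mx e = B by rewrite -mulmxA ee mulmx1.
have oQ : Q *m Q^T = 1%:M by rewrite QT /Q !mulmxA PP ee' orthV.
have eYQ : Y = Q *m A *m Q^T.
  rewrite QT /Q eA eY !mulmxA !PP; congr (_ *m _).
  by rewrite -{1}ea !mulmxA.
exists Q; split=> //.
- have QA : Q *m A = Y *m Q by rewrite eYQ -mulmxA (orthV oQ) mulmx1.
  by rewrite -{1}AA mulmxA QA -mulmxA QA mulmxA YY.
- have : P2 *m (1%:M + Q) *m P^T \in unitmx.
    by rewrite mulmxDr mulmxDl mulmx1 /Q !mulmxA oP2 mul1mx PP.
  by rewrite !unitmx_mul => /andP[/andP[]].
Qed.

Lemma SSR_conj A Q : SSR M A -> Q *m Q^T = 1%:M -> Q *m M = M *m Q ->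
  SSR M (Q *m A *m Q^T) /\ char_poly (Q *m A *m Q^T) = char_poly A.
Proof.
move=> [AT AA] oQ QM; split; last exact: char_poly_orth.
split; first by rewrite !trmx_mul trmxK AT mulmxA.
rewrite !mulmxA -[Q *m A *m Q^T *m Q]mulmxA (orthV oQ) mulmx1 -[Q *m A *m A]mulmxA AA.
by rewrite QM -mulmxA oQ mulmx1.
Qed.

Lemma tangent_conj A Q V : Q *m Q^T = 1%:M ->
  tangent_at A V -> tangent_at (Q *m A *m Q^T) (Q *m V *m Q^T).
Proof.
move=> oQ [VT VA]; split; first by rewrite !trmx_mul trmxK VT mulmxA.
rewrite !mulmxA -[Q *m V *m Q^T *m Q]mulmxA -[Q *m A *m Q^T *m Q]mulmxA (orthV oQ) !mulmx1.
by rewrite -mulmxDl -[Q *m V *m A]mulmxA -[Q *m A *m V]mulmxA -mulmxDr VA mulmx0 mul0mx.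
Qed.

(** Says that the tangent space at [A] has dimension [d], in the form of
    linear coordinates on it. *)
Definition tangent_coord (d : nat) A : Prop :=
  exists (L : {linear 'rV[R]_d -> 'M[R]_n}) (C : {linear 'M[R]_n -> 'rV[R]_d}),
   [/\ forall x, tangent_at A (L x), forall x, C (L x) = x &
       forall V, tangent_at A V -> L (C V) = V].

Lemma tangent_coord_conj d A Q : Q *m Q^T = 1%:M ->
  tangent_coord d A -> tangent_coord d (Q *m A *m Q^T).
Proof.
move=> oQ [L [C [LT CL LC]]].
have linQ (P : 'M[R]_n) : linear (fun V : 'M[R]_n => P *m V *m P^T).
  by move=> a U V; rewrite mulmxDr mulmxDl -scalemxAr -scalemxAl.
(* Coordinates are transported by the linear map [V |-> Q V Q^T]. *)
pose cQ P : {linear 'M[R]_n -> 'M[R]_n} :=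
  HB.pack (fun V : 'M[R]_n => P *m V *m P^T) (GRing.isLinear.Build _ _ _ _ _ (linQ P)).
have QK V : Q^T *m (Q *m V *m Q^T) *m Q = V.
  by rewrite !mulmxA (orthV oQ) mul1mx -mulmxA (orthV oQ) mulmx1.
have KQ V : Q *m (Q^T *m V *m Q) *m Q^T = V.
  by rewrite !mulmxA oQ mul1mx -mulmxA oQ mulmx1.
exists (cQ Q \o L), (C \o cQ Q^T); split=> [x|x|V tV] /=.
- exact: tangent_conj.
- by rewrite trmxK QK CL.
- have oT : Q^T *m Q^T^T = 1%:M by rewrite trmxK orthV.
  have := tangent_conj oT tV; rewrite trmxK QK => tV'.
  by rewrite LC ?trmxK ?KQ.
Qed.

Definition ssr_class A : set 'M[R]_n := [set Y | SSR M Y /\ char_poly Y = char_poly A].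

Lemma ssr_class_eq A B : ssr_class A B -> ssr_class B = ssr_class A.
Proof. by move=> [_ e]; apply/seteqP; split=> Y [sY eY];
  (split; [exact: sY|]); [exact: etrans eY e|exact: etrans eY (esym e)]. Qed.

(** Conjugation carries the tangent space of one point of a class onto that of
    another. *)
Lemma class_tangent_coord d A B : SSR M A -> tangent_coord d A -> ssr_class A B ->
  tangent_coord d B.
Proof.
move=> sA tA [sB eB]; have [Q [oQ _ -> _]] := class_conj sA sB eB.
exact: tangent_coord_conj.
Qed.

Lemma smooth_at_cayley_inv A Y : Y + A \in unitmx -> smooth_at Y (cayley_inv A).
Proof.
move=> u; apply: smooth_at_scale; first exact: smooth_at_cst.
apply: smooth_at_mulmx; last exact: smooth_at_cst.
have s1 : smooth_at Y (fun Z : 'M[R]_n => Z - A).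
  by apply: smooth_at_sub; [exact: smooth_at_id|exact: smooth_at_cst].
apply: smooth_at_mulmx => //; apply: (@smooth_at_invmx _ _ _ _ (fun Z => Z + A)) => //.
by apply: smooth_at_add; [exact: smooth_at_id|exact: smooth_at_cst].
Qed.

Lemma smooth_at_cayley_arg A V : smooth_at V (fun V => 1%:M + 2^-1 *: (V *m invmx A)).
Proof.
apply: smooth_at_add; first exact: smooth_at_cst.
apply: smooth_at_scale; first exact: smooth_at_cst.
by apply: smooth_at_mulmx; [exact: smooth_at_id|exact: smooth_at_cst].
Qed.

Lemma smooth_at_cayley A V : SSR M A -> tangent_at A V -> smooth_at V (cayley A).
Proof.
move=> sA tV; have [skW _ _] := tangent_skew sA tV.
have s1 := smooth_at_cayley_arg A V.
apply: smooth_at_mulmx.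
  by apply: smooth_at_mulmx => //; exact: smooth_at_cst.
by apply: (@smooth_at_invmx _ _ _ _ (fun V => 1%:M + 2^-1 *: (V *m invmx A))) => //; exact: skew_unit.
Qed.

(** The differential at 0 of the chart is the identity of the tangent space,
    so every tangent vector is reached. *)
Lemma has_deriv_cayley A V : SSR M A -> tangent_at A V -> has_deriv (cayley A) 0 V V.
Proof.
move=> sA tV; have [skW AW WV] := tangent_skew sA tV; have uA := SSR_unit sA.
have s1 := smooth_at_cayley_arg A 0.
have mulmxr_lin : linear (fun V : 'M[R]_n => 2^-1 *: (V *m invmx A)).
  by move=> a U W; rewrite mulmxDl scalerDr -scalemxAl !scalerA mulrC.
pose H : {linear 'M[R]_n -> 'M[R]_n} :=
  HB.pack (fun V : 'M[R]_n => 2^-1 *: (V *m invmx A)) (GRing.isLinear.Build _ _ _ _ _ mulmxr_lin).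
have d1 : has_deriv (fun V => 1%:M + 2^-1 *: (V *m invmx A)) 0 V (2^-1 *: (V *m invmx A)).
  rewrite -[X in has_deriv _ _ _ X]add0r; apply: has_deriv_add; first exact: has_deriv_cst.
  exact: (has_deriv_lin H (has_deriv_id _ _)).
have e0 : 1%:M + 2^-1 *: (0 *m invmx A) = 1%:M by rewrite mul0mx scaler0 addr0.
have d2 := has_deriv_mulmx d1 (has_deriv_cst A 0 V).
have u0 : 1%:M + 2^-1 *: (0 *m invmx A) \in unitmx by rewrite e0 unitmx1.
have := has_deriv_mulmx d2 (has_deriv_invmx s1 u0 d1).
rewrite e0 invmx1 mulmx0 addr0 !mul1mx !mulmx1 mulmxN AW opprK.
have -> : forall B : 'M[R]_n, B + B = 2 *: B by move=> B; rewrite scaler_nat mulr2n.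
by rewrite WV.
Qed.

(** The image is cut out by the open condition that [Y + A] be invertible, and
    [cayley_inv] is the inverse chart. *)
Lemma cayley_chart d A : SSR M A -> tangent_coord d A ->
  exists2 p : param R d 'M[R]_n, submanifold_atlas d (ssr_class A) p &
    [/\ pdom p 0, p 0 = A & forall V, tangent_at A V ->
      exists w, has_deriv (pfun p) 0 w V].
Proof.
move=> sA [L [C [LT CL LC]]]; have uA := SSR_unit sA.
have cayley0 : cayley A 0 = A.
  by rewrite /cayley mul0mx scaler0 addr0 mul1mx invmx1 mulmx1.
exists (Param setT (fun x => cayley A (L x))); last first.
  split=> //=; first by rewrite linear0 cayley0.
  move=> V tV; exists (C V).
  apply: (@has_deriv_comp _ _ _ _ _ L (cayley A) _ _ V).
    rewrite -{2}(LC V tV); exact: (has_deriv_lin L (has_deriv_id _ _)).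
  by rewrite linear0; exact: has_deriv_cayley.
split=> /=; first exact: openT.
- exists [set Y | Y + A \in unitmx].
    have -> : [set Y : 'M[R]_n | Y + A \in unitmx] =
      (fun Y => Y + A) @^-1` [set Y : 'M[R]_n | Y \in unitmx] by [].
    apply: open_comp; last exact: open_unitmx.
    by move=> Y _; apply: continuousD; [exact: cvg_id|exact: cst_continuous].
  apply/seteqP; split=> Y; rewrite /pimage /ssr_class /=.
    by move=> [x _ <-]; have [? ? ? _] := cayleyP sA (LT x).
  move=> [[sY _] u]; have [tY eY] := cayley_invP sA sY u.
  by exists (C (cayley_inv A Y)) => //=; rewrite LC.
- apply/smooth_onP; first exact: openT.
  move=> x _; apply: (@smooth_at_comp _ _ _ _ _ _ _ L); first exact: smooth_at_lin.
  exact: smooth_at_cayley.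
- exists (fun Y => C (cayley_inv A Y)); last first.
    by move=> x _; have [_ _ _ ->] := cayleyP sA (LT x).
  move=> Y [x _ <-]; have [_ _ u _] := cayleyP sA (LT x).
  have [U [oU Ux sU]] : smooth_at (cayley A (L x)) (fun Y => C (cayley_inv A Y)).
    apply: (@smooth_at_comp _ _ _ _ _ _ _ (cayley_inv A) C); first exact: smooth_at_cayley_inv.
    exact: smooth_at_lin.
  by exists U, (fun Y => C (cayley_inv A Y)).
Qed.

Lemma class_embedded d A (N : set 'M[R]_n) : SSR M A -> tangent_coord d A ->
  ssr_class A `<=` N -> embedded_submanifold d (ssr_class A) N.
Proof.
move=> sA tA SN; split=> // B SB.
have [p pS [p0 pB _]] := cayley_chart SB.1 (class_tangent_coord sA tA SB).
exists p; first by rewrite -(ssr_class_eq SB).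
by exists 0.
Qed.

(** One inclusion differentiates the equations [Y^T = Y] and [Y Y = M] along a
    chart; the other follows from the differential of the Cayley chart at 0.
    *)
Lemma class_tangent_space d A : SSR M A -> tangent_coord d A ->
  tangent_space d (ssr_class A) A = tangent_at A.
Proof.
move=> sA tA; apply/seteqP; split=> V.
  move=> [p [u [w [[op [N oN pN] sp cp] pu pA eV]]]]; rewrite {}eV.
  have [AT AA] := sA.
  have su : smooth_at u (pfun p) by exists (pdom p).
  have dp := smooth_at_deriv w su; move: ('d (pfun p) u w) dp => W dp.
  have np : \near u, pdom p u by exact: open_nbhs_nbhs.
  have pS x : pdom p x -> SSR M (p x).
    by move=> px; have [[//]] : (ssr_class A `&` N) (p x) by rewrite -pN; exists x.
  split.
    have e1 : {near u, (fun x => (p x)^T) =1 pfun p}.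
      by apply: filterS np => x /pS[].
    have d1 := has_deriv_ext e1 (has_deriv_lin (@trmx R n n) dp).
    exact: has_deriv_uniq d1 dp.
  have e2 : {near u, (fun x => p x *m p x) =1 (fun=> M)}.
    by apply: filterS np => x /pS[].
  have d2 := has_deriv_ext e2 (has_deriv_mulmx dp dp).
  by rewrite -pA; exact: has_deriv_uniq d2 (has_deriv_cst _ _ _).
move=> tV; have [p pS [p0 pA h]] := cayley_chart sA tA.
by have [w [_ dw]] := h V tV; exists p, 0, w.
Qed.

End Fixed.
End Roots.

(** * Compactness and connected components *)

Section Topology.
Context {R : realType} {n : nat}.
Variable M : 'M[R]_n.
Hypothesis Mpos : symmetric_posdef M.
Implicit Types (A Y V Q K C : 'M[R]_n).

Lemma smooth_continuous (E F : normedModType R) (f : E -> F) :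
  (forall x, smooth_at x f) -> continuous f.
Proof. by move=> h x; apply: smooth_at_cont. Qed.

Lemma closed_zeros (E F : normedModType R) (f : E -> F) :
  continuous f -> closed [set x | f x = 0].
Proof.
move=> cf; have -> : [set x | f x = 0] = f @^-1` [set 0] by [].
apply: preimage_closed => [x _|]; first exact: cf.
apply: accessible_closed_set1; apply: hausdorff_accessible; exact: norm_hausdorff.
Qed.

Lemma SSR_closed : closed (SSR M).
Proof.
have -> : SSR M = [set Y | Y^T - Y = 0] `&` [set Y | Y *m Y - M = 0].
  by apply/seteqP; split=> Y [h1 h2]; split=> //=; apply/eqP;
    rewrite ?subr_eq0 ?h1 ?h2 //; rewrite -subr_eq0 ?h1 ?h2.
apply: closedI; apply: closed_zeros; apply: smooth_continuous => Y.
  by apply: smooth_at_sub; [apply: smooth_at_trmx|]; exact: smooth_at_id.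
apply: smooth_at_sub; last exact: smooth_at_cst.
by apply: smooth_at_mulmx; exact: smooth_at_id.
Qed.

(** The squares of the entries of the [i]-th row of [A] sum to [M i i]. *)
Lemma SSR_bounded A i j : SSR M A -> `|A i j| <= 1 + `|M|.
Proof.
move=> [AT AA].
have h1 : A i j ^+ 2 <= M i i.
  have -> : M i i = \sum_k A i k ^+ 2.
    by rewrite -AA mxE; apply: eq_bigr => k _; rewrite -{2}AT mxE expr2.
  by rewrite (bigD1 j) //= lerDl sumr_ge0 // => k _; rewrite sqr_ge0.
have h2 : M i i <= `|M|.
  apply: le_trans (ler_norm _) _.
  rewrite [leRHS]/Num.Def.normr/= mx_normrE.
  exact: (le_bigmax _ (fun ij : 'I_n * 'I_n => `|M ij.1 ij.2|) (i, i)).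
have h3 : `|A i j| ^+ 2 <= `|M| by rewrite real_normK ?num_real // (le_trans h1).
have := normr_ge0 (A i j); have := normr_ge0 M; nra.
Qed.

Lemma SSR_compact : compact (SSR M).
Proof.
pose K := [set x : 'rV[R]_(n * n) | SSR M (vec_mx x)].
have cv : continuous (vec_mx : 'rV[R]_(n * n) -> 'M[R]_n).
  exact: linear_mx_continuous.
have -> : SSR M = vec_mx @` K.
  apply/seteqP; split=> [Y sY|_ [x Kx <-]] //.
  by exists (mxvec Y); rewrite /K /= mxvecK.
apply: continuous_compact; first exact: continuous_subspaceT.
apply: bounded_closed_compact; last first.
  apply: preimage_closed SSR_closed => x _; exact: cv.
exists (1 + `|M|); split; first exact: num_real.
move=> b ltb x Kx /=; rewrite [leLHS]/Num.Def.normr/= mx_normrE.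
apply: bigmax_le => [|[i j] _ /=].
  by apply: le_trans (ltW ltb); rewrite addr_ge0.
rewrite ord1; case/mxvec_indexP: j => k l.
rewrite -[x]vec_mxK mxvecE; apply: le_trans (ltW ltb); exact: SSR_bounded.
Qed.

(** A root close to [A] lies in the range of the Cayley chart at [A]. *)
Lemma class_near A : SSR M A -> \forall Y \near A, SSR M Y -> char_poly Y = char_poly A.
Proof.
move=> sA.
have u : A + A \in unitmx.
  rewrite -mulr2n -scaler_nat unitmxZ ?(SSR_unit Mpos) // unitfE pnatr_eq0 //.
have c : continuous (fun Y : 'M[R]_n => Y + A).
  apply: smooth_continuous => Y; apply: smooth_at_add; [exact: smooth_at_id|exact: smooth_at_cst].
have h : \forall Y \near A, Y + A \in unitmx :=
  c A _ (open_nbhs_nbhs (conj (@open_unitmx R n) u)).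
apply: filterS h => Y /= uY sY; have [tY <-] := cayley_invP Mpos sA sY uY.
by have [] := cayleyP Mpos sA tY.
Qed.

Lemma class_closed A : SSR M A -> closed (ssr_class M A).
Proof.
move=> sA Y cY.
have sY : SSR M Y.
  by apply: SSR_closed; apply: closureS cY => Z [].
split=> //; have [Z [[sZ eZ]]] := cY _ (class_near sY).
by move=> /(_ sZ) <-.
Qed.

Lemma class_compact A : SSR M A -> compact (ssr_class M A).
Proof.
move=> sA; apply: subclosed_compact SSR_compact _; first exact: class_closed.
by move=> Y [].
Qed.

(** With [Q] from [class_conj] and [K] its inverse Cayley transform, the curve
    [t |-> Q_t A Q_t^T], where [Q_t] is the Cayley transform of [t K], runs
    from [A] at 0 to [Y] at 1. It stays in the class because [K] is skew and
    commutes with [M]. *)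
Lemma class_path A Y : SSR M A -> ssr_class M A Y ->
  exists C : set 'M[R]_n, [/\ connected C, C A, C Y & C `<=` ssr_class M A].
Proof.
move=> sA [sY eY]; have [Q [oQ QM eYQ uQ]] := class_conj sA sY eY.
have oQ' := orthV oQ.
(* [Q = (1 + K) (1 - K)^-1] since [K S = Q - 1] and [S = 1 + Q]. *)
pose S := 1%:M + Q; pose K := (Q - 1%:M) *m invmx S.
have KS : K *m S = Q - 1%:M by rewrite /K mulmxKV.
have SK : S *m K = Q - 1%:M.
  have e : S *m (Q - 1%:M) = (Q - 1%:M) *m S.
    by rewrite /S !(mulmxDl, mulmxDr, mulmxN, mulNmx, mulmx1, mul1mx); mxring.
  by rewrite /K mulmxA e mulmxK.
have KT : K^T = - K.
  have uST : S^T \in unitmx by rewrite unitmx_tr.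
  have uS : S \in unitmx := uQ.
  apply: (can_inj (mulKmx uST)); apply: (can_inj (mulmxK uS)).
  rewrite -trmx_mul KS mulmxN mulNmx -[_ *m K *m S]mulmxA KS /S !linearD /= linearN /= !trmx1.
  by rewrite !(mulmxDl, mulmxDr, mulmxN, mulNmx, mulmx1, mul1mx) oQ'; mxring.
have KM : K *m M = M *m K.
  apply: (can_inj (mulKmx uQ)); rewrite mulmxA SK mulmxBl mul1mx QM.
  have SM : S *m M = M *m S by rewrite /S mulmxDl mulmxDr mulmx1 mul1mx QM.
  by rewrite mulmxA SM -mulmxA SK mulmxBr mulmx1.
pose Qt (t : R) := (1%:M + t *: K) *m invmx (1%:M - t *: K).
have uP t : 1%:M + t *: K \in unitmx by apply: skew_unit; rewrite linearZ /= KT scalerN.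
have uN t : 1%:M - t *: K \in unitmx.
  by apply: skew_unit; rewrite linearN /= linearZ /= KT scalerN.
have PN t : (1%:M + t *: K) *m (1%:M - t *: K) = (1%:M - t *: K) *m (1%:M + t *: K).
  by rewrite !(mulmxDl, mulmxDr, mulmxN, mulNmx, mulmx1, mul1mx); mxring.
have QtE t : Qt t = invmx (1%:M - t *: K) *m (1%:M + t *: K).
  by apply: (can_inj (mulKmx (uN t))); rewrite mulKVmx // /Qt mulmxA -PN mulmxK.
have oQt t : Qt t *m (Qt t)^T = 1%:M.
  have PT : (1%:M + t *: K)^T = 1%:M - t *: K.
    by rewrite linearD /= trmx1 linearZ /= KT scalerN.
  have NT : (1%:M - t *: K)^T = 1%:M + t *: K.
    by rewrite linearB /= trmx1 linearZ /= KT scalerN opprK.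
  rewrite {2}/Qt trmx_mul trmx_inv PT NT QtE.
  by rewrite -mulmxA mulKVmx // mulVmx.
have QtM t : Qt t *m M = M *m Qt t.
  have tKM : t *: K *m M = M *m (t *: K) by rewrite -scalemxAl -scalemxAr KM.
  apply: (can_inj (mulKmx (uN t))).
  have -> : (1%:M - t *: K) *m (M *m Qt t) = M *m (1%:M + t *: K).
    rewrite mulmxA mulmxBl mul1mx tKM -{1}[M]mulmx1 -mulmxBr -mulmxA QtE mulKVmx //.
  by rewrite QtE -!mulmxA mulKVmx // mulmxDl mulmxDr mul1mx mulmx1 tKM.
pose g (t : R^o) := Qt t *m A *m (Qt t)^T.
have cg : continuous g.
  have s1 (t : R^o) : smooth_at t (fun t : R^o => t *: K).
    apply: smooth_at_scale; last exact: smooth_at_cst.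
    exists setT; split=> //; first exact: openT.
    by move=> k; apply: (@Ck_linear R R^o R^o k setT idfun) => z; exact: cvg_id.
  have s2 (t : R^o) : smooth_at t Qt.
    apply: smooth_at_mulmx; first by apply: smooth_at_add => //; exact: smooth_at_cst.
    apply: (@smooth_at_invmx R R^o t _ (fun t => 1%:M - t *: K)); first exact: uN.
    by apply: smooth_at_sub => //; exact: smooth_at_cst.
  apply: smooth_continuous => t; apply: smooth_at_mulmx; last exact: smooth_at_trmx.
  by apply: smooth_at_mulmx => //; exact: smooth_at_cst.
exists (g @` setT); split.
- apply: connected_continuous_connected; last exact: continuous_subspaceT.
  exact/connected_intervalP.
- exists 0 => //; rewrite /g.
  by rewrite /Qt scale0r subr0 addr0 invmx1 mulmx1 mul1mx trmx1 mulmx1.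
- exists 1 => //; rewrite /g.
  suff -> : Qt 1 = Q by [].
  apply: (can_inj (mulmxK (uN 1))); rewrite mulmxKV // scale1r.
  apply: (can_inj (mulmxK uQ)); rewrite -/S mulmxDl -mulmxA mulmxBl !mul1mx KS.
  by rewrite /S !(mulmxDl, mulmxDr, mulmxN, mulNmx, mulmx1, mul1mx); mxring.
- by move=> _ [t _ <-]; exact: SSR_conj.
Qed.

(** A class is connected, and both open and closed in the set of roots. *)
Lemma class_component A : SSR M A -> connected_component (SSR M) A = ssr_class M A.
Proof.
move=> sA; apply/seteqP; split=> [Y [C [CA CS cC] CY]|Y SY]; last first.
  have [C [cC CA CY CS]] := class_path sA SY.
  by exists C => //; split=> // Z /CS[].
have : C `&` ssr_class M A = C.
  apply: cC; first by exists A; split.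
    (* The class is open: it is the union of the ranges of its Cayley charts.
       *)
    exists (\bigcup_(Z in ssr_class M A) [set Y' | Y' + Z \in unitmx]).
      apply: bigcup_open => Z _.
      have -> : [set Y' : 'M[R]_n | Y' + Z \in unitmx] =
        (fun Y' => Y' + Z) @^-1` [set Y' : 'M[R]_n | Y' \in unitmx] by [].
      apply: open_comp; last exact: open_unitmx.
      by move=> Y' _; apply: continuousD; [exact: cvg_id|exact: cst_continuous].
    apply/seteqP; split=> [Z [CZ SZ]|Z [CZ [Z' [sZ' eZ'] uZ]]]; split=> //.
      exists Z => //=; have := SSR_unit Mpos SZ.1.
      by rewrite -mulr2n -scaler_nat unitmxZ // unitfE pnatr_eq0.
    split; first exact: CS.
    have [tY <-] := cayley_invP Mpos sZ' (CS _ CZ) uZ.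
    by have [_ -> _ _] := cayleyP Mpos sZ' tY.
  by exists (ssr_class M A) => //; exact: class_closed.
by move/seteqP => [_ h]; have [] := h _ CY.
Qed.

End Topology.

(** * The trace metric on a class *)

Section Metric.
Context {R : realType} {n : nat}.
Variable M : 'M[R]_n.
Hypothesis Mpos : symmetric_posdef M.
Implicit Types (A Y V Q K C : 'M[R]_n).

Lemma trD (U V : 'M[R]_n) : \tr (U + V) = \tr U + \tr V.
Proof. exact: linearD. Qed.
Lemma trN (U : 'M[R]_n) : \tr (- U) = - \tr U.
Proof. exact: linearN. Qed.
Lemma trZ a (U : 'M[R]_n) : \tr (a *: U) = a * \tr U.
Proof. exact: linearZ. Qed.

Lemma trace_gram_gt0 (B : 'M[R]_n) : B != 0 -> 0 < \tr (B *m B^T).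
Proof.
have sq k : 0 <= (B *m B^T) k k.
  by rewrite mxE sumr_ge0 // => l _; rewrite mxE -expr2 sqr_ge0.
move=> B0; rewrite lt_neqAle sumr_ge0 // andbT; apply: contra_neq B0 => e.
apply/matrixP => i j; rewrite mxE.
have /eqP : \sum_k (B *m B^T) k k = 0 by exact: esym e.
rewrite psumr_eq0 => [/allP/(_ i (mem_index_enum _))|//].
rewrite implyTb mxE psumr_eq0 => [/allP/(_ j (mem_index_enum _))|k _]; last first.
  by rewrite mxE -expr2 sqr_ge0.
by rewrite implyTb mxE -expr2 sqrf_eq0 => /eqP.
Qed.

(** On the tangent space [A^-1 V = - V A^-1], so the metric is minus the
    squared Frobenius norm of [V A^-1]. *)
Lemma trace_metric_neg A V : SSR M A -> tangent_at A V -> V != 0 ->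
  trace_metric A V V < 0.
Proof.
move=> sA tV V0; have uA := SSR_unit Mpos sA; have [VT VA] := tV.
pose B := V *m invmx A.
have B0 : B != 0 by apply: contra_neq V0 => B0; rewrite -[V](mulmxKV uA) -/B B0 mul0mx.
have -> : trace_metric A V V = - \tr (B *m B^T).
  rewrite /trace_metric (tangent_invmx Mpos sA tV) !mulNmx linearN /= -/B; congr (- \tr _).
  by rewrite -mulmxA /B trmx_mul trmx_inv VT sA.1.
by rewrite oppr_lt0 trace_gram_gt0.
Qed.

Lemma class_tangentE d A B : SSR M A -> tangent_coord d A -> ssr_class M A B ->
  tangent_space d (ssr_class M A) B = tangent_at B.
Proof.
move=> sA tA SB; rewrite -(ssr_class_eq SB).
exact: (class_tangent_space Mpos SB.1 (class_tangent_coord sA tA SB)).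
Qed.

(** The metric is negative definite on tangent spaces, so its index is their
    dimension. *)
Lemma class_semi_riemannian d A : SSR M A -> tangent_coord d A ->
  semi_riemannian_submanifold (GLn n) trace_metric d (ssr_class M A).
Proof.
move=> sA tA; split.
  by apply: class_embedded => // Y [/(SSR_unit Mpos)].
exists d => B SB; rewrite (class_tangentE sA tA SB).
have [L [C [LT CL LC]]] := class_tangent_coord sA tA SB.
split.
  move=> V tV h; apply/eqP/negP => /negP V0.
  by have := trace_metric_neg SB.1 tV V0; rewrite h // ltxx.
pose T : {vspace 'M[R]_n} := limg (linfun L).
have TE V : (V \in T) <-> tangent_at B V.
  split=> [/memv_imgP[x _ ->]|tV]; first by rewrite lfunE; exact: LT.
  by rewrite -(LC V tV) -lfunE memv_img // memvf.
have dT : \dim T = d.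
  rewrite /T limg_dim_eq ?dimvf ?dim_matrix; first exact: mul1n.
  rewrite capfv; apply/eqP/lker0P => x y; rewrite !lfunE /= => /(congr1 C).
  by rewrite !CL.
split; first exists T.
  split=> // [V /= /TE//|V /TE tV V0].
  exact: (trace_metric_neg SB.1).
move=> L' sL' _; rewrite -dT; apply: dimvS; apply/subvP => V VL.
by apply/TE/sL'.
Qed.

(** The Levi-Civita connection of the trace metric on the general linear
    group: the flat derivative, corrected by a term symmetric in [X] and [Y].
    *)
Definition trace_nabla (X Y : 'M[R]_n -> 'M[R]_n) (A : 'M[R]_n) : 'M[R]_n :=
  'd Y A (X A) - 2^-1 *: (X A *m invmx A *m Y A + Y A *m invmx A *m X A).

Lemma trace_nablaE (X Y : 'M[R]_n -> 'M[R]_n) A W : has_deriv Y A (X A) W ->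
  trace_nabla X Y A = W - 2^-1 *: (X A *m invmx A *m Y A + Y A *m invmx A *m X A).
Proof. by case=> _ <-. Qed.

Lemma has_deriv_exists (E F : normedModType R) (f : E -> F) x v :
  smooth_at x f -> exists w, has_deriv f x v w.
Proof. by move=> sf; exists ('d f x v); exact: smooth_at_deriv. Qed.

Lemma smooth_at_invmx_id A : A \in unitmx -> smooth_at A (@invmx R n).
Proof. by move=> uA; apply: (@smooth_at_invmx _ _ _ _ id) => //; exact: smooth_at_id. Qed.

(** The differential is expanded on the matrix basis, its coefficients being
    directional derivatives in fixed directions. *)
Lemma smooth_trace_nabla (X Y : 'M[R]_n -> 'M[R]_n) : smooth_on (GLn n) X -> smooth_on (GLn n) Y ->
  smooth_on (GLn n) (trace_nabla X Y).
Proof.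
have oG := @open_unitmx R n.
move=> sX sY; apply/smooth_onP => // A uA.
have [sXA sYA] := ((smooth_onP _ oG).1 sX A uA, (smooth_onP _ oG).1 sY A uA).
have sI := smooth_at_invmx_id uA.
apply: smooth_at_sub.
  apply: (@smooth_at_ext _ _ _ _ (fun B => \sum_i \sum_j X B i j *: 'D_(delta_mx i j) Y B)).
    have nA : \near A, A \in unitmx by exact: open_nbhs_nbhs (conj oG uA).
    apply: filterS nA => B uB; rewrite diff_mx_sum //.
    exact: smooth_at_diff ((smooth_onP _ oG).1 sY B uB).
  apply: smooth_at_sum => i; apply: smooth_at_sum => j.
  apply: smooth_at_scale; first exact: smooth_at_entry.
  exists (GLn n); split=> // k.
  by have /CkS[_] := sY k.+1; apply.
apply: smooth_at_scale; first exact: smooth_at_cst.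
by apply: smooth_at_add; apply: smooth_at_mulmx => //; apply: smooth_at_mulmx.
Qed.

Lemma has_deriv_trace_metric (Y Z : 'M[R]_n -> 'M[R]_n) A V Y' Z' : A \in unitmx ->
  has_deriv Y A V Y' -> has_deriv Z A V Z' -> let i := invmx A in
  has_deriv (fun B => trace_metric B (Y B) (Z B) : R^o) A V
   (\tr (i *m Y' *m i *m Z A) + \tr (i *m Y A *m i *m Z')
    - \tr (i *m V *m i *m Y A *m i *m Z A) - \tr (i *m Y A *m i *m V *m i *m Z A)).
Proof.
move=> uA dY dZ i; have sI := smooth_at_invmx_id uA.
have dI : has_deriv (@invmx R n) A V (- (i *m V *m i)).
  exact: (@has_deriv_invmx _ _ _ id _ _ _ (smooth_at_id _) uA (has_deriv_id _ _)).
have d1 := has_deriv_mulmx (has_deriv_mulmx (has_deriv_mulmx dI dY) dI) dZ.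
have := has_deriv_lin (@mxtrace R n : {linear 'M[R]_n -> R^o}) d1.
congr has_deriv => /=.
rewrite -/i !(mulmxDl, mulmxN, mulNmx) !(trD, trN) !mulmxA.
by ring.
Qed.

(* The values of the connection are obtained from [trace_nablaE] only, which
   keeps differentials out of conversion. *)
Opaque trace_nabla.

(** There is no torsion since the correction term is symmetric. The derivative
    of the metric contains two terms that come from the two inverses; each is
    the sum of two halves produced by the correction term. *)
Lemma trace_levi_civita : levi_civita (GLn n) trace_metric trace_nabla.
Proof.
have oG := @open_unitmx R n.
split; first exact: smooth_trace_nabla.
move=> X Y Z f sX sY sZ sf A uA.
have sat (F : normedModType R) (h : 'M[R]_n -> F) (sh : smooth_on (GLn n) h) :
  smooth_at A h := (smooth_onP _ oG).1 sh A uA.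
have [[sXA sYA] [sZA sfA]] := (sat _ _ sX, sat _ _ sY, (sat _ _ sZ, sat _ _ sf)).
have [Y' dY] := has_deriv_exists (X A) sYA; have [Z' dZ] := has_deriv_exists (X A) sZA.
have [X' dX] := has_deriv_exists (Y A) sXA; have [f' df] := has_deriv_exists (X A) sfA.
have [Z2 dZY] := has_deriv_exists (Y A) sZA.
have dZl : has_deriv Z A (f A *: X A + Y A) (f A *: Z' + Z2).
  split; first by case: dZ.
  have [[_ <-] [_ <-]] := (dZ, dZY); rewrite linearD; congr (_ + _); exact: linearZ.
have [[_ eY] [_ eX] [_ ef]] := And3 dY dX df.
split.
- rewrite (@trace_nablaE (fun B => f B *: X B + Y B) Z A _ dZl).
  rewrite (trace_nablaE dZ) (trace_nablaE dZY).
  by rewrite !(mulmxDl, mulmxDr, =^~ scalemxAl, =^~ scalemxAr); mxring.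
- rewrite (trace_nablaE (has_deriv_add dY dZ)) (trace_nablaE dY) (trace_nablaE dZ).
  by rewrite !(mulmxDl, mulmxDr); mxring.
- rewrite (trace_nablaE (has_deriv_scale df dY)) (trace_nablaE dY).
  apply: etrans (congr1 (fun t => f A *: (Y' - 2^-1 *:
    (X A *m invmx A *m Y A + Y A *m invmx A *m X A)) + t *: Y A) (esym ef)).
  by rewrite !(=^~ scalemxAl, =^~ scalemxAr); mxring.
- apply: etrans (esym (congr2 (fun U V => U - V) eY eX)).
  by rewrite (trace_nablaE dY) (trace_nablaE dX); mxring.
- have [_ e] := has_deriv_trace_metric uA dY dZ.
  apply: (etrans e); rewrite (trace_nablaE dY) (trace_nablaE dZ).
  rewrite /trace_metric; set i := invmx A.
  rewrite !(mulmxDl, mulmxDr, mulNmx, mulmxN, =^~ scalemxAl, =^~ scalemxAr) !mulmxA.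
  rewrite !(trD, trN, trZ).
  have -> : \tr (i *m Y A *m i *m Z A *m i *m X A) = \tr (i *m X A *m i *m Y A *m i *m Z A).
    by rewrite -mulmxA mxtrace_mulC !mulmxA.
  by field.
Qed.

(** Differentiating [Y^T = Y] and [Y B + B Y = 0] along [X] gives the
    equations satisfied by the derivative [W] of [Y]: it is symmetric, and [W
    B + B W = - (X Y + Y X)]. The correction term contributes exactly [X Y + Y
    X], because the inverse of [B] anticommutes with tangent vectors. *)
Lemma class_totally_geodesic d A : SSR M A -> tangent_coord d A ->
  totally_geodesic (GLn n) trace_metric d (ssr_class M A).
Proof.
have oG := @open_unitmx R n.
move=> sA tA; exists trace_nabla; first exact: trace_levi_civita.
move=> X Y sX sY tX tY B SB; have uB := SSR_unit Mpos SB.1.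
have sYB : smooth_at B Y := (smooth_onP _ oG).1 sY B uB.
rewrite (class_tangentE sA tA SB).
have tXB := tX B SB; rewrite (class_tangentE sA tA SB) in tXB.
have tYE C : ssr_class M A C -> tangent_at C (Y C).
  by move=> SC; rewrite -(class_tangentE sA tA SC); exact: tY.
have tYB := tYE B SB.
have := tX B SB; move=> [p [u [w [[op [N oN pN] sp cp] pu pA eV]]]].
have np : \near u, pdom p u by exact: open_nbhs_nbhs.
have pS x : pdom p x -> ssr_class M A (p x).
  by move=> px; have [] : (ssr_class M A `&` N) (p x) by rewrite -pN; exists x.
have su : smooth_at u (pfun p) by exists (pdom p).
have dp : has_deriv (pfun p) u w (X B).
  by rewrite eV; exact: smooth_at_deriv.
have [W dYB] := has_deriv_exists (X B) sYB; rewrite (trace_nablaE dYB).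
have dY : has_deriv (fun x => Y (p x)) u w W.
  by apply: (has_deriv_comp dp); rewrite pA.
have WT : W^T = W.
  have e1 : {near u, (fun x => (Y (p x))^T) =1 (fun x => Y (p x))}.
    by apply: filterS np => x /pS/tYE[].
  exact: has_deriv_uniq (has_deriv_ext e1 (has_deriv_lin (@trmx R n n) dY)) dY.
have eW : W *m B + Y B *m X B + (X B *m Y B + B *m W) = 0.
  (* Leibniz rule for [Y B + B Y = 0] along a curve in direction [X B]. *)
  have e2 : {near u, (fun x => Y (p x) *m p x + p x *m Y (p x)) =1 (fun=> 0)}.
    by apply: filterS np => x /pS/tYE[].
  have d2 := has_deriv_ext e2 (has_deriv_add (has_deriv_mulmx dY dp) (has_deriv_mulmx dp dY)).
  by rewrite -{1 2 5 6}pA; exact: has_deriv_uniq d2 (has_deriv_cst _ _ _).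
have [BT _] := SB.1; have [XT XB] := tXB; have [YT YB] := tYB.
have iX := tangent_invmx Mpos SB.1 tXB; have iY := tangent_invmx Mpos SB.1 tYB.
set i := invmx B in iX iY *; have iT : i^T = i by rewrite /i trmx_inv BT.
have iB : i *m B = 1%:M by rewrite mulVmx.
have Bi : B *m i = 1%:M by rewrite mulmxV.
have BX : B *m X B = - (X B *m B) by apply/eqP; rewrite -addr_eq0 addrC XB.
have BY : B *m Y B = - (Y B *m B) by apply/eqP; rewrite -addr_eq0 addrC YB.
split.
  rewrite linearB /= linearZ /= linearD /= !trmx_mul XT YT WT iT !mulmxA.
  by rewrite [X in _ - _ *: X]addrC.
rewrite mulmxBl mulmxBr -scalemxAl -scalemxAr mulmxDl mulmxDr.
have e1 : X B *m i *m Y B *m B = - (X B *m Y B).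
  by rewrite -[_ *m i *m _]mulmxA iY mulmxN mulNmx -!mulmxA iB mulmx1.
have e2 : Y B *m i *m X B *m B = - (Y B *m X B).
  by rewrite -[_ *m i *m _]mulmxA iX mulmxN mulNmx -!mulmxA iB mulmx1.
have e3 : B *m (X B *m i *m Y B) = - (X B *m Y B).
  by rewrite !mulmxA BX !mulNmx -[X B *m B *m i]mulmxA Bi mulmx1.
have e4 : B *m (Y B *m i *m X B) = - (Y B *m X B).
  by rewrite !mulmxA BY !mulNmx -[Y B *m B *m i]mulmxA Bi mulmx1.
rewrite e1 e2 e3 e4.
rewrite -[RHS]eW; apply/matrixP => k l; rewrite !linmxE; by field.
Qed.

End Metric.

(** * Manifolds embedded in a space of matrices *)

Section Embedded.
Context {R : realType}.

Lemma smooth_subset_at (E F : normedModType R) (P : set E) (f : E -> F) :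
  (forall y, P y -> exists g, smooth_at y g /\ \forall z \near y, P z -> f z = g z) ->
  smooth_subset P f.
Proof.
move=> h y Py; have [g [[U [oU Uy sU]] /near_open[V [oV Vy fg]]]] := h y Py.
exists (U `&` V), g; split=> //; first exact: openI.
  by move=> k; apply: Ck_sub (sU k) => z [].
by move=> z Pz [_ Vz]; exact: fg.
Qed.

Lemma smooth_subsetE (E F : normedModType R) (P : set E) (f : E -> F) y :
  smooth_subset P f -> P y ->
  exists g, smooth_at y g /\ \forall z \near y, P z -> f z = g z.
Proof.
move=> h Py; have [U [g [oU Uy sU fg]]] := h y Py.
exists g; split; first by exists U.
have : \near y, U y by exact: open_nbhs_nbhs.
by apply: filterS => z Uz Pz; exact: fg.
Qed.

Lemma relatively_open (T : topologicalType) (S P : set T) : P `<=` S ->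
  (forall y, P y -> \forall z \near y, S z -> P z) -> exists2 W, open W & P = S `&` W.
Proof.
move=> PS h; exists (\bigcup_(U in [set U | open U /\ S `&` U `<=` P]) U).
  by apply: bigcup_open => U [].
apply/seteqP; split=> [y Py|y [Sy [U [oU SU] Uy]]]; last exact: SU.
split; first exact: PS.
have [U [oU Uy UP]] := near_open (h y Py).
by exists U => //; split=> // z [Sz Uz]; exact: UP.
Qed.

Lemma open_preimage (T T' : topologicalType) (D : set T) (f : T -> T') (W : set T') :
  open D -> (forall x, D x -> {for x, continuous f}) -> open W ->
  open [set x | D x /\ W (f x)].
Proof.
move=> oD cf oW; rewrite openE => x [Dx Wx].
have h1 : \forall y \near x, W (f y) := cf x Dx _ (open_nbhs_nbhs (conj oW Wx)).
have h2 : \near x, D x by exact: open_nbhs_nbhs.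
suff : \forall y \near x, D y /\ W (f y) by [].
by apply: filterS2 h2 h1.
Qed.

(** Criterion behind all smoothness claims for maps between manifolds that are
    not subsets of a normed space: if [j] embeds the target into matrices and
    turns [q] into a submanifold chart, the smoothness of [f] is that of the
    matrix-valued map [F], from which the coordinates are recovered by the
    smooth left inverse [chi] of the chart. *)
Lemma smooth_in_coords_emb (d e m k : nat) (T T' : Type) (S : set 'M[R]_(m, k))
    (p : param R d T) (q : param R e T') (f : T -> T')
    (F : 'rV[R]_d -> 'M[R]_(m, k)) (j : T' -> 'M[R]_(m, k)) :
  open (pdom p) -> smooth_on (pdom p) F ->
  (forall x, pdom p x -> S (F x) /\ F x = j (f (p x))) ->
  submanifold_atlas e S (Param (pdom q) (j \o q)) ->
  (forall x y, pdom p x -> pdom q y -> j (q y) = j (f (p x)) -> q y = f (p x)) ->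
  smooth_in_coords p q f.
Proof.
move=> op sF FS [oq [W oW qW] sq [chi schi chiK]] inj.
have sFx := (smooth_onP F op).1 sF.
have WE : [set x | pdom p x /\ pimage q (f (p x))] = [set x | pdom p x /\ W (F x)].
  apply/seteqP; split=> x [px h]; split=> //; have [SF FE] := FS x px.
    have [y qy qE] := h.
    have : pimage (Param (pdom q) (j \o q)) (F x) by exists y => //=; rewrite qE -FE.
    by rewrite qW => -[].
  have : (S `&` W) (F x) by [].
  rewrite -qW => -[y /= qy jq]; exists y => //; apply: inj => //.
  by rewrite jq.
have oWE : open [set x | pdom p x /\ pimage q (f (p x))].
  rewrite WE; apply: open_preimage; [exact: op| |exact: oW].
  by move=> x px; exact: smooth_at_cont (sFx x px).
split=> //; exists (chi \o F).
  apply/smooth_onP => // x; rewrite WE => -[px WF] /=.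
  have [SF FE] := FS x px.
  have Pi : pimage (Param (pdom q) (j \o q)) (F x) by rewrite qW.
  have [g [sg cg]] := smooth_subsetE schi Pi.
  apply: (@smooth_at_ext _ _ _ _ (g \o F)); last exact: (smooth_at_comp (sFx x px) sg).
  have h1 : \forall y \near x, pimage (Param (pdom q) (j \o q)) (F y) -> chi (F y) = g (F y).
    exact: (smooth_at_cont (sFx x px) cg).
  have h2 : \forall y \near x, pdom p y /\ W (F y).
    have := oWE; rewrite WE => o; exact: open_nbhs_nbhs.
  by apply: filterS2 h1 h2 => y hy [py WFy] /=; rewrite hy // qW; split=> //; case: (FS y py).
move=> x [px [y qy qE]] /=; have [_ FE] := FS x px.
have -> : F x = j (q y) by rewrite FE qE.
by rewrite (chiK y qy).
Qed.

Lemma submanifold_chart_inj (E : normedModType R) d (S : set E) (p : param R d E) :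
  submanifold_atlas d S p -> {in pdom p &, injective p}.
Proof.
move=> [_ _ _ [chi _ chiK]] x y; rewrite !inE => px py e.
by rewrite -(chiK x px) e chiK.
Qed.

Lemma submanifold_chart_sub (E : normedModType R) d (S : set E) (p : param R d E) x :
  submanifold_atlas d S p -> pdom p x -> S (p x).
Proof.
move=> [_ [W _ pW] _ _] px; have [] // : (S `&` W) (p x).
by rewrite -pW; exists x.
Qed.

(** Balls with rational centre and radius, enumerated. *)
Definition mx_base m n (k : nat) : set 'M[R]_(m, n) :=
  if (unpickle k : option ('M[rat]_(m, n) * rat)%type) is Some Ar
  then ball (map_mx (@ratr R) Ar.1) (ratr Ar.2) else set0.

Lemma mx_ballE m n (A B : 'M[R]_(m, n)) r : 0 < r ->
  ball A r B <-> forall i j, `|A i j - B i j| < r.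
Proof.
move=> r0; rewrite -ball_normE /=; split=> [h i j|h].
  apply: le_lt_trans h; rewrite [leRHS]/Num.Def.normr/= mx_normrE.
  have := le_bigmax (0 : R) (fun ij : 'I_m * 'I_n => `|(A - B) ij.1 ij.2|) (i, j).
  by rewrite !mxE.
rewrite [ltLHS]/Num.Def.normr/= mx_normrE; apply: bigmax_lt => //= -[i j] _.
by rewrite !mxE.
Qed.

Lemma mx_ball_open m n (A : 'M[R]_(m, n)) r : open (ball A r).
Proof.
have [r0|r0] := ltP 0 r; first exact: ball_open.
have -> : ball A r = set0; last exact: open0.
apply/seteqP; split=> // B; rewrite -ball_normE /= => h.
by have := le_lt_trans (normr_ge0 _) (lt_le_trans h r0); rewrite ltxx.
Qed.

Lemma mx_baseP m n (W : set 'M[R]_(m, n)) A : open W -> W A ->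
  exists2 k, mx_base k A & @mx_base m n k `<=` W.
Proof.
move=> oW WA; have : nbhs A W by exact: open_nbhs_nbhs.
move=> /nbhs_ballP[e e0 eW].
(* A rational radius below [e / 2], so that two of them fit into the ball. *)
have [r] := rat_in_itvoo (divr_gt0 e0 (ltr0Sn R 1)).
rewrite in_itv /= => /andP[r0 re].
have hB i j : exists q : rat, `|A i j - ratr q| < ratr r.
  have h : A i j - ratr r < A i j + ratr r by rewrite ltrD2l gtrN.
  have [q] := rat_in_itvoo h; rewrite in_itv /= => /andP[q1 q2].
  by exists q; rewrite ltr_norml; apply/andP; split; lra.
pose B := \matrix_(i < m, j < n) projT1 (cid (hB i j)).
exists (pickle (B, r)).
  rewrite /mx_base pickleK /=; apply/mx_ballE => // i j.
  by rewrite !mxE distrC; case: cid.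
rewrite /mx_base pickleK /= => C BC; apply: eW.
have BA : ball (map_mx (@ratr R) B) (ratr r) A.
  by apply/mx_ballE => // i j; rewrite !mxE distrC; case: cid.
have := ball_triangle (ball_sym BA) BC; apply: le_ball.
have -> : e = e / 2 + e / 2 by rewrite -splitr.
by apply: lerD; exact: ltW.
Qed.

(** Separation and a countable base are inherited from the space of matrices
    through [j]; the transition maps are smooth by [smooth_in_coords_emb]. *)
Lemma embedded_manifold (d m n : nat) (T : Type) (X : set T) (A : set (param R d T))
    (j : T -> 'M[R]_(m, n)) (S : set 'M[R]_(m, n)) :
  (forall x y, X x -> X y -> j x = j y -> x = y) -> (forall x, X x -> S (j x)) ->
  (forall p, A p -> pimage p `<=` X /\ submanifold_atlas d S (Param (pdom p) (j \o p))) ->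
  (forall x, X x -> exists2 p, A p & pimage p x) -> smooth_manifold X A.
Proof.
move=> jI jS Ap cov.
have opn U : open U -> atlas_open X A (X `&` j @^-1` U).
  move=> oU; split=> [x []//|p pA]; have [pX [op _ sp _]] := Ap p pA.
  have -> : [set x | pdom p x /\ (X `&` j @^-1` U) (p x)] =
      [set x | pdom p x /\ U ((j \o p) x)].
    apply/seteqP; split=> [x [px [_ jU]]|x [px jU]] //; split=> //; split=> //.
    by apply: pX; exists x.
  apply: (@open_preimage _ _ (pdom p) (j \o p)); [exact: op| |exact: oU].
  by move=> x px; exact: (smooth_at_cont ((smooth_onP _ op).1 sp x px)).
split.
- split=> [p pA|//|p q pA qA].
    have [pX sp] := Ap p pA; split=> //; first by case: sp.
    move=> x y px py e; apply: (submanifold_chart_inj sp) => //=.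
    by rewrite /= e.
  have [pX sp] := Ap p pA; have [qX sq] := Ap q qA; have [op _ ssp _] := sp.
  have Xp x : pdom p x -> X (p x) by move=> px; apply: pX; exists x.
  apply: (@smooth_in_coords_emb _ _ _ _ _ _ S _ _ _ (j \o p) j) => //.
    by move=> x px; split=> //; apply/jS/Xp.
  move=> x y px qy /jI; apply; last exact: Xp.
  by apply: qX; exists y.
- move=> x y Xx Xy xy.
  have jxy : j x != j y by apply/eqP => /jI e; apply: xy; exact: e.
  have := @norm_hausdorff R 'M[R]_(m, n).
  rewrite open_hausdorff => /(_ _ _ jxy)[[U V] /= [Ux Vy] [oU oV /eqP UV]].
  exists (X `&` j @^-1` U), (X `&` j @^-1` V); split; [exact: opn|exact: opn| | |].
  + by split=> //; rewrite inE in Ux.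
  + by split=> //; rewrite inE in Vy.
  + apply/seteqP; split=> z //= [[_ Uz] [_ Vz]].
    by have : (U `&` V) (j z) by []; rewrite UV.
(* Around a point of [W], membership in [W] is tested in coordinates, which
   depend continuously on the image under [j]. *)
- exists (fun k => X `&` j @^-1` (mx_base k)).
    move=> k; apply: opn; rewrite /mx_base; case: unpickle => [Ar|]; last exact: open0.
    exact: mx_ball_open.
  move=> W x [WX Wo] Wx; have Xx := WX _ Wx.
  have [p pA [z pz pzE]] := cov x Xx; have [pX [op [N oN pN] sp [chi schi chiK]]] := Ap p pA.
  have jP : pimage (Param (pdom p) (j \o p)) (j x) by exists z => //=; rewrite pzE.
  have [g [sg cg]] := smooth_subsetE schi jP.
  have gx : g (j x) = z.
    by rewrite -(nbhs_singleton cg) // -pzE; exact: (chiK z pz).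
  have oV := Wo p pA.
  have Vz : [set z | pdom p z /\ W (p z)] (g (j x)) by rewrite gx /= pzE.
  have h1 : \forall y \near j x, [set z | pdom p z /\ W (p z)] (g y).
    exact: (smooth_at_cont sg (open_nbhs_nbhs (conj oV Vz))).
  have h2 : \forall y \near j x, N y.
    by apply: open_nbhs_nbhs; split=> //; have [] : (S `&` N) (j x) by rewrite -pN.
  have [U [oU Ux UP]] := near_open (filterI cg (filterI h1 h2)).
  have [k kx kU] := mx_baseP oU Ux.
  exists k; first by split.
  move=> y [Xy /kU/UP[cgy [Vg Ny]]].
  have Py : pimage (Param (pdom p) (j \o p)) (j y) by rewrite pN; split=> //; exact: jS.
  have [z' pz' /= jz'] := Py.
  have e1 : chi (j y) = z' by rewrite -jz'; exact: (chiK z' pz').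
  have : p z' = y by apply: jI => //; apply: pX; exists z'.
  by move=> <-; move: Vg; rewrite -cgy // e1 => -[].
Qed.

End Embedded.

(** * Isometries by conjugation *)

Section Homogeneous.
Context {R : realType} {n : nat}.
Variable M : 'M[R]_n.
Hypothesis Mpos : symmetric_posdef M.
Implicit Types (A B Y V Q : 'M[R]_n).

Definition conj_by Q A := Q *m A *m Q^T.

Lemma conj_by_linear Q : linear (conj_by Q).
Proof. by move=> a U V; rewrite /conj_by mulmxDr mulmxDl -scalemxAr -scalemxAl. Qed.
HB.instance Definition _ Q :=
  GRing.isLinear.Build R 'M[R]_n 'M[R]_n _ (conj_by Q) (conj_by_linear Q).

Lemma trace_metric_conj Q A V W : Q *m Q^T = 1%:M ->
  trace_metric (conj_by Q A) (conj_by Q V) (conj_by Q W) = trace_metric A V W.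
Proof.
move=> oQ; have uQ := orth_unit oQ; have oQ' := orthV oQ.
rewrite /trace_metric /conj_by.
have -> : invmx (Q *m A *m Q^T) = Q *m invmx A *m Q^T.
  have [uA|nA] := boolP (A \in unitmx).
    have u : Q *m A *m Q^T \in unitmx by rewrite !unitmx_mul uQ uA unitmx_tr.
    apply: (can_inj (mulKmx u)); rewrite mulmxV //.
    by rewrite !mulmxA -[_ *m Q^T *m Q]mulmxA oQ' mulmx1 -[Q *m A *m _]mulmxA mulmxV // mulmx1.
  have nu : Q *m A *m Q^T \notin unitmx by rewrite !unitmx_mul (negbTE nA) andbF.
  by rewrite !invmx_out.
have QQ B : B *m Q^T *m Q = B by rewrite -mulmxA oQ' mulmx1.
by rewrite !mulmxA !QQ mxtrace_mulC !mulmxA oQ' mul1mx.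
Qed.

Lemma class_smooth_conj d A Q : SSR M A -> tangent_coord d A ->
  Q *m Q^T = 1%:M -> Q *m M = M *m Q ->
  smooth_map (ssr_class M A) (submanifold_atlas d (ssr_class M A))
    (ssr_class M A) (submanifold_atlas d (ssr_class M A)) (conj_by Q).
Proof.
move=> sA tA oQ QM.
have Qc Y : ssr_class M A Y -> ssr_class M A (conj_by Q Y).
  by move=> [sY eY]; have [h1 h2] := SSR_conj sY oQ QM; split; [exact: h1|rewrite h2].
split=> // p q pA qA; have [op _ sp _] := pA.
apply: (@smooth_in_coords_emb _ _ _ _ _ _ _ (ssr_class M A) p q (conj_by Q) (conj_by Q \o p) id) => //.
- apply/smooth_onP => // x px.
  apply: (@smooth_at_comp _ _ _ _ _ _ _ p (conj_by Q)); last exact: smooth_at_lin.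
  exact: (smooth_onP _ op).1 sp x px.
- by move=> x px; split=> //; apply: Qc; exact: submanifold_chart_sub pA px.
Qed.

(** By [class_conj] the conjugations that preserve the class act transitively;
    they are linear and preserve traces. *)
Lemma class_homogeneous d A : SSR M A -> tangent_coord d A ->
  homogeneous trace_metric d (ssr_class M A).
Proof.
move=> sA tA B C SB SC.
have [Q [oQ QM eC _]] := class_conj SB.1 SC.1 (etrans SC.2 (esym SB.2)).
have oQT : Q^T *m Q^T^T = 1%:M by rewrite trmxK orthV.
have QTM : Q^T *m M = M *m Q^T.
  have uQ := orth_unit oQ; apply: (can_inj (mulKmx uQ)); apply: (can_inj (mulmxK uQ)).
  by rewrite mulmxA oQ mul1mx !mulmxA -QM -mulmxA -mulmxA (orthV oQ) mulmx1.
exists (conj_by Q); last by rewrite eC.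
split.
  exists (conj_by Q^T); split.
  - exact: class_smooth_conj.
  - exact: class_smooth_conj.
  - by move=> Y _; rewrite /conj_by trmxK !mulmxA (orthV oQ) mul1mx -mulmxA (orthV oQ) mulmx1.
  - by move=> Y _; rewrite /conj_by trmxK !mulmxA oQ mul1mx -mulmxA oQ mulmx1.
move=> p pA x v w px; have [op _ sp _] := pA.
have sx := (smooth_onP _ op).1 sp x px.
have [V dV] := has_deriv_exists v sx; have [W dW] := has_deriv_exists w sx.
have [_ eV'] := has_deriv_lin (conj_by Q) dV; have [_ eW'] := has_deriv_lin (conj_by Q) dW.
have [[_ eV] [_ eW]] := (dV, dW).
apply: etrans (congr2 (trace_metric _) eV' eW') _.
apply: etrans _ (esym (congr2 (trace_metric _) eV eW)).
exact: trace_metric_conj.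
Qed.

End Homogeneous.

(** * The homogeneous space as a class of involutions *)

Section HomogeneousSpace.
Context {R : realType} (u v : nat).
Local Notation n := (u + v)%N.
Implicit Types (A B Y V Q : 'M[R]_n).

Definition Jmx : 'M[R]_n := block_mx 1%:M 0 0 (- 1%:M).

Lemma Jmx_diag : Jmx = diag_mx (row_mx (const_mx 1) (const_mx (-1))).
Proof.
rewrite diag_mx_row /Jmx; congr block_mx; apply/matrixP => i j; rewrite !mxE //.
by case: eqP; rewrite ?mulr1n ?mulr0n ?oppr0.
Qed.

Lemma posdef1 m : symmetric_posdef (1%:M : 'M[R]_m).
Proof.
have := @gram_posdef R m m 1%:M; rewrite trmx1 mulmx1; apply => x.
by rewrite mulmx1.
Qed.

Lemma Jmx_tr : Jmx^T = Jmx.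
Proof. by rewrite tr_block_mx !trmx0 linearN /= !trmx1. Qed.

Lemma Jmx_sq : Jmx *m Jmx = 1%:M.
Proof.
rewrite mulmx_block !mulmx0 !mul0mx !addr0 add0r mulmx1 mulmxN mulmx1 opprK.
by rewrite -scalar_mx_block.
Qed.

Lemma SSR_Jmx : SSR 1%:M Jmx.
Proof. by split; [exact: Jmx_tr|exact: Jmx_sq]. Qed.

Local Notation S := (ssr_class 1%:M Jmx).

(** Symmetric matrices that anticommute with [J] are those with zero diagonal
    blocks, hence are given by their upper right block. *)
Lemma Jmx_tangent_coord : tangent_coord (u * v) Jmx.
Proof.
pose L (x : 'rV[R]_(u * v)) : 'M[R]_n := block_mx 0 (vec_mx x) (vec_mx x)^T 0.
pose C (V : 'M[R]_n) := mxvec (ursubmx V).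
have linL : linear L.
  move=> a x y; rewrite /L scale_block_mx add_block_mx !scaler0 !addr0.
  by rewrite !linearP.
have linC : linear C.
    move=> a U V; rewrite /C -linearP; congr mxvec.
    by apply/matrixP => i j; rewrite !mxE.
exists (HB.pack L (GRing.isLinear.Build _ _ _ _ _ linL) : {linear 'rV[R]_(u * v) -> 'M[R]_n}).
exists (HB.pack C (GRing.isLinear.Build _ _ _ _ _ linC) : {linear 'M[R]_n -> 'rV[R]_(u * v)}).
split=> [x|x|V [VT VJ]] /=.
- rewrite /L /tangent_at /= tr_block_mx trmxK !trmx0; split=> //.
  rewrite /Jmx !mulmx_block !mulmx0 !mul0mx !add0r !addr0.
  rewrite !mulmxN !mulmx1 !mul1mx !mulNmx mul1mx add_block_mx !addr0 addNr subrr.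
  by rewrite block_mx0.
- by rewrite /C /L block_mxKur vec_mxK.
- have [h1 h2] : ulsubmx V = 0 /\ drsubmx V = 0.
    move: VJ; rewrite -[V]submxK /Jmx !mulmx_block !mulmx0 !mul0mx !add0r !addr0.
    rewrite !mulmxN !mulmx1 !mulNmx !mul1mx add_block_mx.
    have -> : (0 : 'M[R]_n) = block_mx 0 0 0 0 by rewrite block_mx0.
    move=> /eq_block_mx[h1 _ _ h2]; rewrite block_mxKul block_mxKdr; split.
      by move/eqP: h1; rewrite -mulr2n -scaler_nat scaler_eq0 pnatr_eq0 /= => /eqP.
    by move/eqP: h2; rewrite -opprD oppr_eq0 -mulr2n -scaler_nat scaler_eq0 pnatr_eq0 /= => /eqP.
  by rewrite /L /C mxvecK trmx_ursub VT -[RHS]submxK h1 h2.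
Qed.

(** For [M = 1] every orthogonal matrix commutes with [M], so the class is a
    full orbit of the orthogonal group. *)
Lemma involution_conj Y : S Y <-> exists2 Q, Q *m Q^T = 1%:M & Y = Q *m Jmx *m Q^T.
Proof.
split=> [[sY eY]|[Q oQ ->]].
  by have [Q [oQ _ eQ _]] := class_conj SSR_Jmx sY eY; exists Q.
by apply: SSR_conj => //; [exact: SSR_Jmx|rewrite mulmx1 mul1mx].
Qed.

Local Notation G := (@orthogonal_group R n).
Local Notation H := (block_orthogonal_group u v).

(** Fibre over [Y] of the orbit map [B |-> B J B^T]; the fibres are the left
    cosets of the stabilizer of [J]. *)
Definition coset_of_root Y : set 'M[R]_n := [set B | G B /\ B *m Jmx *m B^T = Y].

(** The stabilizer of [J] consists of the orthogonal matrices commuting with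
    [J], which forces the off-diagonal blocks to vanish. *)
Lemma block_orthogonalP C : H C <-> G C /\ C *m Jmx *m C^T = Jmx.
Proof.
split=> [[A [B [oA oB ->]]]|[oC CJ]].
  rewrite /orthogonal_group /= in oA oB *.
  rewrite /Jmx tr_block_mx !trmx0 !mulmx_block !mulmx0 !mul0mx !add0r !addr0.
  rewrite !mulmxN !mulmx1 !mulNmx oA oB -scalar_mx_block; split=> //.
  by rewrite !mul0mx.
have CJ' : C *m Jmx = Jmx *m C by rewrite -{2}CJ -!mulmxA (orthV oC) mulmx1.
move: CJ' oC; rewrite -[C]submxK /Jmx /orthogonal_group /=.
set A := ulsubmx C; set B := ursubmx C; set C' := dlsubmx C; set D := drsubmx C.
rewrite !mulmx_block !mulmx0 !mul0mx !add0r !addr0 !mulmxN !mulmx1 !mulNmx !mul1mx.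
move=> /eq_block_mx[_ hB hC _].
have B0 : B = 0.
  by move/eqP: hB; rewrite eq_sym -subr_eq0 opprK -mulr2n -scaler_nat scaler_eq0 pnatr_eq0 /= => /eqP.
have C0 : C' = 0.
  by move/eqP: hC; rewrite -subr_eq0 opprK -mulr2n -scaler_nat scaler_eq0 pnatr_eq0 /= => /eqP.
rewrite B0 C0 tr_block_mx !trmx0 mulmx_block !mulmx0 !mul0mx !add0r !addr0.
rewrite (scalar_mx_block u v 1) => /eq_block_mx[oA _ _ oD].
by exists A, D.
Qed.

Lemma left_cosetE A : G A -> left_coset H A = coset_of_root (A *m Jmx *m A^T).
Proof.
move=> oA; apply/seteqP; split=> [_ [C /block_orthogonalP[oC CJ] <-]|B [oB BJ]].
  rewrite /coset_of_root /orthogonal_group /= trmx_mul; split.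
    by rewrite mulmxA -[A *m C *m _]mulmxA oC mulmx1.
  by rewrite !mulmxA -[A *m C *m Jmx]mulmxA -[A *m (C *m Jmx) *m C^T]mulmxA CJ.
exists (A^T *m B); last by rewrite mulmxA oA mul1mx.
apply/block_orthogonalP; rewrite /orthogonal_group /= trmx_mul trmxK.
split; first by rewrite mulmxA -[A^T *m B *m _]mulmxA oB mulmx1 orthV.
rewrite !mulmxA -[A^T *m B *m Jmx]mulmxA -[A^T *m (B *m Jmx) *m B^T]mulmxA BJ.
by rewrite !mulmxA orthV // mul1mx -mulmxA orthV // mulmx1.
Qed.

Lemma coset_of_root_inj Y Y' : S Y -> coset_of_root Y = coset_of_root Y' -> Y = Y'.
Proof.
move=> /involution_conj[Q oQ eY] e.
have : coset_of_root Y Q by [].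
by rewrite e => -[_ <-]; rewrite eY.
Qed.

Local Notation X := (homogeneous_space G H).

Lemma coset_of_rootP c : X c <-> exists2 Y, S Y & c = coset_of_root Y.
Proof.
split=> [[A oA <-]|[Y /involution_conj[Q oQ ->] ->]].
  exists (A *m Jmx *m A^T); last exact: left_cosetE.
  by apply/involution_conj; exists A.
by exists Q => //; rewrite left_cosetE.
Qed.

(** Inverse of [coset_of_root] on cosets; the value does not depend on the
    representative that is picked. *)
Definition root_of_coset (c : set 'M[R]_n) : 'M[R]_n :=
  let A := xget 0 c in A *m Jmx *m A^T.

Lemma coset_of_rootK Y : S Y -> root_of_coset (coset_of_root Y) = Y.
Proof.
move=> /involution_conj[Q oQ eY].
have : coset_of_root Y (xget 0 (coset_of_root Y)) by apply: (xgetPex 0); exists Q.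
by case.
Qed.

Lemma root_of_cosetK c : X c -> coset_of_root (root_of_coset c) = c.
Proof. by move=> /coset_of_rootP[Y SY ->]; rewrite coset_of_rootK. Qed.

Lemma root_of_coset_class c : X c -> S (root_of_coset c).
Proof. by move=> /coset_of_rootP[Y SY ->]; rewrite coset_of_rootK. Qed.

Lemma root_of_left_coset A : G A -> root_of_coset (left_coset H A) = A *m Jmx *m A^T.
Proof.
move=> oA; rewrite left_cosetE // coset_of_rootK //.
by apply/involution_conj; exists A.
Qed.

(** The columns of [(A + Y A J) / 2] are eigenvectors of [Y], for the
    eigenvalues 1 and -1 in the same order as in [J], and they are the columns
    of [A] when [Y = A J A^T]. Their Gram matrix commutes with [J], and so
    does its inverse Cholesky factor; orthonormalizing with it therefore
    preserves the eigenvector equation, and is smooth in [Y]. *)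
Lemma local_section Y0 : S Y0 -> exists sg : 'M[R]_n -> 'M[R]_n,
  smooth_at Y0 sg /\ \forall Y \near Y0, S Y -> G (sg Y) /\ sg Y *m Jmx *m (sg Y)^T = Y.
Proof.
move=> /involution_conj[A oA eY0]; have oA' := orthV oA.
pose F Y : 'M[R]_n := 2^-1 *: (A + Y *m A *m Jmx).
have F0 : F Y0 = A.
  rewrite /F eY0 -[_ *m A^T *m A]mulmxA oA' mulmx1 -mulmxA Jmx_sq mulmx1.
  have -> : A + A = 2 *: A by rewrite scaler_nat mulr2n.
  by rewrite scalerA mulVf ?pnatr_eq0 // scale1r.
have sF Y : smooth_at Y F.
  apply: smooth_at_scale; first exact: smooth_at_cst.
  apply: smooth_at_add; first exact: smooth_at_cst.
  apply: smooth_at_mulmx; last exact: smooth_at_cst.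
  apply: smooth_at_mulmx; [exact: smooth_at_id|exact: smooth_at_cst].
pose Gr Y := (F Y)^T *m F Y; pose L Y := cholinv (Gr Y).
have posG Y : F Y \in unitmx -> symmetric_posdef (Gr Y).
  move=> uF; rewrite /Gr -{2}[F Y]trmxK; apply: gram_posdef => x xF.
  have uFT : (F Y)^T \in unitmx by rewrite unitmx_tr.
  by rewrite -[x](mulmxK uFT) xF mul0mx.
have uF0 : F Y0 \in unitmx by rewrite F0; exact: orth_unit.
exists (fun Y => F Y *m (L Y)^T); split.
  apply: smooth_at_mulmx => //; apply: smooth_at_trmx; apply: smooth_at_cholinv.
    exact: posG.
  by apply: smooth_at_mulmx => //; exact: smooth_at_trmx.
have h : \forall Y \near Y0, F Y \in unitmx.
  exact: (smooth_at_cont (sF Y0) (open_nbhs_nbhs (conj (@open_unitmx R n) uF0))).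
apply: filterS h => Y uF [[YT YY] _].
have LG := cholinvP (posG Y uF); rewrite -/(L Y) in LG.
have YF : Y *m F Y = F Y *m Jmx.
  rewrite /F -scalemxAl -scalemxAr mulmxDr mulmxDl !mulmxA YY mul1mx.
  by rewrite -[Y *m A *m Jmx *m Jmx]mulmxA Jmx_sq mulmx1 addrC.
have JG : Jmx *m Gr Y = Gr Y *m Jmx.
  have FY : (F Y)^T *m Y = Jmx *m (F Y)^T.
    by have /(congr1 trmx) := YF; rewrite !trmx_mul YT Jmx_tr.
  by rewrite /Gr mulmxA -FY -!mulmxA YF.
have JL : Jmx *m L Y = L Y *m Jmx.
  by rewrite Jmx_diag; apply: cholinv_comm; rewrite -Jmx_diag.
have LJ : (L Y)^T *m Jmx = Jmx *m (L Y)^T.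
  by have /(congr1 trmx) := JL; rewrite !trmx_mul Jmx_tr.
have oS : F Y *m (L Y)^T *m (F Y *m (L Y)^T)^T = 1%:M.
  by apply: mulmx1C; rewrite trmx_mul trmxK -LG /Gr !mulmxA.
split=> //; rewrite -[F Y *m _ *m Jmx]mulmxA LJ mulmxA -YF.
by rewrite -mulmxA -mulmxA -[RHS]mulmx1 -oS !mulmxA.
Qed.

Lemma smooth_at_orbit A : smooth_at A (fun A : 'M[R]_n => A *m Jmx *m A^T).
Proof.
apply: smooth_at_mulmx; last by apply: smooth_at_trmx; exact: smooth_at_id.
by apply: smooth_at_mulmx; [exact: smooth_at_id|exact: smooth_at_cst].
Qed.

(** [A H |-> A J A^T] turns the charts of the quotient into submanifold charts
    of the class of [J]. Openness of the image and smoothness of the inverse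
    are pulled back along [local_section]; the lifts given with the chart
    yield smoothness of the chart itself. *)
Lemma homogeneous_chart_emb (p : param R (u * v) (set 'M[R]_n)) :
  homogeneous_atlas (u * v) G H p ->
  pimage p `<=` X /\ submanifold_atlas (u * v) S (Param (pdom p) (root_of_coset \o p)).
Proof.
move=> [[op pinj pX] [W oW DW] [tau stau tauP] sec]; split=> //.
have Xp x : pdom p x -> X (p x) by move=> px; apply: pX; exists x.
set D := [set A | G A /\ pimage p (left_coset H A)] in DW stau tauP *.
pose ip := Param (pdom p) (root_of_coset \o p).
have ipP Y : pimage ip Y <-> S Y /\ pimage p (coset_of_root Y).
  split=> [[x px /= <-]|[SY [x px pE]]].
    split; first exact/root_of_coset_class/Xp.
    by exists x => //; rewrite root_of_cosetK //; exact: Xp.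
  by exists x => //=; rewrite pE coset_of_rootK.
have secD Y A : S Y -> G A -> A *m Jmx *m A^T = Y -> left_coset H A = coset_of_root Y.
  by move=> SY oA <-; exact: left_cosetE.
split=> //.
- apply: relatively_open => [Y /ipP[]//|Y /ipP[SY pY]].
  have [sg [ssg gP]] := local_section SY.
  have [oY eY] := nbhs_singleton gP SY.
  have WY : W (sg Y).
    have : D (sg Y) by split=> //; rewrite (secD Y).
    by rewrite DW => -[].
  have hW : \forall Z \near Y, W (sg Z).
    exact: (smooth_at_cont ssg (open_nbhs_nbhs (conj oW WY))).
  apply: filterS2 gP hW => Z gZ WZ SZ; have [oZ eZ] := gZ SZ.
  apply/ipP; split=> //; rewrite -(secD Z _ SZ oZ eZ).
  by have [] : D (sg Z) by rewrite DW.
- apply/smooth_onP => // x px; have [U [s [oU Ux sU sP]]] := sec x px.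
  have ss : smooth_at x s by exists U.
  apply: (@smooth_at_ext _ _ _ _ (fun y => s y *m Jmx *m (s y)^T)); last first.
    apply: smooth_at_mulmx; last exact: smooth_at_trmx.
    by apply: smooth_at_mulmx => //; exact: smooth_at_cst.
  have h1 : \near x, U x by exact: open_nbhs_nbhs.
  have h2 : \near x, pdom p x by exact: open_nbhs_nbhs.
  apply: filterS2 h1 h2 => y Uy py; have [oy ey] := sP y py Uy.
  by rewrite /= -ey root_of_left_coset.
(* The inverse chart; outside the image of [p] it takes the value 0. *)
- pose chi Y := xget 0 [set x | pdom p x /\ p x = coset_of_root Y].
  have chiE x Y : pdom p x -> p x = coset_of_root Y -> chi Y = x.
    move=> px e; have [py ey] : [set x | pdom p x /\ p x = coset_of_root Y] (chi Y).
      by apply: xgetPex; exists x.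
    by apply: pinj; rewrite ?inE // ey.
  exists chi; last by move=> x px /=; apply: chiE => //; rewrite root_of_cosetK //; exact: Xp.
  apply: smooth_subset_at => Y /ipP[SY pY].
  have [sg [ssg gP]] := local_section SY.
  have [oY eY] := nbhs_singleton gP SY.
  have DY : D (sg Y) by split=> //; rewrite (secD Y).
  have [g [sg' cg]] := smooth_subsetE stau DY.
  exists (fun Z => g (sg Z)); split; first exact: (smooth_at_comp ssg sg').
  have cg' : \forall Z \near Y, D (sg Z) -> tau (sg Z) = g (sg Z).
    exact: (smooth_at_cont ssg cg).
  apply: filterS2 gP cg' => Z gZ cZ /ipP[SZ pZ]; have [oZ eZ] := gZ SZ.
  have DZ : D (sg Z) by split=> //; rewrite (secD Z).
  have [pt et] := tauP _ DZ.
  by rewrite -cZ //; apply: chiE => //; rewrite et; exact: secD.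
Qed.

(** Conversely, every submanifold chart of the class of [J] comes from a chart
    of the quotient, lifted to the group by [local_section]. *)
Lemma emb_homogeneous_chart (q : param R (u * v) 'M[R]_n) :
  submanifold_atlas (u * v) S q ->
  homogeneous_atlas (u * v) G H (Param (pdom q) (coset_of_root \o q)).
Proof.
move=> qA; have [oq [W oW qW] sq [chi schi chiK]] := qA.
have qS x : pdom q x -> S (q x) by move=> qx; exact: (submanifold_chart_sub qA qx).
have SA A : G A -> S (A *m Jmx *m A^T) by move=> oA; apply/involution_conj; exists A.
have imP A : G A -> pimage (Param (pdom q) (coset_of_root \o q)) (left_coset H A) <->
    pimage q (A *m Jmx *m A^T).
  move=> oA; rewrite left_cosetE //; split=> [[x qx /= e]|[x qx e]].
    by exists x => //; apply: coset_of_root_inj e; exact: qS.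
  by exists x => //=; rewrite e.
split.
- split=> //=.
    move=> x y; rewrite !inE => qx qy e.
    apply: (submanifold_chart_inj qA); rewrite ?inE //.
    by apply: coset_of_root_inj e; exact: qS.
  by move=> _ [x qx <-]; apply/coset_of_rootP; exists (q x) => //; exact: qS.
- exists [set A | W (A *m Jmx *m A^T)]; first by apply: open_comp oW => A _; exact: smooth_at_cont (smooth_at_orbit A).
  apply/seteqP; split=> A /= [oA h]; split=> //.
    by move/(imP A oA): h; rewrite qW => -[].
  by apply/(imP A oA); rewrite qW; split=> //; exact: SA.
- exists (fun A => chi (A *m Jmx *m A^T)).
    apply: smooth_subset_at => A [oA /(imP A oA) h].
    have [g [sg cg]] := smooth_subsetE schi h.
    exists (fun A => g (A *m Jmx *m A^T)); split; first exact: (smooth_at_comp (smooth_at_orbit A) sg).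
    have cg' : \forall B \near A, pimage q (B *m Jmx *m B^T) ->
      chi (B *m Jmx *m B^T) = g (B *m Jmx *m B^T) := smooth_at_cont (smooth_at_orbit A) cg.
    by apply: filterS cg' => B cB [oB /(imP B oB)].
  move=> A [oA /(imP A oA)[x qx e]]; rewrite /= -e chiK //; split=> //.
  by rewrite e left_cosetE.
- move=> x qx; have [sg [ssg gP]] := local_section (qS x qx).
  have sqx := (smooth_onP _ oq).1 sq x qx.
  have ss : smooth_at x (fun y => sg (q y)) := smooth_at_comp sqx ssg.
  have gP' : \forall y \near x, S (q y) -> G (sg (q y)) /\
    sg (q y) *m Jmx *m (sg (q y))^T = q y := smooth_at_cont sqx gP.
  have [U [oU Ux sU]] := ss; have [U' [oU' Ux' hU']] := near_open gP'.
  exists (U `&` U'), (fun y => sg (q y)); split=> //; first exact: openI.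
    by move=> k; apply: Ck_sub (sU k) => y [].
  move=> y qy [_ /hU'] /(_ (qS y qy))[oy ey]; split=> //=.
  by rewrite left_cosetE // ey.
Qed.

Lemma homogeneous_manifold : smooth_manifold X (homogeneous_atlas (u * v) G H).
Proof.
apply: (@embedded_manifold _ _ _ _ _ _ _ root_of_coset S).
- by move=> x y Xx Xy e; rewrite -(root_of_cosetK Xx) e root_of_cosetK.
- exact: root_of_coset_class.
- exact: homogeneous_chart_emb.
- move=> c /coset_of_rootP[Y SY ->].
  have tY := class_tangent_coord SSR_Jmx Jmx_tangent_coord SY.
  have [q qA [q0 qY _]] := cayley_chart (posdef1 n) SY.1 tY.
  rewrite (ssr_class_eq SY) in qA.
  exists (Param (pdom q) (coset_of_root \o q)); first exact: emb_homogeneous_chart.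
  by exists 0 => //=; rewrite qY.
Qed.

End HomogeneousSpace.

(** * Row spaces and the Grassmannian *)

Section RowSpace.
Context {R : realType}.

Definition rowsp k h (N : 'M[R]_(k, h)) : {vspace 'rV[R]_h} :=
  limg (linfun (mulmxr N : 'rV[R]_k -> 'rV[R]_h)).

Lemma rowspP k h (N : 'M[R]_(k, h)) w : reflect (exists x, w = x *m N) (w \in rowsp N).
Proof.
apply: (iffP memv_imgP) => [[x _ ->]|[x ->]]; first by exists x; rewrite lfunE.
by exists x; [exact: memvf|rewrite lfunE].
Qed.

Lemma eq_rowsp k k' h (N : 'M[R]_(k, h)) (N' : 'M[R]_(k', h)) B C :
  N = B *m N' -> N' = C *m N -> rowsp N = rowsp N'.
Proof.
move=> e e'; apply/vspaceP => w; apply/rowspP/rowspP => -[x ->].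
  by exists (x *m B); rewrite e mulmxA.
by exists (x *m C); rewrite e' mulmxA.
Qed.

Lemma rowsp_sub k k' h (N : 'M[R]_(k, h)) (N' : 'M[R]_(k', h)) :
  rowsp N = rowsp N' -> exists B, N = B *m N'.
Proof.
move=> e; have h' i : exists x, row i N = x *m N'.
  by apply/rowspP; rewrite -e; apply/rowspP; exists (delta_mx 0 i); rewrite rowE.
exists (\matrix_i projT1 (cid (h' i))).
by apply/row_matrixP => i; rewrite row_mul rowK; case: cid.
Qed.

Lemma dim_rowsp k h (N : 'M[R]_(k, h)) : (forall x : 'rV_k, x *m N = 0 -> x = 0) ->
  \dim (rowsp N) = k.
Proof.
move=> inj; rewrite /rowsp limg_dim_eq ?dimvf ?dim_matrix; first exact: mul1n.
rewrite capfv; apply/eqP/lker0P => x y; rewrite !lfunE /= => e.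
by apply/eqP; rewrite -subr_eq0; apply/eqP/inj; rewrite mulmxBl e subrr.
Qed.

(** The rows are a basis of the subspace. *)
Lemma rowsp_basis h (W : {vspace 'rV[R]_h}) : exists N : 'M[R]_(\dim W, h),
  (forall x : 'rV_(\dim W), x *m N = 0 -> x = 0) /\ rowsp N = W.
Proof.
pose N : 'M[R]_(\dim W, h) := \matrix_i (tnth (vbasis W) i).
have NE (x : 'rV_(\dim W)) : x *m N = \sum_i x 0 i *: (vbasis W)`_i.
  by rewrite mulmx_sum_row; apply: eq_bigr => i _; rewrite rowK (tnth_nth 0).
exists N; split.
  move=> x; rewrite NE => e; apply/rowP => i; rewrite mxE.
  by have /freeP := basis_free (vbasisP W); apply.
apply/vspaceP => w; apply/rowspP/idP => [[x ->]|wW].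
  rewrite NE; apply: rpred_sum => i _; apply: rpredZ.
  by apply: vbasis_mem; apply: mem_nth; rewrite size_tuple.
exists (\row_i coord (vbasis W) i w); rewrite NE {1}(coord_vbasis wW).
by apply: eq_bigr => i _; rewrite mxE.
Qed.

End RowSpace.

Section Grassmann.
Context {R : realType} (u v : nat).
Local Notation n := (u + v)%N.
Implicit Types (A B Y V Q : 'M[R]_n).
Local Notation J := (@Jmx R u v).
Local Notation S := (ssr_class 1%:M J).

(** Reflection that is 1 on the row space of [N] and -1 on its orthogonal
    complement. *)
Definition refl_mx (N : 'M[R]_(u, n)) : 'M[R]_n :=
  2 *: (N^T *m invmx (N *m N^T) *m N) - 1%:M.

Lemma prod_signs (s : seq R) : all (fun x => x ^+ 2 == 1) s ->
  \prod_(x <- s) ('X - x%:P) =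
    ('X - 1%:P) ^+ count_mem 1 s * ('X - (-1)%:P) ^+ count_mem (-1) s :> {poly R} /\
  (count_mem 1%R s + count_mem (-1)%R s = size s)%N /\
  \sum_(x <- s) x = (count_mem 1 s)%:R - (count_mem (-1) s)%:R.
Proof.
have n1 : (1 == -1 :> R) = false by apply/eqP => /eqP; rewrite -subr_eq0 opprK -[1 + 1]/(2 : R) pnatr_eq0.
elim: s => [|x s IH] /=; first by rewrite !big_nil !expr0 mulr1 subrr.
move=> /andP[x1 /IH[e1 [e2 e3]]]; rewrite !big_cons e1 e3.
move: x1; rewrite sqrf_eq1 => /orP[] /eqP ->; rewrite eqxx ?n1 ?(eq_sym (-1)) ?n1 /=.
  by rewrite add0n add1n exprS mulrA addSn e2 mulrS addrA.
by rewrite add0n add1n exprS addnS e2 mulrCA mulrS opprD addrCA.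
Qed.

Lemma char_poly_Jmx : char_poly J = ('X - 1%:P) ^+ u * ('X - (-1)%:P) ^+ v.
Proof.
rewrite Jmx_diag char_poly_trig ?diag_mx_is_trig // big_split_ord /=; congr (_ * _).
  rewrite (eq_bigr (fun=> 'X - 1%:P)) ?prodr_const ?card_ord // => i _.
  by rewrite mxE eqxx mulr1n row_mxEl mxE.
rewrite (eq_bigr (fun=> 'X - (-1)%:P)) ?prodr_const ?card_ord // => i _.
by rewrite mxE eqxx mulr1n row_mxEr mxE.
Qed.

(** The trace determines the multiplicities of the eigenvalues 1 and -1 of an
    involution, hence its characteristic polynomial. *)
Lemma involution_class Y : SSR 1%:M Y -> \tr Y = u%:R - v%:R -> S Y.
Proof.
move=> sY tY; split=> //; have [YT YY] := sY.
have [P [d [oP eY]]] := real_spectral YT.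
pose s := [seq d 0 j | j <- enum 'I_n].
have d1 : all (fun x => x ^+ 2 == 1) s.
  apply/allP => _ /mapP[j _ ->]; apply/eqP.
  have : P *m (Y *m Y) *m P^T = 1%:M by rewrite YY mulmx1.
  rewrite eY !mulmxA oP mul1mx -[_ *m P *m P^T]mulmxA oP mulmx1.
  rewrite -[_ *m P *m P^T]mulmxA oP mulmx1 mulmx_diag => /matrixP/(_ j j).
  by rewrite !mxE eqxx !mulr1n expr2.
have [e1 [e2 e3]] := prod_signs d1.
have ts : \sum_(x <- s) x = u%:R - v%:R.
  rewrite -tY eY mxtrace_mulC mulmxA oP mul1mx mxtrace_diag.
  by rewrite big_map big_enum.
rewrite ts in e3; rewrite size_map size_enum_ord in e2.
have cu : count_mem 1 s = u.
  have : (count_mem 1 s)%:R + (count_mem (-1) s)%:R = u%:R + v%:R :> R by rewrite -!natrD e2.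
  move=> e4; have : (count_mem 1 s)%:R *+ 2 = u%:R *+ 2 :> R by rewrite !mulr2n; lra.
  by move/eqP; rewrite -!mulrnA eqr_nat eqn_pmul2r // => /eqP.
have cv : count_mem (-1) s = v by apply/eqP; rewrite -(eqn_add2l u) -{1}cu e2.
by rewrite eY char_poly_spectral // -/s e1 cu cv char_poly_Jmx.
Qed.

Lemma refl_mx_class (N : 'M[R]_(u, n)) : (forall x : 'rV_u, x *m N = 0 -> x = 0) ->
  S (refl_mx N) /\ rowsp (1%:M + refl_mx N) = rowsp N.
Proof.
move=> inj; have pG := gram_posdef inj; have uG := posdef_unit pG.
pose P := N^T *m invmx (N *m N^T) *m N.
have PT : P^T = P.
  by rewrite /P !trmx_mul trmxK trmx_inv trmx_mul trmxK mulmxA.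
have NP : N *m P = N by rewrite /P !mulmxA mulmxV // mul1mx.
have PP : P *m P = P by rewrite {1}/P -!mulmxA NP /P !mulmxA.
have trP : \tr P = u%:R.
  by rewrite /P mxtrace_mulC mulmxA mulmxV // mxtrace1.
have rE : refl_mx N = 2 *: P - 1%:M by [].
split.
  apply: involution_class; last first.
    rewrite rE trD trN trZ trP mxtrace1 natrD; ring.
  split; first by rewrite rE linearB /= linearZ /= PT trmx1.
  rewrite rE !(mulmxDl, mulmxDr, mulmxN, mulNmx, =^~ scalemxAl, =^~ scalemxAr) PP !mulmx1 !mul1mx.
  by mxring.
have -> : 1%:M + refl_mx N = 2 *: P by rewrite rE addrC subrK.
apply: (@eq_rowsp _ _ _ _ _ _ (2 *: (N^T *m invmx (N *m N^T))) (2^-1 *: N)).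
  by rewrite -scalemxAl.
by rewrite -scalemxAl -scalemxAr NP scalerA mulVf ?pnatr_eq0 // scale1r.
Qed.

(** Equal row spaces give [(1 + Y) (1 - Y') = 0] and [(1 + Y') (1 - Y) = 0];
    the first minus the transpose of the second reads [2 (Y - Y') = 0]. *)
Lemma rowsp_root_inj Y Y' : S Y -> S Y' -> rowsp (1%:M + Y) = rowsp (1%:M + Y') -> Y = Y'.
Proof.
move=> [[YT YY] _] [[YT' YY'] _] e.
have h (A B : 'M[R]_n) C : B *m B = 1%:M -> 1%:M + A = C *m (1%:M + B) ->
    1%:M + A - B - A *m B = 0.
  move=> BB eA; have : (1%:M + A) *m (1%:M - B) = 0.
    rewrite eA -mulmxA !(mulmxDl, mulmxDr, mulmxN, mulNmx, mulmx1, mul1mx) BB.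
    by rewrite !(mulmxDl, mulmxDr, mulmxN, mulNmx, mulmx1, mul1mx); mxring.
  by rewrite !(mulmxDl, mulmxDr, mulmxN, mulNmx, mulmx1, mul1mx) => <-; mxring.
have [C eC] := rowsp_sub e; have [C' eC'] := rowsp_sub (esym e).
have h1 := h _ _ _ YY' eC; have := congr1 trmx (h _ _ _ YY eC').
rewrite linear0 !linearB /= linearD /= trmx_mul trmx1 YT YT' => h2.
have : 2 *: (Y - Y') = 0.
  by rewrite -[RHS](subrr 0) -{1}h1 -h2; mxring.
by move/eqP; rewrite scaler_eq0 pnatr_eq0 /= subr_eq0 => /eqP.
Qed.

(** [(1 + Y) / 2] is the orthogonal projection onto the eigenspace for 1,
    which has an orthonormal basis. *)
Lemma root_frame Y : S Y -> exists N : 'M[R]_(u, n),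
  N *m N^T = 1%:M /\ 1%:M + Y = 2 *: (N^T *m N).
Proof.
move=> /involution_conj[Q oQ eY]; exists (usubmx Q^T).
have eQ : Q^T = col_mx (usubmx Q^T) (dsubmx Q^T) by rewrite vsubmxK.
have eQT : Q = row_mx (usubmx Q^T)^T (dsubmx Q^T)^T by rewrite -tr_col_mx vsubmxK trmxK.
set N := usubmx Q^T in eQ eQT *; set N' := dsubmx Q^T in eQ eQT *.
have NN : N *m N^T = 1%:M.
  have := congr1 (@ulsubmx R u v u v) (orthV oQ).
  by rewrite [X in X *m _]eQ [X in _ *m X]eQT mul_col_row (scalar_mx_block u v 1) !block_mxKul.
split=> //.
rewrite eY -oQ [X in _ *m X + _]eQ [X in X *m _ + _]eQT [X in _ + X *m _ *m _]eQT.
rewrite [X in _ + _ *m X]eQ /Jmx mul_row_block !mul_row_col !mulmx0 addr0 add0r.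
by rewrite mulmx1 mulmxN mulmx1 mulNmx; mxring.
Qed.

Lemma dim_root Y : S Y -> \dim (rowsp (1%:M + Y)) = u.
Proof.
move=> /root_frame[N [NN ->]].
rewrite (@eq_rowsp _ _ _ _ _ N (2 *: N^T) (2^-1 *: N)).
- by apply: dim_rowsp => x xN; rewrite -[x]mulmx1 -NN mulmxA xN mul0mx.
- by rewrite -scalemxAl.
- by rewrite -scalemxAl -scalemxAr mulmxA NN mul1mx scalerA mulVf ?pnatr_eq0 // scale1r.
Qed.

(** The reflection through a subspace, as the involution with this eigenspace
    for 1. *)
Definition root_of_space (W : {vspace 'rV[R]_n}) : 'M[R]_n :=
  xget 0 [set Y | S Y /\ rowsp (1%:M + Y) = W].

Lemma root_of_rowspK Y : S Y -> root_of_space (rowsp (1%:M + Y)) = Y.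
Proof.
move=> SY.
have [SZ eZ] : [set Z | S Z /\ rowsp (1%:M + Z) = rowsp (1%:M + Y)]
  (root_of_space (rowsp (1%:M + Y))) by apply: xgetPex; exists Y.
exact: rowsp_root_inj eZ.
Qed.

Lemma root_of_rowsp (N : 'M[R]_(u, n)) : (forall x : 'rV_u, x *m N = 0 -> x = 0) ->
  root_of_space (rowsp N) = refl_mx N.
Proof. by move=> /refl_mx_class[SN <-]; rewrite root_of_rowspK. Qed.

Lemma root_of_spaceP W : grassmannian u n W ->
  S (root_of_space W) /\ rowsp (1%:M + root_of_space W) = W.
Proof.
rewrite /grassmannian /= => dW.
have [N [inj eW]] : exists N : 'M[R]_(u, n),
    (forall x : 'rV_u, x *m N = 0 -> x = 0) /\ rowsp N = W.
  by have := rowsp_basis W; rewrite dW.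
rewrite -eW; rewrite root_of_rowsp //; exact: refl_mx_class.
Qed.

Lemma graph_free B (X : 'M[R]_(u, v)) : B \in unitmx ->
  forall x : 'rV_u, x *m (row_mx 1%:M X *m B) = 0 -> x = 0.
Proof.
move=> uB x; rewrite mulmxA => h.
have : x *m row_mx 1%:M X = 0 by rewrite -[LHS](mulmxK uB) h mul0mx.
by rewrite mul_mx_row mulmx1 => /(congr1 lsubmx); rewrite row_mxKl linear0.
Qed.

(** Graph coordinates on the Grassmannian are submanifold charts of the set of
    reflections: the coordinate [X] is recovered from the blocks of [(1 + Y)
    B^-1 = K [1 X]] as [(K^T K)^-1 K^T (K X)]. *)
Lemma grassmannian_chart_emb B : B \in unitmx ->
  submanifold_atlas (u * v) S
    (Param setT (root_of_space \o (grassmannian_param B : 'rV[R]_(u * v) -> _))).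
Proof.
move=> uB.
pose gN (x : 'rV[R]_(u * v)) : 'M[R]_(u, n) := row_mx 1%:M (vec_mx x) *m B.
have -> : root_of_space \o (grassmannian_param B : 'rV[R]_(u * v) -> _) = refl_mx \o gN.
  apply/funext => x /=; rewrite -[limg _]/(rowsp (gN x)).
  by apply: root_of_rowsp; exact: graph_free.
have uG x : gN x *m (gN x)^T \in unitmx.
  by apply/posdef_unit/gram_posdef; exact: graph_free.
have sN x : smooth_at x gN.
  apply: smooth_at_mulmx; last exact: smooth_at_cst.
  apply: smooth_at_mx => i j; case: (split_ordP j) => j' ->.
    under [X in smooth_at _ X]eq_fun do rewrite row_mxEl; exact: smooth_at_cst.
  under [X in smooth_at _ X]eq_fun do rewrite row_mxEr.
  by apply: smooth_at_entry; exact: smooth_at_lin.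
(* [P1 Y] is [K] and [P2 Y] is [K X]; the domain of the chart is where [K^T K]
   is invertible, that is where [K] has full rank. *)
pose P1 Y : 'M[R]_(n, u) := lsubmx ((1%:M + Y) *m invmx B).
pose P2 Y : 'M[R]_(n, v) := rsubmx ((1%:M + Y) *m invmx B).
pose D Y := (P1 Y)^T *m P1 Y.
pose chi Y : 'rV[R]_(u * v) := mxvec (invmx (D Y) *m (P1 Y)^T *m P2 Y).
have sP Y : smooth_at Y (fun Y => (1%:M + Y) *m invmx B).
  apply: smooth_at_mulmx; last exact: smooth_at_cst.
  by apply: smooth_at_add; [exact: smooth_at_cst|exact: smooth_at_id].
have sP1 Y : smooth_at Y P1.
  apply: smooth_at_mx => i j; under [X in smooth_at _ X]eq_fun do rewrite mxE.
  exact: smooth_at_entry.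
have sP2 Y : smooth_at Y P2.
  apply: smooth_at_mx => i j; under [X in smooth_at _ X]eq_fun do rewrite mxE.
  exact: smooth_at_entry.
have sD Y : smooth_at Y D by apply: smooth_at_mulmx => //; exact: smooth_at_trmx.
have schi Y : D Y \in unitmx -> smooth_at Y chi.
  move=> uD; apply: (@smooth_at_comp _ _ _ _ _ _ _ (fun Y => invmx (D Y) *m (P1 Y)^T *m P2 Y) mxvec).
    apply: smooth_at_mulmx => //; apply: smooth_at_mulmx; last exact: smooth_at_trmx.
    exact: smooth_at_invmx.
  exact: (@smooth_at_lin _ _ _ _ _ (@mxvec R u v)).
have PE x : let K := 2 *: ((gN x)^T *m invmx (gN x *m (gN x)^T)) in
    P1 (refl_mx (gN x)) = K /\ P2 (refl_mx (gN x)) = K *m vec_mx x.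
  move=> K.
  have e : (1%:M + refl_mx (gN x)) *m invmx B = row_mx K (K *m vec_mx x).
    rewrite /refl_mx addrC subrK scalemxAl -/K /gN -!mulmxA mulmxV // mulmx1.
    by rewrite mul_mx_row mulmx1.
  by rewrite /P1 /P2 e row_mxKl row_mxKr.
have uDx x : D (refl_mx (gN x)) \in unitmx.
  have [e _] := PE x; rewrite /D e.
  rewrite trmxZ -scalemxAl -scalemxAr scalerA trmx_mul trmxK trmx_inv.
  have -> : (gN x *m (gN x)^T)^T = gN x *m (gN x)^T by rewrite trmx_mul trmxK.
  rewrite -mulmxA [gN x *m (_ *m invmx _)]mulmxA mulmxV // mulmx1.
  by rewrite unitmxZ ?unitmx_inv // unitfE mulf_neq0 // pnatr_eq0.
have chiK x : chi (refl_mx (gN x)) = x.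
  rewrite /chi; have [e1 e2] := PE x; have := uDx x; rewrite /D e2 -e1.
  by rewrite mulmxA -[X in X *m vec_mx x]mulmxA => u0; rewrite mulVmx // mul1mx vec_mxK.
have SN x : S (refl_mx (gN x)) by have [] := refl_mx_class (@graph_free B (vec_mx x) uB).
have pimE : pimage (Param setT (refl_mx \o gN)) = S `&` [set Y | D Y \in unitmx].
  apply/seteqP; split=> [_ [x _ <-]|Y [SY uD]]; first by split; [exact: SN|exact: uDx].
  have [N0 [NN eY]] := root_frame SY.
  pose a := lsubmx (N0 *m invmx B); pose b := rsubmx (N0 *m invmx B).
  have e : (1%:M + Y) *m invmx B = row_mx (2 *: (N0^T *m a)) (2 *: (N0^T *m b)).
    rewrite eY -scalemxAl -mulmxA -[N0 *m invmx B]hsubmxK mul_mx_row -/a -/b.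
    by rewrite scale_row_mx.
  have ua : a \in unitmx.
    move: uD; rewrite /= /D /P1 e row_mxKl trmxZ -scalemxAl -scalemxAr scalerA.
    rewrite trmx_mul trmxK mulmxA -[_ *m N0 *m _]mulmxA NN mulmx1.
    rewrite unitmxZ ?unitfE ?mulf_neq0 ?pnatr_eq0 //.
    by rewrite unitmx_mul => /andP[].
  exists (mxvec (invmx a *m b)) => //=.
  have -> : gN (mxvec (invmx a *m b)) = invmx a *m N0.
    rewrite /gN mxvecK -[N0 in RHS](mulmxKV uB) mulmxA -[N0 *m invmx B]hsubmxK -/a -/b.
    by rewrite mul_mx_row mulVmx.
  rewrite /refl_mx.
  have -> : invmx a *m N0 *m (invmx a *m N0)^T = invmx a *m (invmx a)^T.
    by rewrite trmx_mul !mulmxA -[_ *m N0 *m _]mulmxA NN mulmx1.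
  have ua' : invmx a \in unitmx by rewrite unitmx_inv.
  have uaT : (invmx a)^T \in unitmx by rewrite unitmx_tr.
  have -> : (invmx a *m N0)^T *m invmx (invmx a *m (invmx a)^T) *m (invmx a *m N0) = N0^T *m N0.
    have -> : invmx (invmx a *m (invmx a)^T) = a^T *m a.
      have uu : invmx a *m (invmx a)^T \in unitmx by rewrite unitmx_mul ua'.
      apply: (can_inj (mulKmx uu)); rewrite mulmxV // -!mulmxA [(invmx a)^T *m _]mulmxA.
      by rewrite -trmx_mul mulmxV // trmx1 mul1mx mulVmx.
    rewrite trmx_mul !mulmxA -[N0^T *m _ *m a^T]mulmxA -trmx_mul mulmxV // trmx1 mulmx1.
    by rewrite -[_ *m a *m _]mulmxA mulmxV // mulmx1.
  by rewrite -eY addrC addKr.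
split=> /=; first exact: openT.
- exists [set Y | D Y \in unitmx] => //.
  have -> : [set Y | D Y \in unitmx] = D @^-1` [set A | A \in unitmx] by [].
  by apply: open_comp; [move=> Y _; exact: smooth_at_cont|exact: open_unitmx].
- apply/smooth_onP; first exact: openT.
  move=> x _; apply: smooth_at_sub; last exact: smooth_at_cst.
  apply: smooth_at_scale; first exact: smooth_at_cst.
  apply: smooth_at_mulmx => //; apply: smooth_at_mulmx; first exact: smooth_at_trmx.
  apply: smooth_at_invmx; first exact: uG.
  by apply: smooth_at_mulmx => //; exact: smooth_at_trmx.
- exists chi; last by move=> x _; exact: chiK.
  apply: smooth_subset_at => Y; rewrite pimE => -[_ uD].
  by exists chi; split; [exact: schi|apply: filterE].
Qed.

Local Notation G := (@orthogonal_group R n).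
Local Notation H := (block_orthogonal_group u v).
Local Notation X := (homogeneous_space G H).

(** Both atlases embed as submanifold charts of the class of [J], so the map
    that sends [A H] to the eigenspace of [A J A^T] for 1 and its inverse are
    smooth by [smooth_in_coords_emb]. *)
Lemma homogeneous_grassmannian_diffeo :
  diffeomorphic X (homogeneous_atlas (u * v) G H) (grassmannian u n) (grassmannian_atlas u v).
Proof.
exists (fun c => rowsp (1%:M + @root_of_coset R u v c)).
exists (fun W => @coset_of_root R u v (root_of_space W)).
have XS c : X c -> S (@root_of_coset R u v c) by exact: root_of_coset_class.
have chartX p x : homogeneous_atlas (u * v) G H p -> pdom p x -> X (p x).
  by move=> /homogeneous_chart_emb[pX _] px; apply: pX; exists x.
have chartG B x : B \in unitmx -> grassmannian u n (grassmannian_param B x).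
  move=> uB; rewrite /grassmannian /= -[limg _]/(rowsp (row_mx 1%:M (vec_mx x) *m B)).
  by apply: dim_rowsp; exact: graph_free.
split.
- split=> [c /XS/dim_root//|p _ pA [B uB <-]].
  have [pX [op _ sp _]] := homogeneous_chart_emb pA.
  apply: (@smooth_in_coords_emb _ _ _ _ _ _ _ S _ _ _ (@root_of_coset R u v \o p) root_of_space) => //.
  + move=> x px; have Sx := XS _ (chartX p x pA px).
    by split=> //=; rewrite root_of_rowspK.
  + exact: grassmannian_chart_emb.
  + move=> x y px _; have Sx := XS _ (chartX p x pA px) => e.
    by rewrite -(root_of_spaceP (chartG B y uB)).2 e root_of_rowspK.
- split=> [W /root_of_spaceP[SW _]|_ q [B uB <-] qA].
    by apply/coset_of_rootP; exists (root_of_space W).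
  have [qX sq] := homogeneous_chart_emb qA.
  have [_ _ sp _] := grassmannian_chart_emb uB.
  apply: (@smooth_in_coords_emb _ _ _ _ _ _ _ S _ _ _
    (root_of_space \o (grassmannian_param B : 'rV[R]_(u * v) -> _)) (@root_of_coset R u v)) => //.
  + exact: openT.
  + move=> x _; have [SW _] := root_of_spaceP (chartG B x uB).
    by split=> //=; rewrite coset_of_rootK.
  + move=> x y _ qy; have [SW _] := root_of_spaceP (chartG B x uB).
    rewrite coset_of_rootK // => <-; rewrite root_of_cosetK //; exact: chartX.
- by move=> c Xc; rewrite root_of_rowspK ?root_of_cosetK //; exact: XS.
- move=> W GW; have [SW eW] := root_of_spaceP GW.
  by rewrite coset_of_rootK.
Qed.

End Grassmann.

(** * Splitting a root along the eigenspaces *)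

Section Frame.
Context {R : realType} {n p : nat} (u v : 'I_p -> nat) (s : 'I_p -> R).
Variable e : forall i, 'M[R]_(u i + v i, n).
Hypothesis s_gt0 : forall i, 0 < s i.
Hypothesis s_inj : injective s.
Hypothesis eK : forall i, e i *m (e i)^T = 1%:M.
Hypothesis eO : forall i j, i != j -> e i *m (e j)^T = 0.
Hypothesis e1 : \sum_i (e i)^T *m e i = 1%:M.

(** Block-diagonal matrices with respect to the orthogonal decomposition given
    by the frames [e i]. *)
Definition block_sum (W : forall i, 'M[R]_(u i + v i)) : 'M[R]_n :=
  \sum_i (e i)^T *m W i *m e i.

Definition component (i : 'I_p) (Y : 'M[R]_n) : 'M[R]_(u i + v i) := e i *m Y *m (e i)^T.

Lemma mulmx_block_sum i W : e i *m block_sum W = W i *m e i.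
Proof.
rewrite /block_sum mulmx_sumr (bigD1 i) //= big1 ?addr0 => [|j ji].
  by rewrite !mulmxA eK mul1mx.
by rewrite !mulmxA eO ?mul0mx // eq_sym.
Qed.

Lemma component_block_sum i W : component i (block_sum W) = W i.
Proof. by rewrite /component mulmx_block_sum -mulmxA eK mulmx1. Qed.

Lemma block_sumM W W' : block_sum W *m block_sum W' = block_sum (fun i => W i *m W' i).
Proof.
rewrite {1}/block_sum mulmx_suml; apply: eq_bigr => i _.
by rewrite -mulmxA mulmx_block_sum !mulmxA.
Qed.

Lemma block_sumT W : (block_sum W)^T = block_sum (fun i => (W i)^T).
Proof.
rewrite /block_sum linear_sum; apply: eq_bigr => i _.
by rewrite /= !trmx_mul trmxK mulmxA.
Qed.

Lemma block_sumD W W' : block_sum W + block_sum W' = block_sum (fun i => W i + W' i).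
Proof. by rewrite /block_sum -big_split; apply: eq_bigr => i _; rewrite /= mulmxDr mulmxDl. Qed.

Lemma block_sum0 : block_sum (fun=> 0) = 0.
Proof. by rewrite /block_sum big1 // => i _; rewrite mulmx0 mul0mx. Qed.

Lemma block_sum1 : block_sum (fun=> 1%:M) = 1%:M.
Proof. by rewrite -e1; apply: eq_bigr => i _; rewrite mulmx1. Qed.

Lemma eq_block_sum W W' : (forall i, W i = W' i) -> block_sum W = block_sum W'.
Proof. by move=> h; apply: eq_bigr => i _; rewrite h. Qed.

Definition frame_square := block_sum (fun i => (s i ^+ 2)%:M).
Definition frame_root := block_sum (fun i => s i *: @Jmx R (u i) (v i)).

Lemma SSR_frame_root : SSR frame_square frame_root.
Proof.
split; first by rewrite block_sumT; apply: eq_block_sum => i; rewrite trmxZ Jmx_tr.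
rewrite block_sumM; apply: eq_block_sum => i.
by rewrite -scalemxAl -scalemxAr scalerA Jmx_sq -expr2 scalemx1.
Qed.

(** The off-diagonal blocks of [A] are multiplied by different scalars [s i ^+
    2] on the two sides. *)
Lemma commute_block_sum (A : 'M[R]_n) :
  A *m frame_square = frame_square *m A ->
  A = block_sum (fun i => component i A).
Proof.
move=> AM.
have off i j : i != j -> e i *m A *m (e j)^T = 0.
  move=> ij.
  have h : s i ^+ 2 *: (e i *m A *m (e j)^T) = s j ^+ 2 *: (e i *m A *m (e j)^T).
    have e2 k : e k *m frame_square = s k ^+ 2 *: e k by rewrite mulmx_block_sum mul_scalar_mx.
    have e3 k : frame_square *m (e k)^T = s k ^+ 2 *: (e k)^T.
      rewrite -trmxZ -e2 trmx_mul block_sumT; congr (_ *m _).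
      by apply: eq_block_sum => l; rewrite tr_scalar_mx.
    have l : e i *m frame_square *m A *m (e j)^T = s i ^+ 2 *: (e i *m A *m (e j)^T).
      by rewrite e2 -!scalemxAl.
    have r : e i *m A *m frame_square *m (e j)^T = s j ^+ 2 *: (e i *m A *m (e j)^T).
      by rewrite -[_ *m frame_square *m _]mulmxA e3 -scalemxAr.
    by rewrite -l -r -[e i *m A *m frame_square]mulmxA AM mulmxA.
  apply/eqP; move/eqP: h; rewrite -subr_eq0 -scalerBl scaler_eq0 subr_eq0.
  move=> /orP[|//]; rewrite eqrXn2 ?ltW // => /eqP/s_inj eij.
  by rewrite eij eqxx in ij.
rewrite -[LHS]mulmx1 -e1 mulmx_sumr -[LHS]mul1mx -e1 mulmx_suml /block_sum.
apply: eq_bigr => i _; rewrite mulmx_sumr (bigD1 i) //= big1 ?addr0 => [|j ji].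
  by rewrite /component !mulmxA.
by rewrite -!mulmxA [A *m _]mulmxA [e i *m _]mulmxA [e i *m _]mulmxA off ?mul0mx ?mulmx0 // eq_sym.
Qed.

Lemma componentM i (A B : 'M[R]_n) : A *m frame_square = frame_square *m A ->
  component i (A *m B) = component i A *m component i B.
Proof. by move=> /commute_block_sum {1}->; rewrite /component mulmxA mulmx_block_sum !mulmxA. Qed.

Lemma component_tr i (A : 'M[R]_n) : component i A^T = (component i A)^T.
Proof. by rewrite /component !trmx_mul trmxK mulmxA. Qed.

Lemma component_linear i : linear (component i).
Proof. by move=> a U V; rewrite /component mulmxDr mulmxDl -scalemxAr -scalemxAl. Qed.
HB.instance Definition _ i :=
  GRing.isLinear.Build R 'M[R]_n 'M[R]_(u i + v i) _ (component i)
    (component_linear i).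

Lemma frame_root_commute (A : 'M[R]_n) :
  A *m frame_root = - (frame_root *m A) ->
  A *m frame_square = frame_square *m A.
Proof.
rewrite -SSR_frame_root.2; move: frame_root => Y h.
by rewrite mulmxA h mulNmx -[Y *m A *m Y]mulmxA h mulmxN opprK mulmxA.
Qed.

Local Notation d := (\sum_i u i * v i)%N.

(** A matrix that anticommutes with the root commutes with its square, so it
    is block-diagonal, with blocks that anticommute with the signature
    matrices. *)
Lemma frame_tangent_coord : tangent_coord d frame_root.
Proof.
pose tc i := cid (@Jmx_tangent_coord R (u i) (v i)).
pose L i := projT1 (tc i); pose tc' i := cid (projT2 (tc i)); pose C i := projT1 (tc' i).
have LT i x : tangent_at (@Jmx R (u i) (v i)) (L i x) by have [] := projT2 (tc' i).
have CL i x : C i (L i x) = x by have [] := projT2 (tc' i).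
have LC i V : tangent_at (@Jmx R (u i) (v i)) V -> L i (C i V) = V.
  by have [_ _] := projT2 (tc' i); apply.
pose Lt (x : 'rV[R]_d) := block_sum (fun i => L i (submxrow x i)).
pose Ct (V : 'M[R]_n) : 'rV[R]_d := \mxrow_i C i (component i V).
have linL : linear Lt.
  move=> a x y; rewrite /Lt /block_sum scaler_sumr -big_split; apply: eq_bigr => i _ /=.
  have -> : submxrow (a *: x + y) i = a *: submxrow x i + submxrow y i.
    by apply/matrixP => k l; rewrite !mxE.
  by rewrite linearP mulmxDr mulmxDl -scalemxAr -scalemxAl.
have linC : linear Ct.
  move=> a x y; apply/matrixP => k l; rewrite !mxE.
  by rewrite linearP /= linearP !mxE.
exists (HB.pack Lt (GRing.isLinear.Build _ _ _ _ _ linL) : {linear 'rV[R]_d -> 'M[R]_n}).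
exists (HB.pack Ct (GRing.isLinear.Build _ _ _ _ _ linC) : {linear 'M[R]_n -> 'rV[R]_d}).
split=> [x|x|V [VT VY]] /=.
- split; first by rewrite block_sumT; apply: eq_block_sum => i; have [] := LT i (submxrow x i).
  rewrite !block_sumM block_sumD -block_sum0; apply: eq_block_sum => i; have [_ h] := LT i (submxrow x i).
  by rewrite -scalemxAr -scalemxAl -scalerDr h scaler0.
- rewrite -[RHS]submxrowK; apply/matrixP => k l; rewrite !mxE component_block_sum CL.
  by rewrite !mxE.
- have VY' : V *m frame_root = - (frame_root *m V) by apply/eqP; rewrite -addr_eq0 VY.
  have VM := frame_root_commute VY'.
  rewrite [RHS](commute_block_sum VM); apply: eq_block_sum => i.
  rewrite mxrowK LC //; split; first by rewrite -component_tr VT.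
  have YM : frame_root *m frame_square = frame_square *m frame_root by rewrite -SSR_frame_root.2 mulmxA.
  have := congr1 (component i) VY; rewrite linearD /= !componentM // component_block_sum linear0.
  rewrite -scalemxAr -scalemxAl -scalerDr => /eqP; rewrite scaler_eq0 gt_eqF //=.
  by move/eqP.
Qed.

Local Notation S i := (ssr_class 1%:M (@Jmx R (u i) (v i))).
Definition split_root (Y : 'M[R]_n) i : 'M[R]_(u i + v i) := (s i)^-1 *: component i Y.
Definition join_root (Z : forall i, 'M[R]_(u i + v i)) : 'M[R]_n := block_sum (fun i => s i *: Z i).

Lemma split_join Z i : split_root (join_root Z) i = Z i.
Proof.
by rewrite /split_root /join_root component_block_sum scalerA mulVf ?scale1r // gt_eqF.
Qed.

(** The orthogonal matrix [Q] of [class_conj] commutes with [frame_square],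
    hence is block-diagonal, and its blocks conjugate the signature matrices.
    *)
Lemma split_class Y : ssr_class frame_square frame_root Y ->
  (forall i, S i (split_root Y i)) /\ join_root (split_root Y) = Y.
Proof.
move=> [sY eY]; have [Q [oQ QM -> _]] := class_conj SSR_frame_root sY eY.
have eQ := commute_block_sum QM.
have oQi i : component i Q *m (component i Q)^T = 1%:M.
  have := component_block_sum i (fun i => component i Q *m (component i Q)^T).
  rewrite -block_sumM -block_sumT -eQ oQ /component mulmx1 eK //.
have YE : Q *m frame_root *m Q^T = join_root (fun i => component i Q *m @Jmx R (u i) (v i) *m (component i Q)^T).
  rewrite {1 2}eQ block_sumT !block_sumM; apply: eq_block_sum => i.
  by rewrite -scalemxAr -scalemxAl.
split=> [i|].
  by rewrite YE split_join; apply/involution_conj; exists (component i Q).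
by rewrite YE; apply: eq_block_sum => i; rewrite split_join.
Qed.

Lemma join_class Z : (forall i, S i (Z i)) -> ssr_class frame_square frame_root (join_root Z).
Proof.
move=> SZ; have Qi i := cid2 ((involution_conj _).1 (SZ i)).
pose Q i := s2val (Qi i).
have oQ : block_sum Q *m (block_sum Q)^T = 1%:M.
  by rewrite block_sumT block_sumM -block_sum1; apply: eq_block_sum => i; rewrite (s2valP (Qi i)).
have -> : join_root Z = block_sum Q *m frame_root *m (block_sum Q)^T.
  rewrite block_sumT !block_sumM; apply: eq_block_sum => i.
  by rewrite -scalemxAr -scalemxAl -(s2valP' (Qi i)).
apply: SSR_conj => //; first exact: SSR_frame_root.
rewrite !block_sumM; apply: eq_block_sum => i; exact: scalar_mxC.
Qed.

Local Notation G i := (@orthogonal_group R (u i + v i)).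
Local Notation H i := (@block_orthogonal_group R (u i) (v i)).
Local Notation Q := (fun i => homogeneous_space (G i) (H i)).
Local Notation QA := (fun i => homogeneous_atlas (u i * v i) (G i) (H i)).

Definition root_of_cosets (c : forall i, set 'M[R]_(u i + v i)) : 'M[R]_n :=
  join_root (fun i => root_of_coset (c i)).

Lemma smooth_at_submxrow i (x : 'rV[R]_d) :
  smooth_at x (fun y : 'rV[R]_d => submxrow y i : 'rV[R]_(u i * v i)).
Proof.
apply: smooth_at_mx => k l; under [X in smooth_at _ X]eq_fun do rewrite mxE.
by apply: smooth_at_entry; exact: smooth_at_id.
Qed.

Lemma smooth_at_split i Y : smooth_at Y (fun Y => split_root Y i).
Proof. by apply: smooth_at_scale; [exact: smooth_at_cst|exact: smooth_at_lin]. Qed.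

(** Every ingredient of a submanifold chart (open set, smooth parametrization,
    smooth inverse) is assembled from its blocks. *)
Lemma prod_chart_emb (q : forall i, param R (u i * v i) (set 'M[R]_(u i + v i))) :
  (forall i, QA i (q i)) ->
  submanifold_atlas d (ssr_class frame_square frame_root)
    (Param (pdom (prod_param q)) (root_of_cosets \o prod_param q)).
Proof.
move=> qA.
have qemb i : submanifold_atlas (u i * v i) (S i) (Param (pdom (q i)) (@root_of_coset R (u i) (v i) \o q i)).
  by have [] := homogeneous_chart_emb (qA i).
have near_all (T : topologicalType) (x : T) (P : 'I_p -> T -> Prop) :
    (forall i, \near x, P i x) -> \forall y \near x, forall i, P i y.
  exact: filter_forall.
have Sq i x : pdom (q i) x -> S i (root_of_coset (q i x)).
  by move=> qx; exact: (submanifold_chart_sub (qemb i) qx).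
have oq : open (pdom (prod_param q)).
  rewrite openE => x /= qx.
  suff : \forall y \near x, forall i, pdom (q i) (submxrow y i) by [].
  apply: near_all => i.
  have [oi _ _ _] := qemb i.
  exact: (smooth_at_cont (smooth_at_submxrow i x) (open_nbhs_nbhs (conj oi (qx i)))).
have wch i : exists W : set 'M[R]_(u i + v i), open W /\
    pimage (Param (pdom (q i)) (@root_of_coset R (u i) (v i) \o q i)) = S i `&` W.
  by have [_ [W oW qW] _ _] := qemb i; exists W.
pose W i := projT1 (cid (wch i)); have WP i := projT2 (cid (wch i)).
have cch i : exists chi : 'M[R]_(u i + v i) -> 'rV[R]_(u i * v i),
   smooth_subset (pimage (Param (pdom (q i)) (@root_of_coset R (u i) (v i) \o q i))) chi /\
   forall x, pdom (q i) x -> chi (root_of_coset (q i x)) = x.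
  by have [_ _ _ [chi ? ?]] := qemb i; exists chi.
pose chi i := projT1 (cid (cch i)); have cP i := projT2 (cid (cch i)).
have pimE : pimage (Param (pdom (prod_param q)) (root_of_cosets \o prod_param q)) =
    ssr_class frame_square frame_root `&` [set Y | forall i, W i (split_root Y i)].
  apply/seteqP; split=> [_ [x /= qx <-]|Y [SY WY]].
    split; first by apply: join_class => i; exact: Sq.
    move=> i; rewrite split_join; have [_ pW] := WP i.
    have h : pimage (Param (pdom (q i)) (@root_of_coset R (u i) (v i) \o q i))
        (root_of_coset (q i (submxrow x i))).
      by exists (submxrow x i) => //; exact: qx.
    by move: h; rewrite pW => -[].
  have [SYi eY] := split_class SY.
  have xch i : exists x, pdom (q i) x /\ root_of_coset (q i x) = split_root Y i.
    have [_ pW] := WP i; have : (S i `&` projT1 (cid (wch i))) (split_root Y i) by split=> //; exact: WY.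
    by rewrite -pW => -[x px /= <-]; exists x.
  pose x i := projT1 (cid (xch i)); have xP i := projT2 (cid (xch i)).
  exists (\mxrow_i x i) => /=; first by move=> i; rewrite mxrowK; have [] := xP i.
  rewrite -eY /root_of_cosets; apply: eq_block_sum => i /=.
  by rewrite mxrowK; have [_ ->] := xP i.
split.
- exact: oq.
- exists [set Y | forall i, W i (split_root Y i)]; last exact: pimE.
  rewrite openE => Y WY.
  suff : \forall Z \near Y, forall i, W i (split_root Z i) by [].
  apply: near_all => i; have [oW _] := WP i.
  exact: (smooth_at_cont (smooth_at_split i Y) (open_nbhs_nbhs (conj oW (WY i)))).
- apply/smooth_onP => // x qx; apply: smooth_at_sum => i.
  apply: smooth_at_mulmx; last exact: smooth_at_cst.
  apply: smooth_at_mulmx; first exact: smooth_at_cst.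
  apply: smooth_at_scale; first exact: smooth_at_cst.
  have [oi _ si _] := qemb i.
  exact: (smooth_at_comp (smooth_at_submxrow i x) ((smooth_onP _ oi).1 si _ (qx i))).
- exists (fun Y => \mxrow_i chi i (split_root Y i)); last first.
    move=> x qx; rewrite -[RHS]submxrowK; apply/eq_mxrow => i /=.
    by rewrite split_join; have [_ h] := cP i; exact: (h _ (qx i)).
  apply: smooth_subset_at => Y; rewrite pimE => -[SY WY].
  have [SYi eY] := split_class SY.
  have Pi i : pimage (Param (pdom (q i)) (@root_of_coset R (u i) (v i) \o q i)) (split_root Y i).
    by have [_ ->] := WP i; split; [exact: SYi|exact: WY].
  have gch i := cid (smooth_subsetE (cP i).1 (Pi i)).
  pose g i := projT1 (gch i).
  exists (fun Z => \mxrow_i g i (split_root Z i)); split.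
    apply: smooth_at_mx => k l; under [X in smooth_at _ X]eq_fun do rewrite mxE.
    apply: smooth_at_entry; have [sg _] := projT2 (gch (tagnat.sig1 l)).
    exact: (smooth_at_comp (smooth_at_split _ Y) sg).
  have h : \forall Z \near Y, forall i,
     pimage (Param (pdom (q i)) (@root_of_coset R (u i) (v i) \o q i)) (split_root Z i) ->
     chi i (split_root Z i) = g i (split_root Z i).
    apply: near_all => i; have [_ cg] := projT2 (gch i).
    exact: (smooth_at_cont (smooth_at_split i Y) cg).
  apply: filterS h => Z hZ [SZ WZ]; apply/eq_mxrow => i; apply: hZ.
  have [SZi _] := split_class SZ.
  by have [_ ->] := WP i; split; [exact: SZi|exact: WZ].
Qed.

(** In each eigenspace the block of a root, divided by [s i], is an
    involution, and so corresponds to a coset. *)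
Lemma frame_diffeo :
  diffeomorphic (ssr_class frame_square frame_root)
    (submanifold_atlas d (ssr_class frame_square frame_root))
    (prod_set Q) (prod_atlas QA).
Proof.
pose f Y i := @coset_of_root R (u i) (v i) (split_root Y i).
exists f, root_of_cosets.
have fQ Y : ssr_class frame_square frame_root Y -> prod_set Q (f Y).
  move=> SY i; have [SYi _] := split_class SY.
  by apply/coset_of_rootP; exists (split_root Y i).
have gf Y : ssr_class frame_square frame_root Y -> root_of_cosets (f Y) = Y.
  move=> SY; have [SYi {2}<-] := split_class SY.
  by apply: eq_block_sum => i; rewrite /f coset_of_rootK.
have fg c : prod_set Q c -> f (root_of_cosets c) = c.
  move=> Qc; apply: functional_extensionality_dep => i.
  by rewrite /f split_join root_of_cosetK //; exact: Qc.
have gQ c : prod_set Q c -> ssr_class frame_square frame_root (root_of_cosets c).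
  by move=> Qc; apply: join_class => i; exact/root_of_coset_class/Qc.
have qQ q x : (forall i, QA i (q i)) -> pdom (prod_param q) x -> prod_set Q (prod_param q x).
  move=> qA qx i; have [qX _] := homogeneous_chart_emb (qA i).
  by apply: qX; exists (submxrow x i) => //; exact: qx.
split=> //.
- split=> // r _ rA [q qA ->]; have [opr _ sr _] := rA.
  apply: (@smooth_in_coords_emb _ _ _ _ _ _ _ (ssr_class frame_square frame_root) _ _ _ (pfun r) root_of_cosets) => //.
  + move=> x rx; have Sx := submanifold_chart_sub rA rx.
    by split=> //; rewrite gf.
  + exact: prod_chart_emb.
  + move=> x y rx qy; have Sx := submanifold_chart_sub rA rx.
    rewrite gf // => er; rewrite -er fg //; exact: qQ.
- split=> // _ r [q qA ->] rA; have [oq _ sq _] := prod_chart_emb qA.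
  apply: (@smooth_in_coords_emb _ _ _ _ _ _ _ (ssr_class frame_square frame_root) _ _ _
    (root_of_cosets \o prod_param q) id).
  exact: oq.
  exact: sq.
  move=> x qx.
  have h := gQ _ (qQ q x qA qx).
  split.
    exact: h.
  reflexivity.
  (* [r] and [Param (pdom r) (id \o r)] agree up to eta expansion. *)
  by move: rA; case: (r).
  by [].
Qed.

End Frame.

(** * Roots of a matrix with given eigenvalues *)

(** Each fibre of [c] is enumerated by an ordinal of its size [w i], which is
    the form in which the rows of a frame are indexed. *)
Lemma sum_fibers (T : Type) (idx : T) (op : Monoid.com_law idx) (n p : nat)
    (c : 'I_n -> 'I_p) (w : 'I_p -> nat)
    (wE : forall i, w i = #|[pred j | c j == i]|) (F : 'I_p -> 'I_n -> T) :
  \big[op/idx]_i \big[op/idx]_(k < w i) F i (enum_val (cast_ord (wE i) k)) =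
  \big[op/idx]_j F (c j) j.
Proof.
rewrite [RHS](partition_big c xpredT) //=; apply: eq_bigr => i _.
transitivity (\big[op/idx]_(j | c j == i) F i j); last first.
  by apply: eq_bigr => j /eqP ->.
rewrite (eq_bigl (fun j => j \in [pred j | c j == i])) // [RHS]big_enum_val.
rewrite [RHS](reindex (cast_ord (wE i))) //=.
by exists (cast_ord (esym (wE i))) => k _; rewrite ?cast_ordK ?cast_ordKV.
Qed.

Lemma count_nat_sum (T : Type) (a : pred T) (n : nat) (f : 'I_n -> T) :
  count a [seq f j | j <- enum 'I_n] = (\sum_j a (f j))%N.
Proof.
rewrite -sum1_count big_map big_enum_cond /= big_mkcond.
by apply: eq_bigr => j _; case: (a _).
Qed.

Section Diagonal.
Context {R : realType} (n p : nat) (M : 'M[R]_n) (lam : 'I_p -> R) (h : 'I_p -> nat).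
Hypothesis Mpos : symmetric_posdef M.
Hypothesis lam_incr : forall i j : 'I_p, (i < j)%N -> lam i < lam j.
Hypothesis lam_eigen : forall a : R, eigenvalue M a <-> exists i, a = lam i.
Hypothesis h_mult : forall i, eigen_multiplicity M (lam i) = h i.

Local Notation s := (fun i => Num.sqrt (lam i)).

Lemma lam_inj : injective lam.
Proof.
move=> i j e; apply: val_inj; case: (ltngtP i j) => // /lam_incr; by rewrite e ltxx.
Qed.

Lemma eigenvalue_spectral (P : 'M[R]_n) (d : 'rV[R]_n) j : P *m P^T = 1%:M ->
  M = P^T *m diag_mx d *m P -> exists i, d 0 j = lam i.
Proof.
move=> oP eM; apply/lam_eigen; rewrite eigenvalue_root_char eM char_poly_spectral //.
by rewrite root_prod_XsubC; apply: map_f; rewrite mem_enum.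
Qed.

Lemma lam_gt0 i : 0 < lam i.
Proof.
have /eigenvalueP[x xM x0] := (lam_eigen (lam i)).2 (ex_intro _ i erefl).
have := Mpos.2 x x0; rewrite xM -scalemxAl mxE.
have : 0 <= (x *m x^T) 0 0 by rewrite mxE sumr_ge0 // => k _; rewrite mxE -expr2 sqr_ge0.
by move=> h1 h2; rewrite ltNge; apply/negP => l0; move: h2; rewrite ltNge mulr_le0_ge0.
Qed.

Lemma s_gt0 i : 0 < s i. Proof. by rewrite sqrtr_gt0 lam_gt0. Qed.

Lemma s_sq i : s i ^+ 2 = lam i. Proof. by rewrite sqr_sqrtr // ltW // lam_gt0. Qed.

Lemma s_inj : injective s.
Proof. by move=> i j /= e; apply: lam_inj; rewrite -(s_sq i) -(s_sq j) /= e. Qed.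

Lemma sNs i j : (s i == - s j) = false.
Proof.
apply/eqP => e; have := s_gt0 i.
by rewrite e oppr_gt0 => /(lt_trans (s_gt0 j)); rewrite ltxx.
Qed.

(** Each eigenvalue of a root squares to an eigenvalue of [M], and the
    multiplicity of the latter counts both of its square roots. *)
Lemma root_spectrum Y : SSR M Y -> exists t : seq R,
  [/\ char_poly Y = \prod_(x <- t) ('X - x%:P),
      forall x, x \in t -> exists i, x = s i \/ x = - s i &
      forall i, h i = (count_mem (s i) t + count_mem (- s i) t)%N].
Proof.
move=> [YT YY]; have [P [d [oP eY]]] := real_spectral YT.
exists [seq d 0 j | j <- enum 'I_n].
have eM : M = P^T *m diag_mx (\row_j d 0 j ^+ 2) *m P.
  rewrite -YY eY !mulmxA -[_ *m P *m P^T]mulmxA oP mulmx1 -[_ *m diag_mx d *m diag_mx d]mulmxA.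
  by rewrite mulmx_diag; congr (_ *m diag_mx _ *m _); apply/rowP => j; rewrite !mxE expr2.
have rt x i : x ^+ 2 = lam i -> x = s i \/ x = - s i.
  move=> e; have : (x == s i) || (x == - s i) by rewrite -eqf_sqr e s_sq.
  by case/orP=> /eqP; [left|right].
split.
- by rewrite eY char_poly_spectral.
- move=> _ /mapP[j _ ->]; have [k] := eigenvalue_spectral j oP eM.
  by rewrite mxE => /rt; exists k.
- move=> i; rewrite -h_mult /eigen_multiplicity eM char_poly_spectral // mu_prod_XsubC.
  rewrite (_ : [seq _ | j <- _] = [seq x ^+ 2 | x <- [seq d 0 j | j <- enum 'I_n]]); last first.
    by rewrite -[RHS]map_comp; apply: eq_map => j /=; rewrite mxE.
  rewrite count_map; elim: [seq _ | _ <- _] => //= x t ->.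
  rewrite -{1}(s_sq i) eqf_sqr addnACA; congr (_ + _)%N.
  by case: eqP => [->|_] //; rewrite sNs.
Qed.

Lemma root_mult_le Y i : SSR M Y ->
  (eigen_multiplicity Y (s i) <= h i)%N /\
  eigen_multiplicity Y (- s i) = (h i - eigen_multiplicity Y (s i))%N.
Proof.
move=> /root_spectrum[t [e _ hE]].
by rewrite /eigen_multiplicity e !mu_prod_XsubC hE leq_addr addKn.
Qed.

(** The multiplicities of the negative eigenvalues are determined as
    complements in [h i]. *)
Lemma same_mult_char_poly Y Y' : SSR M Y -> SSR M Y' ->
  (forall i, eigen_multiplicity Y (s i) = eigen_multiplicity Y' (s i)) ->
  char_poly Y = char_poly Y'.
Proof.
move=> sY sY' e.
have [t [et tE _]] := root_spectrum sY; have [t' [et' tE' _]] := root_spectrum sY'.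
have eN i : eigen_multiplicity Y (- s i) = eigen_multiplicity Y' (- s i).
  by have [_ ->] := root_mult_le i sY; have [_ ->] := root_mult_le i sY'; rewrite e.
rewrite et et'; apply: perm_big; apply/allP => x xt /=; apply/eqP.
have [i xi] : exists i, x = s i \/ x = - s i.
  by move: xt; rewrite mem_cat => /orP[/tE|/tE'].
move: (e i) (eN i); rewrite /eigen_multiplicity et et' !mu_prod_XsubC.
by case: xi => ->.
Qed.

Variable u : 'I_p -> nat.
Hypothesis u_le : forall i, (u i <= h i)%N.
Local Notation v := (fun i => h i - u i)%N.

(** Orthonormal bases of the eigenspaces of [M], split after the [u i]-th
    vector, give a root with multiplicities [u i]. The eigenvectors of an
    orthonormal eigenbasis of [M] are grouped by eigenvalue; [sg] gives the
    sign to each of them, according to its rank in its group. *)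
Lemma eigen_frame : exists e : forall i, 'M[R]_(u i + v i, n),
  [/\ forall i, e i *m (e i)^T = 1%:M,
      forall i j, i != j -> e i *m (e j)^T = 0,
      \sum_i (e i)^T *m e i = 1%:M,
      frame_square s e = M &
      exists t : seq R, [/\ char_poly (frame_root s e) = \prod_(x <- t) ('X - x%:P),
        forall i, count_mem (s i) t = u i,
        count (fun x => 0 < x) t = (\sum_i u i)%N &
        count (fun x => x < 0) t = (n - \sum_i u i)%N]].
Proof.
have [P [m [oP eM]]] := real_spectral Mpos.1.
have oP' := orthV oP.
pose c j := projT1 (cid (eigenvalue_spectral j oP eM)).
have cE j : m 0 j = lam (c j) := projT2 (cid (eigenvalue_spectral j oP eM)).
have wE i : (u i + v i)%N = #|[pred j | c j == i]|.
  rewrite subnKC // -h_mult /eigen_multiplicity eM char_poly_spectral // mu_prod_XsubC.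
  rewrite count_nat_sum -sum1_card [RHS]big_mkcond; apply: eq_bigr => j _ /=.
  by rewrite cE (inj_eq lam_inj) inE; case: eqP.
pose f i (k : 'I_(u i + v i)) : 'I_n := enum_val (cast_ord (wE i) k).
have cf i k : c (f i k) = i by have := enum_valP (cast_ord (wE i) k); rewrite inE => /eqP.
have f_inj i : injective (f i) by move=> k l /enum_val_inj/cast_ord_inj.
pose e i : 'M[R]_(u i + v i, n) := \matrix_(k, l) P (f i k) l.
(* [c j] is the index of the eigenvalue of the [j]-th eigenvector and [f i]
   enumerates the eigenvectors for [lam i]. *)
pose sg i j : R := if (index j (enum [pred j | c j == i]) < u i)%N then 1 else -1.
have sgE i k : sg i (f i k) = if (k < u i)%N then 1 else -1.
  rewrite /sg /f (enum_val_nth (f i k)) index_uniq ?enum_uniq //.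
  by rewrite -cardE; exact: (ltn_ord (cast_ord (wE i) k)).
have JE i k l : @Jmx R (u i) (v i) k l = (if (k < u i)%N then 1 else -1) *+ (k == l).
  rewrite Jmx_diag mxE; congr (_ *+ _).
  by case: (split_ordP k) => k' ->; rewrite ?row_mxEl ?row_mxEr mxE /= ?ltn_ord // ltnNge leq_addr.
have blkE (a : 'I_p -> 'I_n -> R) :
    block_sum e (fun i => \matrix_(k, l) (a i (f i k) *+ (k == l))) =
    P^T *m diag_mx (\row_j a (c j) j) *m P.
  apply/matrixP => x y; rewrite spectral_entry /block_sum summxE.
  pose F i j := a i j * P j x * P j y.
  rewrite (eq_bigr (fun j => F (c j) j)) => [|j _]; last by rewrite mxE.
  rewrite -(sum_fibers _ wE F); apply: eq_bigr => i _; rewrite -mulmxA mxE.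
  apply: eq_bigr => k _; rewrite !mxE (bigD1 k) //= big1 ?addr0 => [|l lk].
    by rewrite !mxE eqxx mulr1n mulrA [P _ x * _]mulrC.
  by rewrite !mxE eq_sym (negbTE lk) mul0r.
pose t := [seq s (c j) * sg (c j) j | j <- enum 'I_n].
have eY : frame_root s e = P^T *m diag_mx (\row_j (s (c j) * sg (c j) j)) *m P.
  rewrite -(blkE (fun i j => s i * sg i j)); apply: eq_block_sum => i.
  by apply/matrixP => k l; rewrite scalemxE JE [RHS]mxE sgE mulrnAr.
(* The eigenvalues of a root are nonzero, so the negative ones are counted as
   those that are not positive. *)
have t0 x : x \in t -> (0 < x) = ~~ (x < 0).
  move=> /mapP[j _ ->]; rewrite /sg; case: ifP => _; rewrite ?mulr1 ?mulrN1.
    by rewrite s_gt0 ltNge ltW // s_gt0.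
  by rewrite oppr_gt0 oppr_lt0 s_gt0 ltNge ltW // s_gt0.
have cnt (a : pred R) : count a t = (\sum_i (u i * a (s i) + v i * a (- s i)))%N.
  rewrite count_nat_sum.
  pose F i j : nat := a (s i * sg i j).
  rewrite (eq_bigr (fun j => F (c j) j)) // -(sum_fibers _ wE F); apply: eq_bigr => i _.
  rewrite big_split_ord /=; congr (_ + _)%N.
    rewrite (eq_bigr (fun=> (a (s i) : nat))) ?sum_nat_const ?card_ord // => k _.
    by rewrite /F -/(f i _) sgE /= ltn_ord mulr1.
  rewrite (eq_bigr (fun=> (a (- s i) : nat))) ?sum_nat_const ?card_ord // => k _.
  by rewrite /F -/(f i _) sgE /= ltnNge leq_addr mulrN1.
have cpos : count (fun x => 0 < x) t = (\sum_i u i)%N.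
  rewrite cnt; apply: eq_bigr => i _.
  by rewrite s_gt0 oppr_gt0 ltNge ltW ?s_gt0 // muln1 muln0 addn0.
exists e; split.
- move=> i; apply/matrixP => k l; have /matrixP/(_ (f i k) (f i l)) := oP.
  rewrite !mxE (inj_eq (@f_inj i)) => <-; apply: eq_bigr => x _; by rewrite !mxE.
- move=> i j ij; apply/matrixP => k l; have /matrixP/(_ (f i k) (f j l)) := oP.
  rewrite !mxE; have /negbTE -> : f i k != f j l.
    by apply: contra ij => /eqP fe; rewrite -(cf i k) fe cf.
  by move=> PP0; apply: etrans PP0; apply: eq_bigr => x _; rewrite !mxE.
- transitivity (block_sum e (fun i => \matrix_(k, l) ((fun _ _ => 1 : R) i (f i k) *+ (k == l)))).
    apply: eq_bigr => i _; rewrite (_ : \matrix_(_, _) _ = 1%:M) ?mulmx1 //.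
    by apply/matrixP => k l; rewrite !mxE.
  rewrite (blkE (fun _ _ => 1)) (_ : \row__ _ = const_mx 1); last by apply/rowP => j; rewrite !mxE.
  by rewrite diag_const_mx mulmx1.
- rewrite eM (_ : m = \row_j (fun i _ => lam i) (c j) j); last by apply/rowP => j; rewrite mxE cE.
  rewrite -(blkE (fun i _ => lam i)); apply: eq_block_sum => i.
  by apply/matrixP => k l; rewrite !mxE s_sq.
- exists t; split => //.
  + rewrite eY char_poly_spectral //; congr (\prod_(_ <- _) _).
    by apply: eq_map => j; rewrite mxE.
  + move=> i; rewrite cnt (bigD1 i) //= big1 ?addn0 => [|j ji].
      by rewrite eqxx eq_sym sNs muln1 muln0 addn0.
    by rewrite (inj_eq s_inj) (negbTE ji) eq_sym sNs !muln0.
  + rewrite -cpos -[X in (X - _)%N](size_enum_ord n) -(size_map (fun j => s (c j) * sg (c j) j)) -/t.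
    rewrite -(count_predC (fun x => 0 < x) t) addKn; apply: eq_in_count => x xt /=.
    by rewrite t0 // negbK.
Qed.

Lemma SSR_mult_frame (e : forall i, 'M[R]_(u i + v i, n)) (t : seq R) :
  SSR M (frame_root s e) -> char_poly (frame_root s e) = \prod_(x <- t) ('X - x%:P) ->
  (forall i, count_mem (s i) t = u i) ->
  ssr_class M (frame_root s e) = SSR_mult M lam h u.
Proof.
move=> sY et ct.
have mY i : eigen_multiplicity (frame_root s e) (s i) = u i.
  by rewrite /eigen_multiplicity et mu_prod_XsubC.
apply/seteqP; split=> Y.
  move=> [sY' eY]; split=> // i; have [_ mN] := root_mult_le i sY'.
  have mi : eigen_multiplicity Y (s i) = u i by rewrite -mY /eigen_multiplicity eY.
  by rewrite mN mi.
move=> [sY' mE]; split=> //; apply: same_mult_char_poly => // i.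
by have [-> _] := mE i; rewrite mY.
Qed.

End Diagonal.

Theorem theorem3p4 (R : realType) (n p : nat) (M : 'M[R]_n)
    (lam : 'I_p -> R) (h : 'I_p -> nat)
    (Mpos : symmetric_posdef M)
    (lam_incr : forall i j : 'I_p, (i < j)%N -> lam i < lam j)
    (lam_eigen : forall a : R, eigenvalue M a <-> exists i, a = lam i)
    (h_mult : forall i, eigen_multiplicity M (lam i) = h i) :
  (* (a) *)
  (forall u : 'I_p -> nat, (forall i, (u i <= h i)%N) ->
   let v := fun i => (h i - u i)%N in
   let d := (\sum_i u i * v i)%N in
   let Q := fun i => homogeneous_space (@orthogonal_group R (u i + v i))
                       (block_orthogonal_group (u i) (v i)) in
   let QA := fun i => homogeneous_atlas (u i * v i)
                        (@orthogonal_group R (u i + v i))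
                        (block_orthogonal_group (u i) (v i)) in
   [/\ embedded_submanifold d (SSR_mult M lam h u)
         (sym_signature n (\sum_i u i)),
       forall i, smooth_manifold (Q i) (QA i),
       diffeomorphic (SSR_mult M lam h u)
         (submanifold_atlas d (SSR_mult M lam h u))
         (prod_set Q) (prod_atlas QA)
     & forall i, diffeomorphic (Q i) (QA i)
         (grassmannian (u i) (u i + v i))
         (grassmannian_atlas (u i) (v i))]) /\
  (* (b) *)
  [set connected_component (SSR M) Y | Y in SSR M] =
    [set SSR_mult M lam h u | u in [set u | forall i, (u i <= h i)%N]] /\
  (forall u : 'I_p -> nat, (forall i, (u i <= h i)%N) ->
   let d := (\sum_i u i * (h i - u i))%N in
   [/\ compact (SSR_mult M lam h u),
       semi_riemannian_submanifold (GLn n) trace_metric d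
         (SSR_mult M lam h u),
       totally_geodesic (GLn n) trace_metric d (SSR_mult M lam h u)
     & homogeneous trace_metric d (SSR_mult M lam h u)]).
Proof.
pose s i := Num.sqrt (lam i).
have s0 := s_gt0 Mpos lam_eigen; have sI := s_inj Mpos lam_incr lam_eigen.
have pkg (u : 'I_p -> nat) : (forall i, (u i <= h i)%N) ->
   exists e : forall i, 'M[R]_(u i + (h i - u i), n),
   [/\ SSR M (frame_root s e), tangent_coord (\sum_i u i * (h i - u i)) (frame_root s e),
       ssr_class M (frame_root s e) = SSR_mult M lam h u,
       ssr_class M (frame_root s e) `<=` sym_signature n (\sum_i u i) &
       diffeomorphic (ssr_class M (frame_root s e))
         (submanifold_atlas (\sum_i u i * (h i - u i)) (ssr_class M (frame_root s e)))
         (prod_set (fun i => homogeneous_space (@orthogonal_group R (u i + (h i - u i)))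
                       (block_orthogonal_group (u i) (h i - u i))))
         (prod_atlas (fun i => homogeneous_atlas (u i * (h i - u i))
                        (@orthogonal_group R (u i + (h i - u i)))
                        (block_orthogonal_group (u i) (h i - u i))))].
  move=> u_le.
  have [e [eK eO e1 eM [t [et ct cp cn]]]] := eigen_frame Mpos lam_incr lam_eigen h_mult u_le.
  exists e.
  have sY : SSR M (frame_root s e) by rewrite -eM; exact: SSR_frame_root.
  split => //.
  - exact: (frame_tangent_coord s0 sI eK eO e1).
  - exact: (SSR_mult_frame Mpos lam_eigen h_mult sY et ct).
  - by move=> Y [[YT _] eY]; split=> //; exists t; split=> //; rewrite eY et.
  - have := frame_diffeo s0 sI eK eO e1; rewrite eM; exact.
split; last split.
- move=> u u_le v d Q QA; have [e [sY tY eS sub dif]] := pkg u u_le.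
  split.
  + by rewrite -eS; exact: class_embedded.
  + by move=> i; exact: homogeneous_manifold.
  + by rewrite -eS; exact: dif.
  + by move=> i; exact: homogeneous_grassmannian_diffeo.
- apply/seteqP; split=> [_ [Y sY <-]|_ [u u_le <-]].
    pose u i := eigen_multiplicity Y (s i).
    have hu i := root_mult_le Mpos lam_eigen h_mult i sY.
    have u_le i : (u i <= h i)%N by have [] := hu i.
    exists u => //; rewrite class_component //.
    have [e [sY0 _ eS _ _]] := pkg u u_le.
    rewrite -eS; apply/esym/ssr_class_eq; rewrite eS; split=> // i.
    by have [_ ->] := hu i.
  have [e [sY0 _ eS _ _]] := pkg u u_le.
  by exists (frame_root s e) => //; rewrite class_component.
- move=> u u_le d; have [e [sY tY eS _ _]] := pkg u u_le; rewrite -eS; split.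
  + exact: class_compact.
  + exact: class_semi_riemannian.
  + exact: class_totally_geodesic.
  + exact: class_homogeneous.
Qed.
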